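(* Let $d\ge3$ and let $p_c$ be the critical probability of $T_d\Box\mathbb{Z}$. Then $$\alpha(p_c)=\frac{1}{d-1}.$$
   Context: $T_d$ is the $d$-regular tree with a fixed root (origin), and $T_d\Box\mathbb{Z}$ is its Cartesian product with the line $\mathbb{Z}$; vertices are pairs $(x,k)$ with $x\in T_d$, $k\in\mathbb{Z}$, and $o=(\text{root},0)$. In Bernoulli bond percolation with parameter $p\in[0,1]$ each edge is independently open with probability $p$ and closed otherwise; $\mathbb{P}_p$ is the associated probability measure. Clusters are the connected components of the subgraph of open edges. $p_c=\inf\{p\in[0,1]: \text{there exists an infinite cluster almost surely}\}$. For vertices $x,y$, $(x\leftrightarrow y)$ is the event that there is an open path between $x$ and $y$. Define $$\alpha(p)=\lim_{n\to\infty}\mathbb{P}_p(o\leftrightarrow(v_n,0))^{1/n}=\sup_{n\ge1}\mathbb{P}_p(o\leftrightarrow(v_n,0))^{1/n},$$ where $v_n$ is any vertex of $T_d$ at distance $n$ from the root (the value does not depend on the choice; the limit exists and equals the supremum by supermultiplicativity). *)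

(* Defs.v *)
From HB Require Import structures.
From mathcomp Require Import all_boot all_order all_algebra.
From mathcomp Require Import finmap.
From mathcomp Require Import all_classical all_reals all_analysis.
From mathcomp Require Import measurable_realfun.
From mathcomp Require Import ring lra zify.
Set Implicit Arguments.
Unset Strict Implicit.
Unset Printing Implicit Defensive.
Import Order.TTheory GRing.Theory Num.Theory.
Import numFieldNormedType.Exports.
Local Open Scope classical_set_scope.
Local Open Scope ring_scope.

Section Graphs.
Local Open Scope nat_scope.
Variables (V : eqType) (adj : rel V).

Definition at_distance (x y : V) (n : nat) : Prop :=
  (exists s, [/\ path adj x s, last x s = y & size s = n]) /\
  (forall s, path adj x s -> last x s = y -> n <= size s).

Definition regular_tree (d : nat) : Prop :=
  [/\ symmetric adj, irreflexive adj,
      forall x, exists s : seq V,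
        [/\ uniq s, size s = d & forall y, adj x y = (y \in s)] &
      forall x y, exists! s, [/\ path adj x s, uniq (x :: s) & last x s = y]].

End Graphs.

Definition box (V W : eqType) (adjV : rel V) (adjW : rel W) : rel (V * W) :=
  fun x y => (x.1 == y.1) && adjW x.2 y.2 || adjV x.1 y.1 && (x.2 == y.2).

Definition adjZ : rel int := fun k l => (l == k + 1)%R || (k == l + 1)%R.

(* The [d]-regular tree is realized as the Cayley graph of the free product of
   [d] copies of Z/2Z: vertices are reduced words, and two vertices are adjacent
   when one word is the tail of the other. *)
Section Tree.
Local Open Scope nat_scope.
Variable d : nat.

Record tree : Type := Word {
  letters : seq 'I_d;
  letters_reduced : sorted (fun a b => a != b) letters }.

HB.instance Definition _ := [isSub for letters].
HB.instance Definition _ := [Countable of tree by <:].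

Definition tree_root : tree := @Word [::] isT.

Definition adjT : rel tree := fun x y =>
  (letters x != [::]) && (behead (letters x) == letters y) ||
  (letters y != [::]) && (behead (letters y) == letters x).

Let child (x y : tree) := (letters y != [::]) && (behead (letters y) == letters x).

Let adjTE x y : adjT x y = child y x || child x y. Proof. by []. Qed.

Let childP x y : child x y -> exists a, letters y = a :: letters x.
Proof. by rewrite /child; case: (letters y) => // a s /eqP /= ->; exists a. Qed.

Let childE x y a : letters y = a :: letters x -> child x y.
Proof. by rewrite /child => ->; rewrite /= eqxx. Qed.

Let adjT_sym : symmetric adjT.
Proof. by move=> x y; rewrite /adjT orbC. Qed.

Let adjT_irr : irreflexive adjT.
Proof.
move=> x; rewrite adjTE orbb; apply/negP => /childP[a /(congr1 size)] /=; lia.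
Qed.

Let suffix_cons (c : seq 'I_d) a z : suffix c (a :: z) = (c == a :: z) || suffix c z.
Proof.
apply/idP/orP => [/suffixP[[|b u] /= e]|[/eqP->|/suffixP[u ->]]].
- by left; rewrite e.
- by case: e => _ ->; right; apply: suffix_suffix.
- exact: suffix_refl.
- by rewrite -cat_cons; apply: suffix_suffix.
Qed.

Let step (c z z' : tree) : adjT z z' ->
  suffix (letters c) (letters z) = suffix (letters c) (letters z') \/
  (child z c /\ z' = c) \/ (child z' c /\ z = c).
Proof.
rewrite adjTE => /orP[] zz'; have [a e] := childP zz'; rewrite e suffix_cons;
  case: eqP => /= [ce|]; try by left.
- by right; right; split; [apply: (childE (a := a))|apply: val_inj; rewrite /= e].
- by right; left; split; [apply: (childE (a := a))|apply: val_inj; rewrite /= e].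
Qed.

Let child_inj x x' c : child x c -> child x' c -> x = x'.
Proof. by move=> /childP[a e] /childP[b]; rewrite e => -[_ /val_inj]. Qed.

Let branch (x c z : tree) s : child x c -> path adjT z s -> x \notin z :: s ->
  suffix (letters c) (letters z) = suffix (letters c) (letters (last z s)).
Proof.
move=> xc; elim: s z => //= z' s IH z /andP[zz' zs].
rewrite inE negb_or => /andP[xz xs]; rewrite -(IH z') //.
have [//|[[zc ez]|[zc ez]]] := step c zz'.
- by rewrite (child_inj xc zc) eqxx in xz.
- by rewrite (child_inj xc zc) mem_head in xs.
Qed.

Let first_step (x z z' : tree) s t : child x z -> adjT x z' ->
  path adjT z s -> x \notin z :: s -> path adjT z' t -> x \notin z' :: t ->
  last z s = last z' t -> z = z'.
Proof.
move=> xz xz' zs xs zt xt el.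
have := branch xz zt xt; rewrite -el -(branch xz zs xs) suffix_refl.
move: xz' (childP xz); rewrite adjTE => /orP[] /childP[b eb] [a ea];
  move=> /suffixP[u e]; have := congr1 size e; rewrite size_cat ea.
  by rewrite eb /= => su; exfalso; lia.
rewrite eb /= -[LHS]add0n => /addIn/esym/size0nil u0.
by apply: val_inj; rewrite /= e u0.
Qed.

Let simple_path_uniq (x : tree) s t : path adjT x s -> uniq (x :: s) ->
  path adjT x t -> uniq (x :: t) -> last x s = last x t -> s = t.
Proof.
elim: s t x => [|z s IH] [|z' t] x //.
- by move=> _ _ _ /= /andP[xt _] e; rewrite e mem_last in xt.
- by move=> _ /= /andP[xs _] _ _ e; rewrite -e mem_last in xs.
move=> /= /andP[xz zs] /andP[xs us] /andP[xz' zt] /andP[xt ut] el.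
have e : z = z'.
  move: (xz) (xz'); rewrite !adjTE.
  move=> /orP[cz|cz] /orP[cz'|cz'].
  - exact: child_inj cz cz'.
  - exact/esym/(first_step cz' xz zt xt zs xs (esym el)).
  - exact: first_step cz xz' zs xs zt xt el.
  - exact: first_step cz xz' zs xs zt xt el.
by subst z'; rewrite (IH t z).
Qed.

Let path_to_root x : exists2 s, path adjT x s & last x s = tree_root.
Proof.
case: x => l; elim: l => [|a l IH] lr; first by exists [::] => //; apply: val_inj.
have lr' : sorted (fun a b : 'I_d => a != b) l by apply: path_sorted lr.
have [s ps ls] := IH lr'; exists (Word lr' :: s) => //=.
by rewrite ps andbT adjTE (@childE _ _ a).
Qed.

Let simple_path_ex x y : exists s, [/\ path adjT x s, uniq (x :: s) & last x s = y].
Proof.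
have [s ps ls] := path_to_root x; have [t pt lt] := path_to_root y.
have : path adjT x (s ++ rev (belast y t)).
  rewrite cat_path ps ls -lt /= rev_path.
  by rewrite (eq_path (e' := adjT)) // => u v; exact: adjT_sym.
have : last x (s ++ rev (belast y t)) = y.
  by rewrite last_cat ls; case: t lt {pt} => [//|b t]; rewrite /= rev_cons last_rcons.
move=> le /shortenP e; case: e le => s' ps' us' _ ls'; by exists s'.
Qed.

Let up (l : seq 'I_d) := if l is _ :: l' then [:: l'] else [::].

Let down (l : seq 'I_d) := [seq a :: l | a <- enum 'I_d & ohead l != Some a].

Let degree x : exists s : seq tree,
  [/\ uniq s, size s = d & forall y, adjT x y = (y \in s)].
Proof.
case: x => l lr.
have red : all (fun l : seq 'I_d => sorted (fun a b => a != b) l) (up l ++ down l).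
  rewrite all_cat; apply/andP; split.
    by case: l lr => [|a l] //= lr; rewrite (path_sorted lr).
  apply/allP => _ /mapP[a + ->]; rewrite mem_filter => /andP[+ _].
  case: l lr => [|b l] //= -> ba; rewrite andbT.
  by apply: contraNneq ba => ->.
exists (pmap insub (up l ++ down l)); split.
- apply: pmap_sub_uniq; rewrite cat_uniq; apply/and3P; split.
  + by case: (l).
  + apply/hasPn => _ /mapP[a _ ->]; case: (l) => // b l'.
    by rewrite inE; apply/eqP => /(congr1 size) /=; lia.
  + rewrite map_inj_uniq; last by move=> a b [].
    exact: filter_uniq (enum_uniq _).
- rewrite size_pmap_sub; move: red; rewrite all_count => /eqP ->.
  rewrite size_cat size_map /down /up size_filter; case: (l) => [|b l'] /=.
    by rewrite count_predT size_enum_ord.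
  have := count_predC (pred1 b) (enum 'I_d).
  rewrite (count_uniq_mem b (enum_uniq _)) mem_enum /= size_enum_ord => dE.
  apply: etrans dE; congr (1 + _); apply: eq_count => a /=; by rewrite eq_sym.
- move=> y; rewrite mem_pmap_sub mem_cat /adjT /=; congr (_ || _).
    by case: (l) => //= b l'; rewrite inE eq_sym.
  case: y => [[|a m] mr] /=.
    by apply/esym/mapP => -[].
  apply/eqP/mapP => [ml|[b _ [_ ->]]] //.
  exists a; last by rewrite ml.
  rewrite mem_filter mem_enum andbT -ml.
  by case: (m) mr => //= b m' /andP[ab _]; rewrite eq_sym; apply: contraNneq ab => -[->].
Qed.

Lemma adjT_regular_tree : regular_tree adjT d.
Proof.
split; [exact: adjT_sym|exact: adjT_irr|exact: degree|move=> x y].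
have [s [ps us ls]] := simple_path_ex x y; exists s; split => // t [pt ut lt].
by apply: (simple_path_uniq ps us pt ut); rewrite ls lt.
Qed.
End Tree.

Section ProductMeasure.
Variable E : countType.

Definition config_gen : set (set (E -> bool)) :=
  range (fun e : E => [set w : E -> bool | w e]).

Definition config : Type := g_sigma_algebraType config_gen.

HB.instance Definition _ := Measurable.on config.
HB.instance Definition _ := Pointed.on config.

Variables (R : realType) (p : R).

Definition bernoulli_product (mu : probability config R) : Prop :=
  forall (J : {fset E}) (b : E -> bool),
    mu [set w : config | forall e, e \in J -> w e = b e] =
    (\prod_(e <- enum_fset J) (if b e then p else 1 - p))%:E.

(* Existence for [0 <= p <= 1] is [bernoulli_measureP] and uniqueness is
   [bernoulli_product_unique]. *)
Definition bernoulli_measure : probability config R := get bernoulli_product.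

Lemma measurable_open (e : E) : measurable [set w : config | w e].
Proof. by apply: sub_sigma_algebra; exists e. Qed.

Lemma measurable_cylinder (J : {fset E}) (b : E -> bool) :
  measurable [set w : config | forall e, e \in J -> w e = b e].
Proof.
have -> : [set w : config | forall e, e \in J -> w e = b e] =
    \bigcap_(e in [set` J]) [set w : config | w e = b e].
  by apply/seteqP; split => w /= H e; exact: H.
apply: fin_bigcap_measurable; first exact: finite_fset.
move=> e _; case: (b e); first exact: measurable_open.
have -> : [set w : config | w e = false] = ~` [set w : config | w e].
  by apply/seteqP; split => w /=; [move=> ->|move/negP/negbTE].
by apply: measurableC; exact: measurable_open.
Qed.

Lemma bernoulli_product_unique (mu nu : probability config R) :
  bernoulli_product mu -> bernoulli_product nu ->
  forall A, measurable A -> mu A = nu A.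
Proof.
move=> hmu hnu A mA.
pose cyl (J : {fset E}) (b : E -> bool) : set config :=
  [set w : config | forall e, e \in J -> w e = b e].
pose G : set (set config) := [set B | B = set0 \/ exists J b, B = cyl J b].
have GT : G setT.
  right; exists fset0, (fun=> true).
  by apply/seteqP; split => w //= _ e; rewrite in_fset0.
have mG B : G B -> measurable B.
  by move=> [->|[J [b ->]]]; [exact: measurable0|exact: measurable_cylinder].
apply: (measure_unique G (fun=> setT)) => //.
- apply/seteqP; split; last first.
    by apply: smallest_sub; [exact: sigma_algebra_measurable|exact: mG].
  apply: sub_smallest2r; first exact: smallest_sigma_algebra.
  move=> _ [e _ <-]; right; exists [fset e]%fset, (fun=> true).
  apply/seteqP; split => w /= h; last by apply: h; rewrite in_fset1.
  by move=> f; rewrite in_fset1 => /eqP ->.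
- move=> B C [->|[J [b ->]]]; first by left; rewrite set0I.
  move=> [->|[K [c ->]]]; first by left; rewrite setI0.
  have [agree|] := pselect (forall e, e \in J -> e \in K -> b e = c e).
    right; exists (J `|` K)%fset, (fun e => if e \in J then b e else c e).
    apply/seteqP; split => w /=.
      by move=> [hJ hK] e; rewrite in_fsetU; case: ifPn => [/hJ//|_ /hK].
    move=> h; split => e eJ.
      by rewrite h ?in_fsetU ?eJ.
    rewrite h ?in_fsetU ?eJ ?orbT //; case: ifPn => // eJ'; exact: agree.
  move=> dis; left; apply/seteqP; split => // w [hJ hK]; apply: dis => e eJ eK.
  by rewrite -(hJ _ eJ) (hK _ eK).
- by rewrite bigcup_const //; exists 0%N.
- by move=> B [->|[J [b ->]]]; [rewrite !measure0|exact: etrans (hmu J b) (esym (hnu J b))].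
- by move=> k; rewrite /= probability_setT ltry.
Qed.

Section Existence.
Hypothesis p01 : 0 <= p <= 1.

Let p_ge0 : 0 <= p. Proof. by case/andP: p01. Qed.
Let p_le1 : p <= 1. Proof. by case/andP: p01. Qed.

Let T := measurableTypeR R.

Let shift (x : T) : T := if x < p then x / p else (x - p) / (1 - p).

Let digit n (x : T) : bool := (iter n shift x : R) < p.

Let ok (o : option bool) (b : bool) := oapp (fun c => b == c) true o.

Let wt (o : option bool) : R := oapp (fun b : bool => if b then p else 1 - p) 1 o.

Let Fixpoint fits (c : seq (option bool)) (x : T) : bool :=
  if c is o :: c' then ok o (x < p) && fits c' (shift x) else true.

Let mshift : measurable_fun setT shift.
Proof.
apply: measurable_fun_ifT => //.
- by apply: measurable_fun_ltr.
- by apply: measurable_funM.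
- by apply: measurable_funM => //; apply: measurable_funB.
Qed.

Let miter n : measurable_fun setT (iter n shift).
Proof.
elim: n => [|n IH] /=; first exact: measurable_id.
exact: (measurableT_comp mshift IH).
Qed.

Let mdigit n : measurable_fun setT (digit n).
Proof. by apply: measurable_fun_ltr; [exact: miter|exact: measurable_cst]. Qed.

Let mfits c : measurable_fun setT (fits c).
Proof.
elim: c => [|o c IH] /=; first exact: measurable_cst.
apply: measurable_and; last exact: (measurableT_comp IH mshift).
apply: (@measurableT_comp _ _ _ _ _ _ (ok o)) => //.
exact: (mdigit 0).
Qed.

Let mset (f : T -> bool) : measurable_fun setT f -> measurable [set x : T | f x].
Proof.
by move=> mf; have := mf measurableT [set true] I; rewrite setTI; apply.
Qed.

Let fitsP c x : reflect (forall n, (n < size c)%N -> ok (nth None c n) (digit n x))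
  (fits c x).
Proof.
elim: c x => [|o c IH] x /=; first by constructor.
apply: (iffP andP) => [[h0 /IH h] [|n] //=|h].
  by move=> nc; have := h n nc; rewrite /digit iterSr.
split; first exact: (h 0%N).
by apply/IH => n nc; have := h n.+1 nc; rewrite /= /digit iterSr.
Qed.

Let W (c : seq (option bool)) := \prod_(o <- c) wt o.

Let W_ge0 c : 0 <= W c.
Proof. by apply: prodr_ge0 => -[[]|] _; rewrite /wt /=; have h0 := p_ge0; have h1 := p_le1; lra. Qed.

Let fits_itv (c : seq bool) : exists a, [/\ 0 <= a, a + W (map Some c) <= 1 &
  forall x, (0 <= x < 1) && fits (map Some c) x = (a <= x < a + W (map Some c))].
Proof.
elim: c => [|b c [a [a0 a1 IH]]] /=.
  by exists 0; rewrite /W big_nil add0r; split => // x; rewrite andbT.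
rewrite /W big_cons -/(W _) /=; have W0 := W_ge0 (map Some c).
set w := W _ in a1 IH W0 *; clearbody w.
have p0' := p_ge0; have p1' := p_le1.
have q0' : 0 <= 1 - p by lra.
have pa := mulr_ge0 p0' a0; have qa := mulr_ge0 q0' a0.
have pw := mulr_ge0 p0' W0; have qw := mulr_ge0 q0' W0.
have pa1 := ler_wpM2l p0' a1; have qa1 := ler_wpM2l q0' a1.
rewrite mulr1 mulrDr in pa1; rewrite mulr1 mulrDr in qa1.
rewrite /wt; case: b => /=.
- exists (p * a); split; [by []|lra|move=> x].
  rewrite /ok /=; have [xp|px] := ltP x p; last first.
    by rewrite andbF; apply/esym/negP => /andP[_]; lra.
  have [p0|p0] := ltP 0 p; last first.
    have -> : 0 <= x = false by apply/negP => x0; lra.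
    have -> : p = 0 by lra.
    by apply/esym/negP => /andP[]; lra.
  rewrite -mulrDr; have := IH (shift x); rewrite /shift xp eqxx !ler_pdivlMr // !ltr_pdivrMr //.
  rewrite mul0r mul1r.
  rewrite [a * p]mulrC [(_ + _) * p]mulrC => <-.
  rewrite xp andbT /=.
  by rewrite (lt_le_trans xp p1') andbT.
- exists (p + (1 - p) * a); split; [lra|lra|move=> x].
  rewrite -addrA /ok /=; have [xp|px] := ltP x p.
    by rewrite andbF; apply/esym/negP => /andP[+ _]; lra.
  have [p1|p1] := ltP p 1; last first.
    have -> : p = 1 by lra.
    rewrite subrr !mul0r addr0; have -> : x < 1 = false by apply/negP => x1; lra.
    by rewrite andbF; apply/esym/negP => /andP[]; lra.
  have q0 : 0 < 1 - p by lra.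
  rewrite -mulrDr; have := IH (shift x); rewrite /shift ltNge px /= !ler_pdivlMr // !ltr_pdivrMr //.
  rewrite mul0r mul1r.
  rewrite -[p + _ <= x]lerBrDl -[x < p + _]ltrBlDl.
  rewrite [a * _]mulrC [(_ + _) * (1 - p)]mulrC => <-.
  by rewrite (le_trans p0' px) subr_ge0 px ltrD2r.
Qed.

Let I01 : set T := `[0, 1[%classic.

Let mI01 : measurable I01. Proof. exact: measurable_itv. Qed.

Let unif : set T -> \bar R := mrestr (@lebesgue_measure R) mI01.

HB.instance Definition _ := Measure.copy unif (mrestr (@lebesgue_measure R) mI01).

Let unif_setT : unif setT = 1%E.
Proof.
by rewrite /unif /mrestr setTI /I01 lebesgue_measure_itv /= lte_fin ltr01 sube0.
Qed.

HB.instance Definition _ := Measure_isProbability.Build _ _ _ unif unif_setT.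

Let fits_mu (q : seq (option bool)) (c : seq bool) :
  unif [set x : T | fits (map Some c ++ q) x] = (W (map Some c ++ q))%:E.
Proof.
elim: q c => [|[b|] q IH] c.
- rewrite cats0; have [a [a0 a1 H]] := fits_itv c.
  rewrite /unif /mrestr.
  have -> : [set x : T | fits (map Some c) x] `&` I01 =
      `[a, a + W (map Some c)[%classic.
    apply/seteqP; split => x; rewrite /I01 /= !in_itv /=.
      by move=> [fx x01]; rewrite -H x01.
    by rewrite -H => /andP[].
  rewrite lebesgue_measure_itv /= lte_fin ltrDl.
  have [w0|w0] := ltP 0 (W (map Some c)).
    by rewrite -EFinB addrC addKr.
  by have -> : W (map Some c) = 0 by apply/eqP; rewrite eq_le w0 W_ge0.
- by have := IH (rcons c b); rewrite map_rcons cat_rcons.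
- have -> : [set x : T | fits (map Some c ++ None :: q) x] =
     [set x : T | fits (map Some c ++ Some true :: q) x] `|`
     [set x : T | fits (map Some c ++ Some false :: q) x].
    apply/seteqP; split => x /=; elim: c x => [|a c IHc] x /=.
    + by case: (x < p) => /= ->; [left|right].
    + by move=> /andP[-> /IHc].
    + by rewrite /ok /=; case: (x < p) => /=; case.
    + by move=> [/andP[-> h]|/andP[-> h]] /=; apply: IHc; [left|right].
  rewrite measureU; [|exact: mset|exact: mset|].
    have h1 := IH (rcons c true); have h2 := IH (rcons c false).
    rewrite map_rcons cat_rcons in h1; rewrite map_rcons cat_rcons in h2.
    apply: etrans; first exact: (congr2 (fun a b => a + b)%E h1 h2).
    rewrite /= -EFinD; congr EFin; rewrite /W !big_cat /= !big_cons /wt /=.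
    ring.
  apply/seteqP; split => x // -[] /fitsP h1 /fitsP h2.
  have sz : (size c < size (map Some c ++ Some true :: q))%N.
    by rewrite size_cat size_map /= addnS ltnS leq_addr.
  have := h1 _ sz; have := h2 (size c).
  rewrite !size_cat !size_map /= addnS ltnS leq_addr => /(_ isT).
  rewrite !nth_cat size_map ltnn subnn /= /ok /=.
  by move=> /eqP -> .
Qed.

Let X (x : T) : config := fun e => digit (choice.pickle e) x.

Let mX : measurable_fun setT X.
Proof.
apply: (@measurability _ _ T config setT X config_gen) => //.
move=> _ [_ [e _ <-] <-]; rewrite setTI; exact: mset (mdigit (choice.pickle e)).
Qed.

HB.instance Definition _ := isMeasurableFun.Build _ _ _ _ X mX.

Lemma bernoulli_product_exists : exists mu, bernoulli_product mu.
Proof.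
exists (distribution unif X) => J b.
pose qf n := if choice.pickle_inv n is Some e then
  (if (e : E) \in J then Some (b e) else None) else None.
have qfE e : qf (choice.pickle e) = if e \in J then Some (b e) else None.
  by rewrite /qf choice.pickleK_inv.
have [N ltN] : exists N, forall e, e \in J -> (choice.pickle e < N)%N.
  exists (\max_(e <- enum_fset J) choice.pickle e).+1 => e eJ.
  by rewrite ltnS; apply: leq_bigmax_seq.
pose q := mkseq qf N.
have szq : size q = N by rewrite size_mkseq.
have XE : X @^-1` [set w : config | forall e, e \in J -> w e = b e] =
    [set x : T | fits q x].
  apply/seteqP; split => x; last first.
    move=> /fitsP h e eJ; have := h (choice.pickle e); rewrite szq ltN // => /(_ isT).
    by rewrite nth_mkseq ?ltN // qfE eJ /ok /= => /eqP.
  move=> h; apply/fitsP => n; rewrite szq => nN; rewrite nth_mkseq // /qf.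
    case E1: (choice.pickle_inv n) => [e|] //; case: ifPn => // eJ /=.
    have := @choice.pickle_invK E n; rewrite E1 /= => <-.
    by rewrite /ok /=; apply/eqP; exact: h.
apply: etrans; first exact: (congr1 unif XE).
apply: etrans; first exact: (fits_mu q [::]).
congr EFin; rewrite /W /q /= /mkseq big_map.
rewrite (bigID (fun n => n \in map choice.pickle (enum_fset J))) /=.
rewrite [X in _ * X]big1 ?mulr1; last first.
  move=> n /mapP nJ; rewrite /qf; case E1: (choice.pickle_inv n) => [e|] //.
  case: ifPn => // eJ; case: nJ; exists e => //.
  by have := @choice.pickle_invK E n; rewrite E1.
rewrite -big_filter (perm_big (map choice.pickle (enum_fset J))) /=; last first.
  apply: uniq_perm.
  - by rewrite filter_uniq // iota_uniq.
  - by rewrite map_inj_uniq ?fset_uniq //; exact: (pcan_inj choice.pickleK).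
  move=> n; rewrite mem_filter mem_iota add0n /=.
  by case: mapP => // -[e eJ ->]; rewrite ltN.
by rewrite big_map; apply: eq_big_seq => e eJ; rewrite qfE eJ.
Qed.

Lemma bernoulli_measureP : bernoulli_product bernoulli_measure.
Proof. by rewrite /bernoulli_measure; case: bernoulli_product_exists => mu; exact: getI. Qed.
End Existence.
End ProductMeasure.

Section Percolation.
Variables (V : countType) (adj : rel V).

Definition is_edge (A : {fset V}) : bool :=
  [exists x : A, [exists y : A,
    adj (val x) (val y) && (A == [fset val x; val y]%fset)]].

Record edge : Type := Edge { endpoints : {fset V}; endpointsP : is_edge endpoints }.

HB.instance Definition _ := [isSub for endpoints].
HB.instance Definition _ := [Countable of edge by <:].

(* [insub] returns the edge with endpoints [x] and [y] if there is one. *)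
Definition edge_open (w : edge -> bool) : rel V :=
  fun x y => oapp w false (insub [fset x; y]%fset).

Definition connected_in (w : edge -> bool) (x y : V) : Prop :=
  exists2 s, path (edge_open w) x s & last x s = y.

Definition open_cluster (w : edge -> bool) (x : V) : set V :=
  [set y | connected_in w x y].

Definition infinite_cluster_exists (w : edge -> bool) : Prop :=
  exists x, infinite_set (open_cluster w x).

Lemma is_edgeE x y : symmetric adj -> is_edge [fset x; y]%fset = adj x y.
Proof.
move=> adjC; apply/existsP/idP; last first.
  move=> xy; exists [` fset21 x y]%fset; apply/existsP; exists [` fset22 x y]%fset.
  by rewrite /= xy eqxx.
move=> [[u /= _] /existsP[[v /= _] /andP[uv /eqP/fsetP e]]].
have := e v; have := e u; have := e y; have := e x.
rewrite !in_fset2 !eqxx !orbT /= => /esym/orP[]/eqP xE /esym/orP[]/eqP yE.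
- by move=> _ /orP[]/eqP ve; move: uv; rewrite ve xE yE // -?xE.
- by rewrite xE yE.
- by rewrite xE yE adjC.
- by move=> /orP[]/eqP ue _; move: uv; rewrite ue xE yE // -?xE.
Qed.

Section Probability.
Variables (R : realType) (p : R).

Definition connection_prob (x y : V) : R :=
  fine (bernoulli_measure edge p [set w : config edge | connected_in w x y]).

End Probability.

Definition critical_prob (R : realType) : R :=
  inf [set p : R | 0 <= p <= 1 /\
    {ae bernoulli_measure edge p, forall w, infinite_cluster_exists w}].

Lemma measurable_connected_in x y :
  measurable [set w : config edge | connected_in w x y].
Proof.
have -> : [set w : config edge | connected_in w x y] =
    \bigcup_(s : seq V) [set w : config edge | path (edge_open w) x s && (last x s == y)].
  apply/seteqP; split => w; first by move=> [s ps ls]; exists s => //=; rewrite ps ls eqxx.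
  by move=> [s _ /andP[ps /eqP ls]]; exists s.
apply: countable_bigcupT_measurable => // s.
case: eqP => _; last first.
  rewrite (_ : mkset _ = set0) //; by apply/seteqP; split => w //=; rewrite andbF.
elim: s x => [|z s IH] x /=.
  by rewrite (_ : mkset _ = setT) //; apply/seteqP; split.
rewrite (_ : mkset _ = [set w : config edge | edge_open w x z] `&`
   [set w : config edge | path (edge_open w) z s && true]); last first.
  by apply/seteqP; split => w /=; rewrite !andbT => /andP.
apply: measurableI; last exact: IH.
rewrite /edge_open; case: insub => [e|] /=; first exact: measurable_open.
by rewrite (_ : mkset _ = set0) //; apply/seteqP; split.
Qed.

End Percolation.

Section Alpha.
Variable d : nat.

Definition tree_line : rel (tree d * int) := box (@adjT d) adjZ.

(* [limn] is [0] on a divergent sequence, so [alpha v p != 0] entails that the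
   limit exists. *)
Definition alpha (R : realType) (v : nat -> tree d) (p : R) : R :=
  limn (fun n => connection_prob tree_line p (tree_root d, 0) (v n, 0) `^ (n%:R^-1)).

End Alpha.

(* Main.v *)
From HB Require Import structures.
From mathcomp Require Import all_boot all_order all_algebra.
From mathcomp Require Import perm finmap.
From mathcomp Require Import all_classical all_reals all_analysis.
From mathcomp Require Import ring lra zify.
Require Import Defs.

(** Write [tau x y] for the probability that [x] and [y] are connected, [o] for
    the origin, [B_n] for the ball of radius [n] in the tree, [x_n] for any
    vertex of the tree at distance [n] from the root, and [a n] for [tau o
    (x_n, 0)].  By the Harris inequality and the symmetries of the product, [a]
    is supermultiplicative, so [(a n)^(1/n)] converges to its supremum [alpha]
    (lemma [fekete]).  Each of the two inequalities at [p = p_c] comes from a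
    condition on a finite region, and such a condition is open in [p] because
    the probabilities involved are polynomials in [p].

    Upper bound.  If [alpha > 1/(d-1)], then for some [n] a finite region
    already connects [o] to [(x_n, 0)] with probability larger than
    [(d-1)^(-n)], and this remains true slightly below [p_c].  Concatenating
    many translates of that connection along a geodesic, and adding straight
    open paths at both ends, gives a connection from a vertex [u] to a
    descendant [v] that stays inside the cone of [u] and meets the cone of [v]
    at [v] only ([reach_lower_bound]).  The straight paths cost a constant
    factor only, so the expected number of descendants reached exceeds one.
    Successive generations use disjoint sets of edges: a supercritical
    branching process embeds into the cluster ([survival_prob_ge]), and trying
    infinitely many disjoint cones gives an infinite cluster almost surely
    ([region_percolates]).  This contradicts the definition of [p_c].

    Lower bound.  Suppose [alpha < 1/(d-1)].  Going to height [k] and coming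
    back by reflection gives [(tau o (x_n, k))^2 <= a (2n) <= alpha^(2n)] for
    every [k] ([connection_prob_reflect]).  Moreover [tau o (root, k)] is not
    bounded away from zero: if it were at least [c > 0] for all [k], then [a n
    >= c^2] for all [n] ([long_range_order]), since the clusters of [o] and of
    [(x_n, 0)] would come within reach of each other at every height and would
    merge.  Consider now the box [B_n x [-k, k]] and the expected number of
    open edges through which the cluster of [o] inside the box leaves it.
    Through the top and the bottom this is at most a constant times the sum
    over [i <= n] of [(d-1)^i * tau o (x_i, k)], a series dominated by a
    convergent geometric series uniformly in [k], whose terms are small for a
    well-chosen [k] since [p^i * tau o (x_i, k) <= tau o (root, k)]; through
    the side it is of order [k * ((d-1) * alpha)^n].  Choosing [k] first and
    then [n] makes the total less than one ([small_flow]).  By the inequality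
    of Simon and Lieb ([simon_lieb]) a flow less than one bounds the expected
    size of all clusters, hence excludes infinite ones.  Since the flow is
    continuous in [p], this would also exclude them slightly above [p_c], a
    contradiction ([critical_flow]).

    Probabilities of events that depend on finitely many edges are computed as
    iterated averages over a list of edges ([expect]).  Independence, the
    Harris inequality and continuity in [p] are then inductions on that list,
    and [bernoulli_measure_finitary] identifies these averages with the product
    measure. *)

Set Implicit Arguments.
Unset Strict Implicit.
Unset Printing Implicit Defensive.
Import Order.TTheory GRing.Theory Num.Theory.
Import numFieldNormedType.Exports.
Local Open Scope classical_set_scope.
Local Open Scope ring_scope.

(** * Averages over finitely many edges *)

Section FiniteExpectation.
Variables (E : eqType) (R : realType).
Implicit Types (w : E -> bool) (F G : (E -> bool) -> R) (p : R) (D : set E).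

Definition update w (e : E) (b : bool) : E -> bool :=
  fun e' => if e' == e then b else w e'.

Definition resample p (e : E) F : (E -> bool) -> R :=
  fun w => p * F (update w e true) + (1 - p) * F (update w e false).

Definition resample_seq p (s : seq E) F := foldr (resample p) F s.

(** An upper bound on the support: disjointness of such bounds is how
    independence is expressed. *)
Definition depends T D (F : (E -> bool) -> T) :=
  forall w w', (forall e, D e -> w e = w' e) -> F w = F w'.

Definition finitary T (F : (E -> bool) -> T) :=
  exists s : seq E, depends [set` s] F.

Definition increasing F :=
  forall w w', (forall e, w e -> w' e) -> F w <= F w'.

Lemma update_same w e b : update w e b e = b.
Proof. by rewrite /update eqxx. Qed.

Lemma update_other w e b e' : e' != e -> update w e b e' = w e'.
Proof. by rewrite /update => /negbTE->. Qed.

Lemma updateC w e e' b b' : e != e' ->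
  update (update w e b) e' b' = update (update w e' b') e b.
Proof.
move=> ee'; apply/funext => x; rewrite /update.
by case: (x =P e) => [->|//]; rewrite (negbTE ee').
Qed.

Lemma depends_sub T D D' (F : (E -> bool) -> T) :
  D `<=` D' -> depends D F -> depends D' F.
Proof. by move=> DD' dF w w' ww'; apply: dF => e /DD'; exact: ww'. Qed.

Lemma depends_comp T U D (F : (E -> bool) -> T) (h : T -> U) :
  depends D F -> depends D (fun w => h (F w)).
Proof. by move=> dF w w' ww'; rewrite (dF w w'). Qed.

Lemma depends_comp2 T U V D (F : (E -> bool) -> T) (G : (E -> bool) -> U)
    (h : T -> U -> V) :
  depends D F -> depends D G -> depends D (fun w => h (F w) (G w)).
Proof. by move=> dF dG w w' ww'; rewrite (dF w w') // (dG w w'). Qed.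

Lemma depends_update T D (F : (E -> bool) -> T) e b w :
  depends D F -> ~ D e -> F (update w e b) = F w.
Proof.
move=> dF nDe; apply: dF => e' De'; rewrite update_other //.
by apply/eqP => ee; apply: nDe; rewrite -ee.
Qed.

Lemma resample_indep p e D F : depends D F -> ~ D e -> resample p e F = F.
Proof.
move=> dF nDe; apply/funext => w; rewrite /resample !(depends_update _ _ dF nDe).
by ring.
Qed.

Lemma depends_resample p e D F : depends D F -> depends (D `\ e) (resample p e F).
Proof.
move=> dF w w' ww'; rewrite /resample; congr (_ * _ + _ * _).
  all: apply: dF => e' De'; rewrite /update; case: eqP => // ne; apply: ww'.
  all: by split.
Qed.

Arguments depends_resample p e {D F}.

Lemma depends_resample_seq p s D F :
  depends D F -> depends (D `\` [set` s]) (resample_seq p s F).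
Proof.
elim: s => [|e s IH] /= dF.
  by apply: depends_sub dF => e De; split.
apply: depends_sub (depends_resample p e (IH dF)).
move=> x [[Dx xs] xe]; split => //=; rewrite inE => /orP[/eqP//|]; exact: xs.
Qed.

Arguments depends_resample_seq p s {D F}.

Lemma depends_resample_seqW p s D F :
  depends D F -> depends D (resample_seq p s F).
Proof. by move=> dF; apply: depends_sub (depends_resample_seq p s dF) => x []. Qed.

Lemma resampleC p e e' F :
  resample p e (resample p e' F) = resample p e' (resample p e F).
Proof.
case: (eqVneq e e') => [->//|ee'].
apply/funext => w; rewrite /resample.
by rewrite !(updateC _ _ _ ee'); ring.
Qed.

(** By linearity, averaging over two different edges may be done in either
    order. *)
Lemma resample_seqC p s t F :
  resample_seq p s (resample_seq p t F) = resample_seq p t (resample_seq p s F).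
Proof.
elim: s => //= e s ->; elim: t => //= e' t <-.
by rewrite resampleC.
Qed.

Lemma resample_seq_indep p s D F :
  depends D F -> (forall e, e \in s -> ~ D e) -> resample_seq p s F = F.
Proof.
move=> dF; elim: s => //= e s IH sD.
rewrite IH; last by move=> e' e's; apply: sD; rewrite inE e's orbT.
by apply: (resample_indep _ dF); apply: sD; rewrite inE eqxx.
Qed.

(** Once all the edges that [F] sees have been resampled the result is
    constant, so further resampling leaves it unchanged. Resampling along both
    lists, in either order, therefore gives both sides. *)
Lemma resample_seq_unique p s t F w w' :
  depends [set` s] F -> depends [set` t] F ->
  resample_seq p s F w = resample_seq p t F w'.
Proof.
move=> dFs dFt.
have cst u v G : depends [set` u] G -> resample_seq p v (resample_seq p u G) =
    resample_seq p u G.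
  move=> dG; apply: (resample_seq_indep _ (depends_resample_seq p u dG)).
  by move=> e _ [].
rewrite -(cst t s F dFt) resample_seqC (cst s t F dFs).
by apply: (depends_resample_seq p s dFs) => e [].
Qed.

(** The value does not depend on the support, by [resample_seq_unique]. It is
    meaningful for finitary functions only. *)
Definition expect p F : R :=
  match pselect (finitary F) with
  | left h => resample_seq p (projT1 (cid h)) F (fun=> false)
  | right _ => 0
  end.

Lemma expectE p s F w : depends [set` s] F -> expect p F = resample_seq p s F w.
Proof.
move=> dF; rewrite /expect; case: pselect => [h|]; last by case; exists s.
by apply: resample_seq_unique dF; exact: projT2 (cid h).
Qed.

Lemma finitary_cst T (c : T) : finitary (fun=> c).
Proof. by exists [::]. Qed.

Lemma finitary_comp T U (F : (E -> bool) -> T) (h : T -> U) :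
  finitary F -> finitary (fun w => h (F w)).
Proof. by move=> [s dF]; exists s; apply: depends_comp. Qed.

Lemma finitary_comp2 T U V (F : (E -> bool) -> T) (G : (E -> bool) -> U)
    (h : T -> U -> V) :
  finitary F -> finitary G -> finitary (fun w => h (F w) (G w)).
Proof.
move=> [s dF] [t dG]; exists (s ++ t); apply: depends_comp2.
  by apply: depends_sub dF => e /=; rewrite mem_cat => ->.
by apply: depends_sub dG => e /=; rewrite mem_cat => ->; rewrite orbT.
Qed.

Lemma finitary_bigop (I : eqType) (T : Type) (op : T -> T -> T) (x0 : T)
    (r : seq I) (P : pred I) (F : I -> (E -> bool) -> T) :
  (forall i, i \in r -> P i -> finitary (F i)) ->
  finitary (fun w => \big[op/x0]_(i <- r | P i) F i w).
Proof.
elim: r => [|i r IH] fF.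
  by under eq_fun do rewrite big_nil; exact: finitary_cst.
under eq_fun do rewrite big_cons.
have IH' : finitary (fun w => \big[op/x0]_(i <- r | P i) F i w).
  by apply: IH => j jr; apply: fF; rewrite inE jr orbT.
case Pi: (P i) => //; apply: finitary_comp2 => //.
by apply: fF => //; rewrite mem_head.
Qed.

Lemma finitaryD F G : finitary F -> finitary G -> finitary (fun w => F w + G w).
Proof. exact: finitary_comp2. Qed.

Lemma finitaryB F G : finitary F -> finitary G -> finitary (fun w => F w - G w).
Proof. exact: (@finitary_comp2 _ _ _ F G (fun x y => x - y)). Qed.

Lemma finitaryM F G : finitary F -> finitary G -> finitary (fun w => F w * G w).
Proof. exact: finitary_comp2. Qed.

Lemma finitary_common T U (F : (E -> bool) -> T) (G : (E -> bool) -> U) :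
  finitary F -> finitary G ->
  exists s : seq E, depends [set` s] F /\ depends [set` s] G.
Proof.
move=> [s dF] [t dG]; exists (s ++ t); split.
  by apply: depends_sub dF => e /=; rewrite mem_cat => ->.
by apply: depends_sub dG => e /=; rewrite mem_cat => ->; rewrite orbT.
Qed.

Lemma expect_cst p c : expect p (fun=> c) = c.
Proof. by rewrite (@expectE p [::] _ (fun=> false)). Qed.

Lemma resample_seqD p s F G w :
  resample_seq p s (fun w => F w + G w) w =
  resample_seq p s F w + resample_seq p s G w.
Proof. by elim: s w => //= e s IH w; rewrite /resample !IH; ring. Qed.

Lemma resample_seqZ p s c F w :
  resample_seq p s (fun w => c * F w) w = c * resample_seq p s F w.
Proof. by elim: s w => //= e s IH w; rewrite /resample !IH; ring. Qed.

Lemma expectD p F G : finitary F -> finitary G ->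
  expect p (fun w => F w + G w) = expect p F + expect p G.
Proof.
move=> fF fG; have [s [dF dG]] := finitary_common fF fG.
rewrite (expectE p (fun=> false) dF) (expectE p (fun=> false) dG) -resample_seqD.
by apply: expectE; exact: depends_comp2.
Qed.

Lemma expectZ p c F : finitary F ->
  expect p (fun w => c * F w) = c * expect p F.
Proof.
move=> [s dF]; rewrite (expectE p (fun=> false) dF) -resample_seqZ.
by apply: expectE; exact: depends_comp dF.
Qed.

Lemma expectB p F G : finitary F -> finitary G ->
  expect p (fun w => F w - G w) = expect p F - expect p G.
Proof.
move=> fF fG; under eq_fun do rewrite -mulN1r.
rewrite expectD ?expectZ ?mulN1r //; exact: finitary_comp.
Qed.

Lemma expect_sum p (I : eqType) (r : seq I) (P : pred I)
    (F : I -> (E -> bool) -> R) :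
  (forall i, i \in r -> P i -> finitary (F i)) ->
  expect p (fun w => \sum_(i <- r | P i) F i w) =
  \sum_(i <- r | P i) expect p (F i).
Proof.
elim: r => [|i r IH] fF.
  by under eq_fun do rewrite big_nil; rewrite big_nil expect_cst.
under eq_fun do rewrite big_cons; rewrite big_cons.
have fF' j : j \in r -> P j -> finitary (F j).
  by move=> jr; apply: fF; rewrite inE jr orbT.
case Pi: (P i); last exact: IH.
rewrite expectD ?IH //; first by apply: fF => //; rewrite mem_head.
exact: finitary_bigop.
Qed.

(** Each edge is seen by at most one of the two factors, so averaging over it
    acts on one factor only. *)
Lemma resample_seqM p s D D' F G w :
  depends D F -> depends D' G -> D `&` D' = set0 ->
  resample_seq p s (fun w => F w * G w) w =
  resample_seq p s F w * resample_seq p s G w.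
Proof.
move=> dF dG DD'; elim: s w => //= e s IH w.
rewrite {1}/resample !IH.
have dF' := @depends_resample_seqW p s _ _ dF.
have dG' := @depends_resample_seqW p s _ _ dG.
have [De|nDe] := pselect (D e).
  have nD'e : ~ D' e by move=> D'e; have : (D `&` D') e by []; rewrite DD'.
  rewrite (resample_indep p dG' nD'e) !(depends_update _ _ dG' nD'e) /resample.
  by ring.
rewrite (resample_indep p dF' nDe) !(depends_update _ _ dF' nDe) /resample.
by ring.
Qed.

Lemma expectM p D D' F G : finitary F -> finitary G ->
  depends D F -> depends D' G -> D `&` D' = set0 ->
  expect p (fun w => F w * G w) = expect p F * expect p G.
Proof.
move=> fF fG dF dG DD'; have [s [dFs dGs]] := finitary_common fF fG.
rewrite (expectE p (fun=> false) dFs) (expectE p (fun=> false) dGs).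
rewrite -(resample_seqM _ _ _ dF dG DD').
by apply: expectE; exact: depends_comp2.
Qed.

Section Positive.
Variable p : R.
Hypothesis p01 : 0 <= p <= 1.

Lemma resample_seq_le s F G w : (forall w, F w <= G w) ->
  resample_seq p s F w <= resample_seq p s G w.
Proof.
move=> FG; elim: s w => [|e s IH] w //=; rewrite /resample.
by case/andP: p01 => p0 p1; rewrite lerD ?ler_wpM2l ?subr_ge0.
Qed.

Lemma expect_le F G : finitary F -> finitary G ->
  (forall w, F w <= G w) -> expect p F <= expect p G.
Proof.
move=> fF fG FG; have [s [dF dG]] := finitary_common fF fG.
by rewrite (expectE p (fun=> false) dF) (expectE p (fun=> false) dG) resample_seq_le.
Qed.

Lemma expect_ge0 F : finitary F -> (forall w, 0 <= F w) -> 0 <= expect p F.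
Proof.
move=> fF F0; rewrite -(expect_cst p 0).
by apply: expect_le => //; exact: finitary_cst.
Qed.

Lemma increasing_resample_seq s F : increasing F -> increasing (resample_seq p s F).
Proof.
move=> iF; elim: s => [|e s IH] //= w w' ww'; rewrite /resample.
case/andP: p01 => p0 p1.
rewrite lerD ?ler_wpM2l ?subr_ge0 //; apply: IH => e' /=;
  by rewrite /update; case: eqP => // _; exact: ww'.
Qed.

(** On a single edge this is Chebyshev's sum inequality: the defect is [p * (1
    - p)] times the product of the two increments, which have the same sign.
    *)
Lemma resample_seq_harris s F G w : increasing F -> increasing G ->
  resample_seq p s F w * resample_seq p s G w <=
  resample_seq p s (fun w => F w * G w) w.
Proof.
move=> iF iG; elim: s w => [|e s IH] w //=.
case/andP: p01 => p0 p1; rewrite {3}/resample.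
apply: le_trans (_ : p * (resample_seq p s F (update w e true) *
    resample_seq p s G (update w e true)) +
  (1 - p) * (resample_seq p s F (update w e false) *
    resample_seq p s G (update w e false)) <= _); last first.
  by rewrite lerD ?ler_wpM2l ?subr_ge0.
rewrite /resample.
have upd : forall e', update w e false e' -> update w e true e'.
  by move=> e'; rewrite /update; case: eqP.
have := increasing_resample_seq s iF upd.
have := increasing_resample_seq s iG upd.
set a0 := resample_seq _ _ F _; set a1 := resample_seq _ _ F _.
set b0 := resample_seq _ _ G _; set b1 := resample_seq _ _ G _.
move=> b01 a01; rewrite -[_ <= _]subr_ge0.
rewrite (_ : _ - _ = p * (1 - p) * ((a1 - a0) * (b1 - b0))); last by ring.
by apply: mulr_ge0; apply: mulr_ge0; rewrite ?subr_ge0.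
Qed.

Lemma expect_harris F G : finitary F -> finitary G ->
  increasing F -> increasing G ->
  expect p F * expect p G <= expect p (fun w => F w * G w).
Proof.
move=> fF fG iF iG; have [s [dF dG]] := finitary_common fF fG.
rewrite (expectE p (fun=> false) dF) (expectE p (fun=> false) dG).
rewrite (expectE p (fun=> false) (depends_comp2 *%R dF dG)).
exact: resample_seq_harris.
Qed.

(** Opening [e] costs the factor [p], and it does not decrease [F]. *)
Lemma expect_open1 (e : E) F : finitary F ->
  (forall w, F (update w e false) <= F (update w e true)) ->
  p * expect p F <= expect p (fun w => (w e)%:R * F w).
Proof.
case/andP: p01 => p0 p1 [s dF] iF.
have dF' : depends [set` rcons s e] F.
  by apply: depends_sub dF => x /=; rewrite mem_rcons inE => ->; rewrite orbT.
have deF : depends [set` rcons s e] (fun w => (w e)%:R * F w).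
  apply: depends_comp2 dF' => w w' ww'.
  by rewrite ww' //= mem_rcons mem_head.
rewrite (expectE p (fun=> false) dF') (expectE p (fun=> false) deF).
(* [e] is resampled first, at the innermost place *)
rewrite /resample_seq !foldr_rcons -!/(resample_seq _ _ _) -resample_seqZ.
apply: resample_seq_le; move=> w; rewrite /resample !update_same mul1r mul0r mulr0 addr0.
rewrite ler_wpM2l // -[_ <= _]subr_ge0.
rewrite (_ : _ - _ = (1 - p) * (F (update w e true) - F (update w e false))).
  by rewrite mulr_ge0 ?subr_ge0.
by ring.
Qed.

Lemma expect_open (J : seq E) F : finitary F -> (forall w, 0 <= F w) ->
  (forall w e, e \in J -> F (update w e false) <= F (update w e true)) ->
  p ^+ size J * expect p F <= expect p (fun w => (all w J)%:R * F w).
Proof.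
move=> + F0; elim: J => [|e J IH] fF iF.
  by rewrite expr0 mul1r; under [in leRHS]eq_fun do rewrite mul1r.
case/andP: p01 => p0 p1; rewrite /= exprS -mulrA.
have fA : finitary (fun w : E -> bool => (all w J)%:R : R).
  exists J => w w' ww'; congr (nat_of_bool _)%:R.
  by apply: eq_in_all => x; exact: ww'.
apply: le_trans (_ : p * expect p (fun w => (all w J)%:R * F w) <= _).
  by rewrite ler_wpM2l // IH // => w x xJ; apply: iF; rewrite inE xJ orbT.
under [in leRHS]eq_fun do rewrite -mulnb natrM -mulrA.
apply: expect_open1; first exact: finitaryM.
move=> w; apply: ler_pM => //; last by apply: iF; rewrite mem_head.
rewrite ler_nat; case: allP => //= h; rewrite lt0b; apply/allP => x /h.
by rewrite /update; case: eqP.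
Qed.
End Positive.

Lemma resample_seq_continuous s F w :
  continuous (fun p => resample_seq p s F w).
Proof.
elim: s w => [|e s IH] w p /=; first exact: cvg_cst.
rewrite /resample; apply: cvgD; apply: cvgM; try exact: IH.
  exact: cvg_id.
by apply: cvgB; [exact: cvg_cst|exact: cvg_id].
Qed.

Lemma expect_continuous F : finitary F -> continuous (fun p => expect p F).
Proof.
move=> [s dF]; under eq_fun do rewrite (expectE _ (fun=> false) dF).
exact: resample_seq_continuous.
Qed.
End FiniteExpectation.

(** The edges outside the image of [h] are not seen, and the others are
    renamed one by one. *)
Lemma expect_relabel (E E' : eqType) (R : realType) (p : R) (h : E -> E')
    (F : (E -> bool) -> R) : injective h -> finitary F ->
  expect p (fun w => F (w \o h)) = expect p F.
Proof.
move=> hI [s dF].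
have d' : depends [set` map h s] (fun w => F (w \o h)).
  by move=> w w' ww'; apply: dF => e es; apply: ww'; exact: map_f.
rewrite (expectE p (fun=> false) d') (expectE p (fun=> false) dF).
rewrite -[fun=> false in RHS]/((fun=> false) \o h).
move: (fun=> false) => w {d' dF}; elim: s w => //= e s IH w.
have upd b : update w (h e) b \o h = update (w \o h) e b.
  by apply/funext => x; rewrite /update /= (inj_eq hI).
by rewrite /resample -!upd -!IH.
Qed.

Section Measure.
Variables (E : countType) (R : realType) (p : R).
Hypothesis p01 : 0 <= p <= 1.
Let mu := bernoulli_measure E p.

(** The edges of [t] have already been revealed: the induction moves the edges of
   [s] into [t], in the order in which [resample_seq] averages over them. *)
Let cylinder_event (t : seq E) (b : E -> bool) (A : (E -> bool) -> bool) :
    set (config E) :=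
  [set w | (forall e, e \in t -> w e = b e) /\ A w].

Let cylinder_eventP (s t : seq E) (A : (E -> bool) -> bool) (b : E -> bool) :
  uniq (s ++ t) -> depends [set` s ++ t] A ->
  measurable (cylinder_event t b A) /\
  mu (cylinder_event t b A) = ((\prod_(e <- t) (if b e then p else 1 - p)) *
    resample_seq p s (fun w => (A w)%:R) b)%:E.
Proof.
elim: s t b => [|e s IH] t b /= us dA.
  have [Ab|Ab] := boolP (A b).
    have -> : cylinder_event t b A =
        [set w : config E | forall e, e \in [fset e in t]%fset -> w e = b e].
      apply/seteqP; split => w /=.
        by move=> [wt _] e; rewrite inE; exact: wt.
      move=> wt; have wt' e : e \in t -> w e = b e.
        by move=> et; apply: wt; rewrite inE.
      by split=> //; rewrite (dA w b).
    split; first exact: measurable_cylinder.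
    rewrite mulr1; apply: etrans (bernoulli_measureP p01 _ _) _.
    congr EFin; apply: perm_big.
    by apply: uniq_perm => // x; rewrite inE.
  rewrite mulr0 (_ : cylinder_event _ _ _ = set0) ?measure0 //.
  apply/seteqP; split => // w [wt Aw].
  by move: Ab; rewrite -(dA w b) ?Aw.
have dA' : depends [set` s ++ e :: t] A.
  apply: depends_sub dA => x /=; rewrite !inE !mem_cat inE => /or3P[->|->|->] //;
  by rewrite !orbT.
have us' : uniq (s ++ e :: t).
  by move: us; rewrite (perm_uniq (permEl (perm_catCA s [:: e] t))).
have et : e \notin t by move: us => /andP[]; rewrite mem_cat negb_or => /andP[].
have [m1 e1] := IH (e :: t) (update b e true) us' dA'.
have [m0 e0] := IH (e :: t) (update b e false) us' dA'.
have -> : cylinder_event t b A = cylinder_event (e :: t) (update b e true) A `|`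
    cylinder_event (e :: t) (update b e false) A.
  apply/seteqP; split => w /=.
    move=> [wt Aw]; case we: (w e); [left|right]; split=> // x;
      rewrite inE => /orP[/eqP->|xt]; rewrite ?update_same // update_other ?wt //;
      by apply: contraNneq et => <-.
  by case=> -[wt Aw]; split=> // x xt; rewrite wt ?inE ?xt ?orbT //
    update_other //; apply: contraNneq et => <-.
split; first exact: measurableU.
rewrite measureU //; last first.
  apply/seteqP; split => // w [[w1 _] [w0 _]].
  have := w1 e (mem_head _ _); have := w0 e (mem_head _ _).
  by rewrite !update_same => ->.
apply: etrans (congr2 (fun x y => x + y)%E e1 e0) _.
rewrite -EFinD; congr EFin; rewrite !big_cons !update_same /resample.
have eqt c : \prod_(x <- t) (if update b e c x then p else 1 - p) =
    \prod_(x <- t) (if b x then p else 1 - p).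
  apply: eq_big_seq => x xt; rewrite update_other //.
  by apply: contraNneq et => <-.
by rewrite !eqt; ring.
Qed.

Lemma measurable_finitary (A : (E -> bool) -> bool) : finitary A ->
  measurable [set w : config E | A w].
Proof.
move=> [s dA].
have [] := @cylinder_eventP (undup s) [::] A (fun=> false).
- by rewrite cats0 undup_uniq.
- by rewrite cats0; apply: depends_sub dA => e /=; rewrite mem_undup.
move=> + _; congr measurable.
by apply/seteqP; split => w //= -[].
Qed.

Lemma bernoulli_measure_finitary (A : (E -> bool) -> bool) : finitary A ->
  mu [set w : config E | A w] = (expect p (fun w => (A w)%:R))%:E.
Proof.
move=> [s dA].
have dA' : depends [set` undup s] A.
  by apply: depends_sub dA => e /=; rewrite mem_undup.
have [] := @cylinder_eventP (undup s) [::] A (fun=> false).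
- by rewrite cats0 undup_uniq.
- by rewrite cats0.
rewrite big_nil mul1r.
rewrite -(expectE p _ (depends_comp (fun b : bool => b%:R) dA')) => _ <-.
congr (mu _).
by apply/seteqP; split => w //= -[].
Qed.
End Measure.

(** * Connections in a region *)

Section Connection.
Variables (V : countType) (adj : rel V).
Hypothesis adjC : symmetric adj.
Local Notation E := (edge adj).
Implicit Types (w : E -> bool) (P Q : set V) (x y z : V).

(** A boolean, so that it can be turned into an indicator and averaged. *)
Definition conn P w x y : bool :=
  `[< exists s, [/\ path (edge_open w) x s, forall v, v \in x :: s -> P v &
                    last x s = y] >].

Definition inside P : set E := [set e | forall v, v \in endpoints e -> P v].

Lemma edge_openC w x y : edge_open w x y = edge_open w y x.
Proof. by rewrite /edge_open fsetUC. Qed.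

Lemma edge_openP w x y :
  reflect (exists2 e : E, endpoints e = [fset x; y]%fset & w e) (edge_open w x y).
Proof.
rewrite /edge_open; case: insubP => [e _ ee|ne] /=.
  apply: (iffP idP) => [we|[e' ee' we']]; first by exists e.
  by rewrite (_ : e = e') //; apply: val_inj; rewrite ee.
by constructor => -[e ee _]; move: ne; rewrite -ee (endpointsP e).
Qed.

Lemma edge_exists x y : adj x y -> exists e : E, endpoints e = [fset x; y]%fset.
Proof.
by rewrite -(is_edgeE x y adjC) => xy; exists (Edge xy).
Qed.

Lemma edge_open_adj w x y : edge_open w x y -> adj x y.
Proof.
by move=> /edge_openP[e ee _]; rewrite -(is_edgeE x y adjC) -ee; exact: endpointsP.
Qed.

Lemma conn_refl P w x : P x -> conn P w x x.
Proof. by move=> Px; apply/asboolP; exists [::]; split=> // v; rewrite inE => /eqP->. Qed.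

Lemma conn_trans P w x y z : conn P w x y -> conn P w y z -> conn P w x z.
Proof.
move=> /asboolP[s [ps Ps <-]] /asboolP[t [pt Pt <-]]; apply/asboolP; exists (s ++ t).
rewrite cat_path last_cat ps pt; split=> // v.
rewrite -cat_cons mem_cat => /orP[/Ps//|vt]; apply: Pt.
by rewrite inE vt orbT.
Qed.

Lemma conn_sym P w x y : conn P w x y -> conn P w y x.
Proof.
move=> /asboolP[s [ps Ps <-]]; apply/asboolP; exists (rev (belast x s)); split.
- rewrite rev_path; apply: sub_path ps => a b /=; by rewrite edge_openC.
- move=> v; rewrite inE mem_rev => /orP[/eqP->|vs]; apply: Ps; first exact: mem_last.
  exact: mem_belast.
- by case: s {ps Ps} => //= a s; rewrite rev_cons last_rcons.
Qed.

Lemma conn_symE P w x y : conn P w x y = conn P w y x.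
Proof. by apply/idP/idP; exact: conn_sym. Qed.

Lemma conn_edge P w x y : P x -> P y -> edge_open w x y -> conn P w x y.
Proof.
move=> Px Py xy; apply/asboolP; exists [:: y]; split=> //=; first by rewrite xy.
by move=> v; rewrite !inE => /orP[]/eqP->.
Qed.

Lemma conn_region P w x y : conn P w x y -> P x /\ P y.
Proof.
move=> /asboolP[s [ps Ps <-]]; split; apply: Ps; first exact: mem_head.
exact: mem_last.
Qed.

Lemma conn_sub P Q w x y : P `<=` Q -> conn P w x y -> conn Q w x y.
Proof.
by move=> PQ /asboolP[s [ps Ps <-]]; apply/asboolP; exists s; split=> // v /Ps/PQ.
Qed.

Lemma conn_sub_config P w w' x y : (forall e, inside P e -> w e -> w' e) ->
  conn P w x y -> conn P w' x y.
Proof.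
move=> ww' /asboolP[s [ps Ps <-]]; apply/asboolP; exists s; split=> //.
elim: s x ps Ps => //= z s IH x /andP[xz zs] Ps; rewrite IH ?andbT //; last first.
  by move=> v vs; apply: Ps; rewrite inE vs orbT.
case/edge_openP: xz => e ee we; apply/edge_openP; exists e => //; apply: ww' => // v.
rewrite ee in_fset2 => /orP[]/eqP->; apply: Ps; rewrite ?mem_head //.
by rewrite !inE eqxx orbT.
Qed.

Lemma depends_conn P x y : depends (inside P) (fun w => conn P w x y).
Proof.
by move=> w w' ww'; apply/idP/idP; apply: conn_sub_config => e De; rewrite ww'.
Qed.

Lemma inside_finite P : finite_set P -> exists s : seq E, inside P `<=` [set` s].
Proof.
move=> /finite_fsetP[A PA].
exists (pmap insub (enum_fset (fpowerset A))) => e /= De.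
rewrite mem_pmap_sub; change (endpoints e \in fpowerset A); rewrite fpowersetE.
by apply/fsubsetP => v /De; rewrite PA.
Qed.

Lemma finitary_depends T P (F : (E -> bool) -> T) :
  finite_set P -> depends (inside P) F -> finitary F.
Proof. by move=> /inside_finite[s Ps] dF; exists s; apply: depends_sub dF. Qed.

Lemma finitary_conn P x y : finite_set P -> finitary (fun w => conn P w x y).
Proof. by move=> fP; apply: finitary_depends fP _; exact: depends_conn. Qed.

Lemma connected_inP w x y :
  connected_in w x y <-> exists S : {fset V}, conn [set` S] w x y.
Proof.
split=> [[s ps ls]|[S /asboolP[s [ps _ ls]]]]; last by exists s.
exists [fset v in x :: s]%fset; apply/asboolP; exists s; split=> // v.
by rewrite /= !inE.
Qed.

Section Probability.
Variables (R : realType) (p : R).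

Definition region_prob P x y : R := expect p (fun w => (conn P w x y)%:R).

Hypothesis p01 : 0 <= p <= 1.

Lemma finitary_connR P x y : finite_set P ->
  finitary (fun w => (conn P w x y)%:R : R).
Proof. by move=> fP; exact: (finitary_comp (fun b : bool => b%:R) (finitary_conn x y fP)). Qed.
#[local] Hint Resolve finitary_connR : core.

Lemma region_prob_ge0 P x y : finite_set P -> 0 <= region_prob P x y.
Proof. by move=> fP; apply: expect_ge0 => //; exact: finitary_connR. Qed.

Lemma region_prob_le1 P x y : finite_set P -> region_prob P x y <= 1.
Proof.
move=> fP; rewrite -[leRHS](expect_cst E p); apply: expect_le => //.
- exact: finitary_connR.
- exact: finitary_cst.
- by move=> w; rewrite lern1 leq_b1.
Qed.

Lemma region_prob_sub P Q x y : finite_set Q -> P `<=` Q ->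
  region_prob P x y <= region_prob Q x y.
Proof.
move=> fQ PQ; have fP := sub_finite_set PQ fQ.
apply: expect_le => //; try exact: finitary_connR.
move=> w; rewrite ler_nat; case: (boolP (conn P w x y)) => // /(conn_sub PQ) -> //.
Qed.

Lemma region_probC P x y : region_prob P x y = region_prob P y x.
Proof. by congr expect; apply/funext => w; rewrite conn_symE. Qed.

Lemma increasing_conn P x y : increasing (fun w => (conn P w x y)%:R : R).
Proof.
move=> w w' ww'; rewrite ler_nat; case: (boolP (conn P w x y)) => // h.
by rewrite (conn_sub_config _ h) // => e _; exact: ww'.
Qed.

Lemma region_prob_trans P x y z : finite_set P ->
  region_prob P x y * region_prob P y z <= region_prob P x z.
Proof.
move=> fP; apply: le_trans (expect_harris p01 _ _ _ _) _;
  try exact: finitary_connR; try exact: increasing_conn.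
apply: expect_le => //; first by apply: finitaryM; exact: finitary_connR.
  exact: finitary_connR.
move=> w; rewrite -natrM mulnb ler_nat.
case: andP => // -[xy yz]; by rewrite (conn_trans xy yz).
Qed.

Lemma region_prob_edge P x y : finite_set P -> P x -> P y -> adj x y ->
  p <= region_prob P x y.
Proof.
move=> fP Px Py /edge_exists[e ee].
rewrite -[leLHS]mulr1 -[X in _ * X](expect_cst E p).
apply: le_trans (expect_open1 (e := e) p01 _ _) _; first exact: finitary_cst.
  by [].
apply: expect_le => //.
- by exists [:: e] => w w' ww'; rewrite ww' //= mem_head.
- exact: finitary_connR.
- move=> w; rewrite mulr1 ler_nat; case: (boolP (w e)) => // we.
  rewrite conn_edge //; apply/edge_openP; by exists e.
Qed.

Lemma region_prob_id P x : P x -> region_prob P x x = 1.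
Proof.
by move=> Px; rewrite /region_prob; under eq_fun do rewrite conn_refl //;
  rewrite expect_cst.
Qed.

Let mu := bernoulli_measure E p.

(** An exhaustion of the vertices by finite sets; the numbering of the
    vertices bears no relation to the graph. *)
Definition pickle_ball (n : nat) : {fset V} :=
  [fset x in pmap choice.unpickle (iota 0 n)]%fset.

Lemma mem_pickle_ball n x : (choice.pickle x < n)%N -> x \in pickle_ball n.
Proof.
move=> xn; rewrite !inE mem_pmap; apply/mapP.
by exists (choice.pickle x); rewrite ?choice.pickleK // mem_iota.
Qed.

Lemma pickle_ball_sub m n : (m <= n)%N -> [set` pickle_ball m] `<=` [set` pickle_ball n].
Proof.
move=> mn x /=; rewrite !inE !mem_pmap => /mapP[i im ->]; apply/mapP.
by exists i => //; move: im; rewrite !mem_iota => /andP[_ im]; exact: leq_trans mn.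
Qed.

Lemma fset_pickle_ball (S : {fset V}) : exists n, [set` S] `<=` [set` pickle_ball n].
Proof.
exists (\max_(x <- enum_fset S) choice.pickle x).+1 => x /= xS.
by apply: mem_pickle_ball; rewrite ltnS; exact: leq_bigmax_seq.
Qed.

(** An open path is finite, so the connection event is the increasing union of
    the connections in finite regions. *)
Lemma region_prob_cvg x y :
  region_prob [set` pickle_ball n] x y @[n --> \oo] --> connection_prob adj p x y.
Proof.
pose F n := [set w : config E | conn [set` pickle_ball n] w x y].
have ff n : finitary (fun w => conn [set` pickle_ball n] w x y).
  by apply: finitary_conn; exact: finite_fset.
have mF n : measurable (F n) by exact: (measurable_finitary p01 (ff n)).
have UF : \bigcup_n F n = [set w : config E | connected_in w x y].
  apply/seteqP; split => w.
    by move=> [n _ Fn]; apply/connected_inP; exists (pickle_ball n).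
  move=> /connected_inP[S h]; have [n Sn] := fset_pickle_ball S.
  by exists n => //; exact: conn_sub h.
have cv : mu (F n) @[n --> \oo] --> mu (\bigcup_n F n).
  apply: nondecreasing_cvg_mu => //; first exact: bigcupT_measurable.
  by move=> m n mn; apply/subsetPset => w; apply: conn_sub; exact: pickle_ball_sub.
rewrite UF in cv.
have -> : (fun n => region_prob [set` pickle_ball n] x y) = (fun n => fine (mu (F n))).
  by apply/funext => n; rewrite /mu bernoulli_measure_finitary.
apply: fine_cvg; rewrite fineK //.
by apply: fin_num_measure; exact: measurable_connected_in.
Qed.

Lemma region_prob_le_connection P x y : finite_set P ->
  region_prob P x y <= connection_prob adj p x y.
Proof.
move=> /[dup] fP /finite_fsetP[S PS]; have [n Sn] := fset_pickle_ball S.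
have -> := esym (cvg_lim (@Rhausdorff R) (@region_prob_cvg x y)).
apply: limr_ge; first by apply/cvg_ex; eexists; exact: region_prob_cvg.
near=> m; apply: region_prob_sub; first exact: finite_fset.
rewrite PS; apply: (subset_trans Sn); apply: pickle_ball_sub.
by near: m; exact: nbhs_infty_ge.
Unshelve. all: by end_near. Qed.

Lemma connection_lt_region t x y : t < connection_prob adj p x y ->
  exists S : {fset V}, t < region_prob [set` S] x y.
Proof.
move=> tc; have [n _ h] := cvgr_gt _ (@region_prob_cvg x y) _ tc.
by exists (pickle_ball n); apply: h => /=.
Qed.

Lemma connection_prob_le c x y :
  (forall S : {fset V}, region_prob [set` S] x y <= c) ->
  connection_prob adj p x y <= c.
Proof.
move=> h; rewrite leNgt; apply/negP => /connection_lt_region[S].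
by rewrite ltNge h.
Qed.

Lemma connection_prob_ge0 x y : 0 <= connection_prob adj p x y.
Proof. exact: le_trans (region_prob_ge0 x y (finite_set0 V)) (region_prob_le_connection _ _ (finite_set0 V)). Qed.

Lemma connection_prob_le1 x y : connection_prob adj p x y <= 1.
Proof. by apply: connection_prob_le => S; exact: region_prob_le1. Qed.

Lemma connection_probC x y : connection_prob adj p x y = connection_prob adj p y x.
Proof.
wlog: x y / connection_prob adj p x y < connection_prob adj p y x => [h|].
  by case: (ltgtP (connection_prob adj p x y) (connection_prob adj p y x)) => // /h.
move=> /connection_lt_region[S]; rewrite region_probC ltNge.
by rewrite region_prob_le_connection //; exact: finite_fset.
Qed.

(** The inequality holds in each finite region of the exhaustion, and both
    sides converge. *)
Lemma connection_prob_trans x y z :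
  connection_prob adj p x y * connection_prob adj p y z <= connection_prob adj p x z.
Proof.
have cv : region_prob [set` pickle_ball n] x y * region_prob [set` pickle_ball n] y z
    @[n --> \oo] --> connection_prob adj p x y * connection_prob adj p y z.
  by apply: cvgM; exact: region_prob_cvg.
have -> := esym (cvg_lim (@Rhausdorff R) cv).
apply: limr_le; first by apply/cvg_ex; eexists; exact: cv.
near=> n; have fB : finite_set [set` pickle_ball n] by exact: finite_fset.
apply: le_trans (region_prob_trans _ _ _ fB) _.
exact: region_prob_le_connection.
Unshelve. all: by end_near. Qed.

Lemma connection_prob_edge x y : adj x y -> p <= connection_prob adj p x y.
Proof.
move=> xy; pose S := [fset x; y]%fset.
apply: le_trans (_ : region_prob [set` S] x y <= _).
  by apply: region_prob_edge => //=; rewrite ?in_fset2 ?eqxx ?orbT.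
exact: region_prob_le_connection.
Qed.
End Probability.
End Connection.

(** * Symmetries, and the criterion of a small boundary flow *)

Section Automorphism.
Variables (V : countType) (adj : rel V).
Hypothesis adjC : symmetric adj.
Local Notation E := (edge adj).
Variable f : V -> V.
Hypotheses (fI : injective f) (fadj : forall x y, adj (f x) (f y) = adj x y).

Let fedge (e : E) : E := insubd e (f @` endpoints e)%fset.

Let is_edgeP (A : {fset V}) :
  reflect (exists x y, adj x y /\ A = [fset x; y]%fset) (is_edge adj A).
Proof.
apply: (iffP idP) => [/existsP[x /existsP[y /andP[xy /eqP->]]]|[x [y [xy ->]]]].
  by exists (val x), (val y).
by rewrite is_edgeE.
Qed.

Let fset2_im x y : (f @` [fset x; y])%fset = [fset f x; f y]%fset.
Proof.
apply/fsetP => z; rewrite in_fset2; apply/imfsetP/orP => [[u /=]|].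
  by rewrite in_fset2 => /orP[]/eqP-> ->; [left|right].
by case=> /eqP->; [exists x|exists y] => //=; rewrite in_fset2 eqxx ?orbT.
Qed.

Let fedgeE e : endpoints (fedge e) = (f @` endpoints e)%fset.
Proof.
rewrite /fedge; apply: (insubdK e : {in _, _}).
have /is_edgeP[x [y [xy ->]]] := endpointsP e.
by apply/is_edgeP; exists (f x), (f y); rewrite fadj fset2_im.
Qed.

Let fedge_inj : injective fedge.
Proof.
move=> e e' /(congr1 (@endpoints _ _)); rewrite !fedgeE => /fsetP ee.
apply: val_inj; apply/fsetP => v.
have := ee (f v); by rewrite !mem_imfset.
Qed.

Let edge_open_f (w : E -> bool) x y :
  edge_open (w \o fedge) x y = edge_open w (f x) (f y).
Proof.
apply/edge_openP/edge_openP => -[e ee we].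
  by exists (fedge e) => //; rewrite fedgeE ee fset2_im.
have /(edge_exists adjC)[e' ee'] : adj x y.
  by rewrite -fadj -(is_edgeE _ _ adjC) -ee; exact: endpointsP.
exists e' => //=; rewrite (_ : fedge e' = e) //.
by apply: val_inj; rewrite /= fedgeE ee' ee fset2_im.
Qed.

Let conn_f P (w : E -> bool) x y :
  conn (f @` P) w (f x) (f y) = conn P (w \o fedge) x y.
Proof.
apply/asboolP/asboolP => -[s [ps Ps ls]]; last first.
  exists (map f s); split.
  - elim: s x ps {Ps ls} => //= z s IH x /andP[xz zs].
    by rewrite -edge_open_f xz IH.
  - rewrite -map_cons => _ /mapP[v vs ->]; exists v => //; exact: Ps.
  - by rewrite last_map ls.
suff [t [ts pt lt]] : exists t, [/\ map f t = s, path (edge_open (w \o fedge)) x t &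
    last x t = y].
  exists t; split=> // v vt.
  have /Ps[u Pu /fI <-//] : f v \in f x :: s by rewrite -ts -map_cons map_f.
elim: s x ps Ps ls => [|z s IH] x /=.
  by move=> _ _ /fI <-; exists [::].
move=> /andP[xz zs] Ps ls.
have [|z0 _ z0E] := Ps z; first by rewrite !inE eqxx orbT.
rewrite -z0E in xz zs ls.
have [|t [ts pt lt]] := IH z0 zs _ ls.
  by rewrite z0E => v vs; apply: Ps; rewrite inE vs orbT.
by exists (z0 :: t); rewrite /= ts z0E pt lt edge_open_f xz.
Qed.

Variables (R : realType) (p : R).

Lemma region_prob_automorphism P x y : finite_set P ->
  region_prob adj p (f @` P) (f x) (f y) = region_prob adj p P x y.
Proof.
move=> fP; rewrite /region_prob.
under eq_fun do rewrite conn_f.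
apply: (@expect_relabel E E R p fedge (fun w => (conn P w x y)%:R)) => //.
exact: finitary_connR.
Qed.

Lemma connection_prob_automorphism x y : 0 <= p <= 1 ->
  connection_prob adj p x y <= connection_prob adj p (f x) (f y).
Proof.
move=> p01; apply: connection_prob_le => // S.
rewrite -region_prob_automorphism //.
apply: region_prob_le_connection => //.
by apply: finite_image; exact: finite_fset.
Qed.
End Automorphism.

Section FiniteSize.
Variables (V : countType) (adj : rel V).
Hypothesis adjC : symmetric adj.
Local Notation E := (edge adj).
Variable nb : V -> seq V.
Hypothesis nbP : forall x y, adj x y = (y \in nb x).
Variables (R : realType).
Implicit Types (w : E -> bool) (S L C : {fset V}) (p : R).

(** The expected number of open edges through which the cluster of [x] in [S]
    leaves [S]. *)
Definition boundary_flow p S x : R :=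
  \sum_(a <- enum_fset S) \sum_(b <- nb a | b \notin S)
    p * region_prob adj p [set` S] x a.

Let cluster S x w : {fset V} := [fset z in S | conn [set` S] w x z]%fset.

Let in_cluster S x w z : (z \in cluster S x w) = conn [set` S] w x z.
Proof.
rewrite !inE /=; apply: andb_idl => xz; by case: (conn_region xz).
Qed.

Let touching S C : set E :=
  [set e | inside [set` S] e /\ exists2 v, v \in C & v \in endpoints e].

(** The event that the cluster is [C] is decided by the edges touching [C]:
    the open ones span [C], and those leading from [C] to the rest of [S] are
    closed. *)
Let cluster_eq S x C w w' : x \in S ->
  (forall e, touching S C e -> w e = w' e) -> cluster S x w = C -> cluster S x w' = C.
Proof.
move=> xS ww' clC.
have xC : x \in C by rewrite -clC in_cluster conn_refl.
have step (u : E -> bool) a b : (u = w \/ u = w') -> a \in C -> b \in S ->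
    edge_open u a b -> edge_open w a b && edge_open w' a b.
  move=> uE aC bS /edge_openP[e ee ue].
  have aS : a \in S by move: aC; rewrite -clC !inE => /andP[].
  have te : touching S C e.
    split; last by exists a => //; rewrite ee in_fset2 eqxx.
    by move=> v; rewrite ee in_fset2 => /orP[]/eqP->.
  have we : w e by case: uE => uE; move: ue; rewrite uE // ww'.
  by apply/andP; split; apply/edge_openP; exists e; rewrite -?ww'.
have stepC a b : a \in C -> b \in S -> edge_open w a b -> b \in C.
  move=> aC bS ab; rewrite -clC in_cluster; move: aC.
  rewrite -clC in_cluster => xa; apply: (conn_trans xa); apply: conn_edge => //.
  by case: (conn_region xa).
apply/fsetP => z; rewrite in_cluster; apply/idP/idP.
  move=> /asboolP[s [ps Ps <-]] {z}.
  have stay t a : a \in C -> path (edge_open w') a t ->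
      (forall v, v \in a :: t -> v \in S) -> last a t \in C.
    elim: t a => //= z t IH a aC /andP[az zt] Pt.
    have zS : z \in S by apply: Pt; rewrite !inE eqxx orbT.
    have /andP[az1 _] := step _ _ _ (or_intror erefl) aC zS az.
    apply: IH => //; first exact: stepC az1.
    by move=> v vt; apply: Pt; rewrite inE vt orbT.
  exact: stay.
rewrite -{1}clC in_cluster => /asboolP[s [ps Ps <-]] {z}.
have reach t a : a \in C -> conn [set` S] w' x a -> path (edge_open w) a t ->
    (forall v, v \in a :: t -> v \in S) -> conn [set` S] w' x (last a t).
  elim: t a => //= z t IH a aC xa /andP[az zt] Pt.
  have zS : z \in S by apply: Pt; rewrite !inE eqxx orbT.
  have /andP[az1 az2] := step _ _ _ (or_introl erefl) aC zS az.
  apply: IH => //; first exact: stepC az1.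
    apply: (conn_trans xa); apply: conn_edge => //.
    by case: (conn_region xa).
  by move=> v vt; apply: Pt; rewrite inE vt orbT.
by apply: reach => //; exact: conn_refl.
Qed.

Let depends_cluster S x C : x \in S ->
  depends (touching S C) (fun w => cluster S x w == C).
Proof.
move=> xS w w' ww'; apply/eqP/eqP; apply: cluster_eq => // e te.
by rewrite ww'.
Qed.

(** Used with [A] a cluster: after its last visit to the cluster of [x], a
    path never meets an edge that the exploration of the cluster has revealed.
    *)
Let last_exit (e : rel V) (A : pred V) x s : path e x s -> ~~ A (last x s) ->
  all (predC A) (x :: s) \/
  exists a b t, [/\ a \in x :: s, A a, e a b, path e b t &
    [/\ all (predC A) (b :: t), {subset b :: t <= s} & last b t = last x s]].
Proof.
elim: s x => [|z s IH] x /=; first by move=> _ ->; left.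
move=> /andP[xz zs] lA; have [|zsA|[a [b [t [az Aa ab bt [tA ts tl]]]]]] := IH z zs.
- by [].
- case: (boolP (A x)) => Ax; last by left.
  by right; exists x, z, s; split; rewrite ?mem_head //; split.
- right; exists a, b, t; split=> //; first by rewrite inE az orbT.
  by split=> // v /ts vs; rewrite inE vs orbT.
Qed.

Let escape L S x y w : x \in S -> conn [set` L] w x y -> ~~ conn [set` S] w x y ->
  exists a b, [/\ a \in cluster S x w, b \notin S, edge_open w a b &
    conn ([set` L] `\` [set` cluster S x w]) w b y].
Proof.
move=> xS /asboolP[s [ps Ps <-]]; rewrite -in_cluster => ly.
have [/= /andP[+ _]|] := last_exit (A := fun v => v \in cluster S x w) ps ly.
  by rewrite in_cluster conn_refl.
move=> [a [b [t [_ aC ab bt [/allP tC ts tl]]]]]; exists a, b; split=> //.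
  apply: contra (tC b (mem_head _ _)) => bS; rewrite in_cluster.
  move: aC; rewrite in_cluster => xa; apply: (conn_trans xa).
  by apply: conn_edge => //; case: (conn_region xa).
apply/asboolP; exists t; split=> // v vt; split.
  by apply: Ps; rewrite inE ts ?orbT.
by have := tC v vt; rewrite /= => /negP.
Qed.

Let finitary_edge_open x y : finitary (fun w : E -> bool => (edge_open w x y)%:R : R).
Proof.
rewrite /edge_open; case: insub => [e|]; last by exists [::].
by exists [:: e] => w w' ww' /=; rewrite ww' //= mem_head.
Qed.

Let depends_edge_open x y :
  depends [set e : E | endpoints e = [fset x; y]%fset]
    (fun w : E -> bool => (edge_open w x y)%:R : R).
Proof.
move=> w w' ww'; congr (nat_of_bool _)%:R; apply/edge_openP/edge_openP => -[e ee we].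
  by exists e => //; rewrite -ww'.
by exists e => //; rewrite ww'.
Qed.

Let expect_edge_open p x y : 0 <= p <= 1 -> expect p (fun w : E -> bool => (edge_open w x y)%:R : R) <= p.
Proof.
move=> /andP[p0 _]; rewrite /edge_open; case: insub => [e|] /=; last by rewrite expect_cst.
rewrite (@expectE _ _ p [:: e] _ (fun=> false)).
  by rewrite /resample_seq /= /resample !update_same mulr1 mulr0 addr0.
by move=> w w' ww'; rewrite ww' //= mem_head.
Qed.

Let finitary_clusterE S x C : x \in S ->
  finitary (fun w => (cluster S x w == C)%:R : R).
Proof.
move=> xS; apply: (finitary_depends (finite_fset S)).
apply: (depends_comp (fun b : bool => b%:R)).
by apply: depends_sub (@depends_cluster S x C xS) => e [].
Qed.

(** Explore the cluster [C] of [x] inside [S]. A connection from [x] to [y]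
    that is not realized inside [S] leaves [C] for the last time through an
    edge from [a] to [b]; this edge leaves [S], and the rest of the path
    avoids [C]. The edges touching [C] inside [S], the edge from [a] to [b],
    and the edges avoiding [C] form disjoint sets, so the three conditions are
    independent. Summing over [C] recovers the connection from [x] to [a]. *)
Lemma simon_lieb p L S x y : 0 <= p <= 1 -> x \in S ->
  region_prob adj p [set` L] x y <= region_prob adj p [set` S] x y +
    \sum_(a <- enum_fset S) \sum_(b <- nb a | b \notin S)
      p * region_prob adj p [set` S] x a * region_prob adj p [set` L] b y.
Proof.
move=> p01 xS.
pose term a b C w : R := (cluster S x w == C)%:R *
  ((edge_open w a b)%:R * (conn ([set` L] `\` [set` C]) w b y)%:R).
have term_ge0 a b C w : 0 <= term a b C w by rewrite !mulr_ge0.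
have fL C : finite_set ([set` L] `\` [set` C]).
  by apply: sub_finite_set (finite_fset L) => v [].
have fS := finite_fset S; have fL' := finite_fset L.
have fterm a b C : finitary (term a b C).
  apply: finitaryM; first exact: finitary_clusterE.
  by apply: finitaryM => //; exact: finitary_connR.
have term_le a b C : a \in C -> b \notin S ->
    expect p (term a b C) <= expect p (fun w => (cluster S x w == C)%:R) *
      (p * region_prob adj p [set` L] b y).
  move=> aC bS; case/andP: (p01) => p0 _.
  pose D2 : set E := [set e | endpoints e = [fset a; b]%fset].
  pose D3 : set E := inside ([set` L] `\` [set` C]).
  have dcl := depends_comp (fun b : bool => b%:R : R) (@depends_cluster S x C xS).
  have dco := depends_comp (fun b : bool => b%:R : R)
    (@depends_conn _ adj ([set` L] `\` [set` C]) b y).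
  have deb := @depends_edge_open a b.
  rewrite /term (expectM p _ _ dcl (D' := D2 `|` D3)) //.
  - rewrite (expectM p _ _ deb dco) //.
    + apply: ler_wpM2l; first by apply: expect_ge0 => //; exact: finitary_clusterE.
      apply: ler_pM => //.
      * exact: expect_ge0.
      * exact: region_prob_ge0.
      * exact: expect_edge_open.
      * by apply: region_prob_sub => // v [].
    + exact: finitary_connR.
    + apply/seteqP; split => // e [/= ee De]; have := De a.
      by rewrite ee in_fset2 eqxx => -[//|_]; apply.
  - exact: finitary_clusterE.
  - by apply: finitaryM => //; exact: finitary_connR.
  - apply: depends_comp2.
      by apply: depends_sub deb => e; left.
    by apply: depends_sub dco => e; right.
  - apply/seteqP; split => // e [[De [v vC ve]] [ee|De']].
      have := De b; rewrite ee in_fset2 eqxx orbT => /(_ isT) /=.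
      by rewrite (negbTE bS).
    by have [_] := De' v ve; apply.
have sum_cluster a : a \in S ->
    \sum_(C <- enum_fset (fpowerset S) | a \in C)
      expect p (fun w => (cluster S x w == C)%:R) <=
    region_prob adj p [set` S] x a.
  move=> aS; rewrite -expect_sum; last by move=> *; exact: finitary_clusterE.
  apply: expect_le => //.
  - by apply: finitary_bigop => *; exact: finitary_clusterE.
  - exact: finitary_connR.
  - move=> w; rewrite -in_cluster big_mkcond /=.
    rewrite (eq_bigr (fun C => if C == cluster S x w then (a \in cluster S x w)%:R else 0)).
      rewrite (bigD1_seq (cluster S x w)) ?fset_uniq //=.
        by rewrite eqxx big1 ?addr0 // => C /negbTE->.
      by rewrite fpowersetE; apply/fsubsetP => z; rewrite !inE => /andP[].
    move=> C _; rewrite eq_sym; case: eqP => [->|]; last by case: ifP.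
    by case: ifP.
apply: le_trans (_ : expect p (fun w => (conn [set` S] w x y)%:R +
   \sum_(a <- enum_fset S) \sum_(b <- nb a | b \notin S)
    \sum_(C <- enum_fset (fpowerset S) | a \in C) term a b C w) <= _).
  apply: expect_le => //.
  - exact: finitary_connR.
  - apply: finitaryD; first exact: finitary_connR.
    by do 3![apply: finitary_bigop => ? _ _].
  - move=> w; case: (boolP (conn [set` L] w x y)) => [xy|_]; last first.
      by rewrite addr_ge0 //; repeat (apply: sumr_ge0 => ? _).
    case: (boolP (conn [set` S] w x y)) => [_|nxy].
      by rewrite lerDl; repeat (apply: sumr_ge0 => ? _).
    have [a [b [aC bS ab by_]]] := escape xS xy nxy.
    have aS : a \in S by move: aC; rewrite !inE => /andP[].
    have CS : cluster S x w \in fpowerset S.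
      by rewrite fpowersetE; apply/fsubsetP => z; rewrite !inE => /andP[].
    have abn : b \in nb a by rewrite -nbP (edge_open_adj adjC ab).
    rewrite add0r.
    rewrite (big_rem a) //= (big_rem b) //= bS (big_rem (cluster S x w)) //= aC.
    rewrite {1}/term eqxx ab by_ !mulr1 -!addrA lerDl !addr_ge0 //;
      by repeat (apply: sumr_ge0 => ? _).
rewrite expectD; first last.
- by do 3![apply: finitary_bigop => ? _ _].
- exact: finitary_connR.
rewrite lerD2l expect_sum; last by move=> *; do 2![apply: finitary_bigop => ? _ _].
rewrite !big_seq; apply: ler_sum => a aS.
rewrite expect_sum; last by move=> *; apply: finitary_bigop => ? _ _.
apply: ler_sum => b bS; rewrite expect_sum //.
apply: le_trans (_ : \sum_(C <- enum_fset (fpowerset S) | a \in C)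
   expect p (fun w => (cluster S x w == C)%:R) * (p * region_prob adj p [set` L] b y) <= _).
  by apply: ler_sum => C aC; exact: term_le.
case/andP: (p01) => p0 _.
rewrite -mulr_suml (_ : p * _ * _ = region_prob adj p [set` S] x a *
  (p * region_prob adj p [set` L] b y)); last by ring.
apply: ler_wpM2r; first by rewrite mulr_ge0 // region_prob_ge0.
by apply: sum_cluster.
Qed.

(** By [simon_lieb] the largest expected cluster size [B] satisfies [B <= N +
    c * B], and [B] is finite because [L] is. The bound does not depend on
    [L]. *)
Lemma expected_cluster_le p c (N : nat) (L : {fset V}) :
  0 <= p <= 1 -> 0 <= c < 1 ->
  (forall x, exists S : {fset V},
    [/\ x \in S, (#|` S| <= N)%N & boundary_flow p S x <= c]) ->
  forall x, \sum_(y <- enum_fset L) region_prob adj p [set` L] x y <= N%:R / (1 - c).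
Proof.
move=> p01 /andP[c0 c1] hS.
pose chi x := \sum_(y <- enum_fset L) region_prob adj p [set` L] x y.
have fL := finite_fset L.
have chi0 x : 0 <= chi x by apply: sumr_ge0 => y _; exact: region_prob_ge0.
pose B := \big[Order.max/0]_(x <- enum_fset L) chi x.
have B0 : 0 <= B.
  by rewrite /B; elim/big_rec: _ => // x b _ b0; rewrite le_max b0 orbT.
have chiB x : chi x <= B.
  case: (boolP (x \in L)) => xL; first exact: le_bigmax_seq.
  rewrite (_ : chi x = 0) // /chi big1 // => y _.
  rewrite /region_prob (_ : (fun w => _) = (fun=> 0)) ?expect_cst //.
  apply/funext => w; case: (boolP (conn _ _ _ _)) => // xy.
  by case: (conn_region xy) => /= h; rewrite h in xL.
have step x : chi x <= N%:R + c * B.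
  have [S [xS SN flow]] := hS x.
  apply: le_trans (_ : \sum_(y <- enum_fset L) (region_prob adj p [set` S] x y +
    \sum_(a <- enum_fset S) \sum_(b <- nb a | b \notin S)
      p * region_prob adj p [set` S] x a * region_prob adj p [set` L] b y) <= _).
    by apply: ler_sum => y _; exact: simon_lieb.
  rewrite big_split /=; apply: lerD.
    apply: le_trans (_ : \sum_(y <- enum_fset L) (y \in S)%:R <= _).
      apply: ler_sum => y _; case: (boolP (y \in S)) => yS; last first.
        rewrite /region_prob (_ : (fun w => _) = (fun=> 0)) ?expect_cst //.
        apply/funext => w; case: (boolP (conn _ _ _ _)) => // xy.
        by case: (conn_region xy) => _ /= h; rewrite h in yS.
      exact: region_prob_le1 (finite_fset S).
    rewrite -natr_sum ler_nat; apply: leq_trans SN.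
    rewrite (_ : \sum_(y <- enum_fset L) (y \in S : nat) = size [seq y <- enum_fset L | y \in S]).
      apply: uniq_leq_size; first by rewrite filter_uniq ?fset_uniq.
      by move=> y; rewrite mem_filter => /andP[].
    by rewrite size_filter -sum1_count [RHS]big_mkcond; apply: eq_bigr => y _; case: (y \in S).
  rewrite exchange_big /=.
  apply: le_trans (_ : boundary_flow p S x * B <= _); last by rewrite ler_wpM2r.
  rewrite /boundary_flow mulr_suml; apply: ler_sum => a _.
  rewrite exchange_big /= mulr_suml; apply: ler_sum => b _.
  rewrite -mulr_sumr; apply: ler_wpM2l; last exact: chiB.
  by case/andP: (p01) => p0 _; apply: mulr_ge0 => //; apply: region_prob_ge0.
have BN : B <= N%:R + c * B.
  apply: bigmax_le => [|y _]; last exact: step.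
  by rewrite addr_ge0 ?mulr_ge0.
move=> x; rewrite ler_pdivlMr ?subr_gt0 //.
apply: le_trans (ler_wpM2r _ (chiB x)) _; first by rewrite subr_ge0 ltW.
by rewrite mulrBr mulr1 lerBlDr [B * c]mulrC.
Qed.

Section NoPercolation.
Variables (p K : R).
Hypotheses (p01 : 0 <= p <= 1)
  (bounded : forall (L : {fset V}) x,
    \sum_(y <- enum_fset L) region_prob adj p [set` L] x y <= K).
Let mu := bernoulli_measure E p.

Let visited n x w : nat :=
  size [seq y <- enum_fset (pickle_ball V n) | conn [set` pickle_ball V n] w x y].

Let visitedE n x w :
  visited n x w = (\sum_(y <- enum_fset (pickle_ball V n)) conn [set` pickle_ball V n] w x y)%N.
Proof.
rewrite /visited size_filter -sum1_count big_mkcond; apply: eq_bigr => y _.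
by case: (conn _ _ _ _).
Qed.

Let large M x n : set (config E) := [set w : config E | (M.+1 <= visited n x w)%N].

Let finitary_large M x n : finitary (fun w : E -> bool => (M.+1 <= visited n x w)%N).
Proof.
under eq_fun do rewrite visitedE.
apply: finitary_comp; apply: finitary_bigop => y _ _.
by apply: finitary_comp; apply: finitary_conn; exact: finite_fset.
Qed.

Let measurable_large M x n : measurable (large M x n).
Proof. exact: (measurable_finitary p01 (finitary_large M x n)). Qed.

Let mu_large M x n : (mu (large M x n) <= (K / M.+1%:R)%:E)%E.
Proof.
rewrite /mu bernoulli_measure_finitary // lee_fin ler_pdivlMr ?ltr0n // mulrC.
apply: le_trans (bounded (pickle_ball V n) x).
have fb := finite_fset (pickle_ball V n).
have fc y := @finitary_connR V adj R _ x y fb.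
have fl := finitary_comp (fun b : bool => b%:R : R) (finitary_large M x n).
rewrite -expectZ; last exact: fl.
rewrite -expect_sum //; apply: expect_le => //.
- exact: (finitary_comp (fun t => M.+1%:R * t) fl).
- by apply: finitary_bigop.
- move=> w; rewrite -natr_sum -natrM ler_nat -visitedE.
  by case: leqP => //; rewrite ?muln1 ?muln0.
Qed.

Let nondecreasing_large M x : nondecreasing_seq (large M x).
Proof.
move=> m n mn; apply/subsetPset => w /= h; apply: (leq_trans h).
apply: uniq_leq_size; first by rewrite filter_uniq ?fset_uniq.
move=> y; rewrite !mem_filter => /andP[xy ym].
rewrite (conn_sub (@pickle_ball_sub V m n mn) xy).
exact: (@pickle_ball_sub V m n mn).
Qed.

Let infinite_large M x w : infinite_set (open_cluster w x) ->
  exists n, (M <= visited n x w)%N.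
Proof.
move=> /(infinite_set_fset M)[B Bx MB].
have [S hS] : exists S : {fset V}, forall z, z \in B -> conn [set` S] w x z.
  have : forall z, exists S : {fset V}, z \in B -> conn [set` S] w x z.
    move=> z; have [zB|] := boolP (z \in B); last by exists fset0.
    by have /connected_inP[S h] := Bx z zB; exists S.
  move=> /choice[S hS]; exists (\bigcup_(z <- enum_fset B) S z)%fset => z zB.
  apply: conn_sub (hS z zB) => v /= vS.
  by apply/bigfcupP; exists z => //; rewrite andbT.
have [n Sn] := fset_pickle_ball S; exists n; apply: (leq_trans MB).
apply: uniq_leq_size; first exact: fset_uniq.
move=> z zB; rewrite mem_filter (conn_sub Sn (hS z zB)) /=.
by apply: Sn; case: (conn_region (hS z zB)).
Qed.

(** By Markov's inequality, clusters of more than [M] vertices have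
    probability at most [K / M.+1], uniformly along the exhaustion, and there
    are countably many starting points. *)
Lemma no_infinite_cluster :
  ~ {ae bernoulli_measure E p, forall w, infinite_cluster_exists w}.
Proof.
move=> ae.
have mU M x : measurable (\bigcup_n large M x n) by exact: bigcupT_measurable.
have mu_U M x : (mu (\bigcup_n large M x n) <= (K / M.+1%:R)%:E)%E.
  have cv : mu \o large M x @ \oo --> mu (\bigcup_n large M x n).
    by apply: nondecreasing_cvg_mu => //; exact: nondecreasing_large.
  rewrite (_ : mu (\bigcup_n large M x n) = limn (mu \o large M x)).
    apply: lime_le; first by apply/cvg_ex; eexists; exact: cv.
    by apply: nearW => n; exact: mu_large.
  by apply/esym; apply: cvg_lim.
have negl x : mu.-negligible [set w | infinite_set (open_cluster w x)].
  exists (\bigcap_M \bigcup_n large M x n); split.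
  - exact: bigcapT_measurable.
  - apply/eqP; rewrite eq_le measure_ge0 andbT; apply/lee_addgt0Pr => e e0.
    rewrite add0e.
    have [M KM] : exists M : nat, K / M.+1%:R <= e.
      exists (Num.truncn (K / e)); rewrite ler_pdivrMr ?ltr0n // mulrC.
      by rewrite -ler_pdivrMr // ltW // truncnS_gt.
    apply: le_trans (_ : mu (\bigcup_n large M x n) <= _)%E.
      apply: le_measure; rewrite ?inE //; first exact: bigcapT_measurable.
      by move=> w; apply.
    by apply: le_trans (mu_U M x) _; rewrite lee_fin.
  - move=> w inf M _; have [n Mn] := infinite_large M.+1 inf.
    by exists n.
pose F n : set (config E) := if choice.unpickle n is Some x
  then [set w | infinite_set (open_cluster w x)] else set0.
have /negligibleU/(_ ae) : mu.-negligible (\bigcup_n F n).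
  apply: negligible_bigcup => n; rewrite /F; case: choice.unpickle => // .
  exact: negligible_set0.
rewrite (_ : _ `|` _ = setT) => [[N [mN N0 TN]]|].
  have := probability_setT mu; rewrite (_ : setT = N) ?N0 => [/eqP|].
    by rewrite eq_sym onee_eq0.
  by apply/seteqP; split.
apply/seteqP; split => // w _.
have [[x xinf]|] := pselect (infinite_cluster_exists w); last by right.
by left; exists (choice.pickle x) => //; rewrite /F choice.pickleK.
Qed.
End NoPercolation.

Lemma finite_size_criterion p c (N : nat) :
  0 <= p <= 1 -> 0 <= c < 1 ->
  (forall x, exists S : {fset V},
    [/\ x \in S, (#|` S| <= N)%N & boundary_flow p S x <= c]) ->
  ~ {ae bernoulli_measure E p, forall w, infinite_cluster_exists w}.
Proof.
move=> p01 c01 hS; apply: (@no_infinite_cluster p (N%:R / (1 - c)) p01) => L x.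
exact: expected_cluster_le.
Qed.

Lemma boundary_flow_continuous S x : continuous (fun p => boundary_flow p S x).
Proof.
rewrite /boundary_flow; apply: continuous_big => [q|a _]; first exact: add_continuous.
apply: continuous_big => [q|b _ p]; first exact: add_continuous.
apply: cvgM; first exact: cvg_id.
apply: expect_continuous; apply: finitary_connR; exact: finite_fset.
Qed.
End FiniteSize.

(** * The tree and its automorphisms *)

Section TreeAutomorphism.
Variable d : nat.
Implicit Types (x y z : tree d) (l k u : seq 'I_d) (a b c : 'I_d).
Local Notation root := (tree_root d).
Local Notation reduced := (sorted (fun a b : 'I_d => a != b)).

Lemma reduced_cons a l : reduced (a :: l) = (ohead l != Some a) && reduced l.
Proof.
by case: l => //= b l; rewrite (inj_eq (@Some_inj _)) eq_sym.
Qed.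

Lemma adjTP x y : reflect ((exists a, letters x = a :: letters y) \/
    exists a, letters y = a :: letters x) (adjT x y).
Proof.
rewrite /adjT; apply: (iffP orP) => -[].
- by move=> /andP[]; case: (letters x) => // a l _ /eqP /= ->; left; exists a.
- by move=> /andP[]; case: (letters y) => // a l _ /eqP /= ->; right; exists a.
- by move=> [a ->]; left; rewrite /= eqxx.
- by move=> [a ->]; right; rewrite /= eqxx.
Qed.

Lemma adjT_sym : symmetric (@adjT d).
Proof. by move=> x y; rewrite /adjT orbC. Qed.

Definition tree_automorphism (f : tree d -> tree d) :=
  injective f /\ forall x y, adjT (f x) (f y) = adjT x y.

Lemma tree_automorphism_id : tree_automorphism id.
Proof. by split. Qed.

Lemma tree_automorphism_comp f g : tree_automorphism f -> tree_automorphism g ->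
  tree_automorphism (f \o g).
Proof. by move=> [fI fa] [gI ga]; split=> [|x y /=]; [exact: inj_comp|rewrite fa]. Qed.

Lemma involution_automorphism f : involutive f ->
  (forall x y a, letters y = a :: letters x -> adjT (f x) (f y)) ->
  tree_automorphism f.
Proof.
move=> ff fadj; split; first exact: inv_inj.
have h x y : adjT x y -> adjT (f x) (f y).
  by move=> /adjTP[] [a h]; [rewrite adjT_sym|]; exact: fadj h.
by move=> x y; apply/idP/idP => /h //; rewrite !ff.
Qed.

(** Right multiplication by the generator [b] of the free product, on reduced
    words: adjacency is left multiplication by a generator, so this is a
    symmetry. *)
Let right_mul_seq b l : seq 'I_d :=
  if (l != [::]) && (last b l == b) then take (size l).-1 l else rcons l b.

Let right_mul_rcons b l c : right_mul_seq b (rcons l c) =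
  if c == b then l else rcons (rcons l c) b.
Proof.
rewrite /right_mul_seq last_rcons size_rcons /= -cats1 take_size_cat // cats1.
by case: l.
Qed.

Let olast l := ohead (rev l).

Let reduced_rev l : reduced (rev l) = reduced l.
Proof. by rewrite rev_sorted; apply: eq_sorted => a b; rewrite eq_sym. Qed.

Let reduced_rcons l b : reduced (rcons l b) = (olast l != Some b) && reduced l.
Proof. by rewrite -reduced_rev rev_rcons reduced_cons reduced_rev. Qed.

Let right_mul_olast b l : olast l != Some b -> right_mul_seq b l = rcons l b.
Proof.
case/lastP: l => // l c; rewrite /olast rev_rcons /= right_mul_rcons.
by rewrite (inj_eq (@Some_inj _)) => /negbTE->.
Qed.

Let right_mul_reduced b l : reduced l -> reduced (right_mul_seq b l).
Proof.
case: (boolP (olast l == Some b)) => [lb|lb rl]; last first.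
  by rewrite right_mul_olast // reduced_rcons lb.
case/lastP: l lb => // l c; rewrite /olast rev_rcons /= => /eqP[->].
by rewrite right_mul_rcons eqxx reduced_rcons => /andP[].
Qed.

Let right_mul b x : tree d := Word (right_mul_reduced b (letters_reduced x)).

Let right_mulK b : involutive (right_mul b).
Proof.
move=> [l rl]; apply: val_inj => /=.
case: (boolP (olast l == Some b)) => [lb|lb]; last first.
  by rewrite (right_mul_olast lb) right_mul_rcons eqxx.
case/lastP: l lb rl => // l c; rewrite /olast rev_rcons /= => /eqP[->].
rewrite reduced_rcons => /andP[lb _].
by rewrite right_mul_rcons eqxx (right_mul_olast lb).
Qed.

Let right_mul_automorphism b : tree_automorphism (right_mul b).
Proof.
apply: (involution_automorphism (right_mulK b)) => x y a yx; apply/adjTP => /=.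
rewrite yx; case/lastP: (letters x) => [|l c].
  rewrite (right_mul_rcons b [::] a); rewrite /right_mul_seq /=.
  by case: eqP => _; [left; exists b|right; exists a].
rewrite -rcons_cons !right_mul_rcons.
by case: eqP => _; right; exists a.
Qed.

(** Compose the right multiplications by the letters of [x]. *)
Lemma tree_translation x : exists2 f, tree_automorphism f &
  forall y z, letters z = letters y ++ letters x -> f y = z.
Proof.
case: x => l; elim/last_ind: l => [|l b IH] rl /=.
  exists id; first exact: tree_automorphism_id.
  by move=> y z; rewrite cats0 => zy; exact/esym/val_inj.
have rl' : reduced l by move: rl; rewrite reduced_rcons => /andP[].
have [f fa hf] := IH rl'.
exists (right_mul b \o f).
  exact: tree_automorphism_comp (right_mul_automorphism b) fa.
move=> y z zy; have rz := letters_reduced z.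
move: (rz); rewrite zy -rcons_cat reduced_rcons => /andP[lb r'].
rewrite /= (hf y (Word r')) //; apply: val_inj => /=.
by rewrite right_mul_olast // zy -rcons_cat.
Qed.

(** Applies the permutation [s] to the letters above [u]. If [s] fixes the
    first letter of [u], reducedness is preserved; this permutes the branches
    above the vertex [u] and fixes the rest of the tree. *)
Let swap_seq u (s : {perm 'I_d}) l : seq 'I_d :=
  if suffix u l then map s (take (size l - size u) l) ++ u else l.

Let swap_cat u s k : swap_seq u s (k ++ u) = map s k ++ u.
Proof.
by rewrite /swap_seq suffix_suffix size_cat addnK take_size_cat.
Qed.

Let swap_reduced u (s : {perm 'I_d}) l : omap s (ohead u) = ohead u ->
  reduced l -> reduced (swap_seq u s l).
Proof.
move=> su; rewrite /swap_seq; case: ifP => // /suffixP[k ->].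
rewrite size_cat addnK take_size_cat // .
elim: k => // a k IH; rewrite [map s _]/= !cat_cons !reduced_cons => /andP[ak /IH ->].
rewrite andbT; case: k ak {IH} => [|e k] /=; last first.
  by rewrite !(inj_eq (@Some_inj _)) (inj_eq perm_inj).
rewrite -{2}su; case: (u) => //= e _.
by rewrite !(inj_eq (@Some_inj _)) (inj_eq perm_inj).
Qed.

Let swap u b c (hu : omap (tperm b c) (ohead u) = ohead u) x : tree d :=
  Word (swap_reduced hu (letters_reduced x)).

Let size_swap u b c hu x : size (letters (@swap u b c hu x)) = size (letters x).
Proof.
rewrite /=; case: (boolP (suffix u (letters x))) => [/suffixP[k ->]|ux].
  by rewrite swap_cat !size_cat size_map.
by rewrite /swap_seq (negbTE ux).
Qed.

Let swap_automorphism u b c hu : tree_automorphism (@swap u b c hu).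
Proof.
apply: involution_automorphism => [x|x y a yx].
  apply: val_inj => /=; case: (boolP (suffix u (letters x))) => [/suffixP[k ->]|ux].
    rewrite !swap_cat -map_comp.
    by rewrite (eq_map (g := id)) ?map_id // => e /=; rewrite tpermK.
  by rewrite /swap_seq !(negbTE ux).
apply/adjTP; right => /=; rewrite yx.
case: (boolP (suffix u (letters x))) => [/suffixP[k ->]|ux].
  by rewrite -cat_cons !swap_cat /=; exists (tperm b c a).
exists a; rewrite /swap_seq (negbTE ux).
case: ifP => // /suffixP[[|e k]] /= uE; first by rewrite -uE /= subnn take0.
by move: ux; case: uE => _ ->; rewrite suffix_suffix.
Qed.

(** Once an automorphism matches the parents, it sends [x] to a child of the
    parent of [y], and a swap of two branches above that parent finishes. *)
Lemma tree_sphere_transitive x y : size (letters x) = size (letters y) ->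
  exists f, [/\ tree_automorphism f, forall z, size (letters (f z)) = size (letters z) &
    f x = y].
Proof.
case: x y => [l rl] [k rk] /=; elim: l k rl rk => [|a l IH] [|b k] //= rl rk.
  move=> _; exists id; split=> //; [exact: tree_automorphism_id|exact: val_inj].
move=> [slk].
have rl' : reduced l by exact: path_sorted rl.
have rk' : reduced k by exact: path_sorted rk.
have [f [fa fs fx]] := IH k rl' rk' slk.
pose x := Word (rl : reduced (a :: l)).
have [c fc] : exists c, letters (f x) = c :: k.
  have : adjT (Word rl') x by apply/adjTP; right; exists a.
  rewrite -fa.2 fx => /adjTP[[c h]|[c ->]]; last by exists c.
  have := fs x; rewrite /= slk => sx.
  by have := congr1 size h; rewrite /= sx; lia.
have hk : omap (tperm b c) (ohead k) = ohead k.
  have := letters_reduced (f x); rewrite fc reduced_cons => /andP[+ _].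
  move: (rk : reduced (b :: k)); rewrite reduced_cons => /andP[+ _].
  case: (k) => //= e _; rewrite !(inj_eq (@Some_inj _)) => eb ec.
  by rewrite tpermD // eq_sym.
exists (@swap k b c hk \o f); split.
- exact: tree_automorphism_comp (swap_automorphism hk) fa.
- by move=> z; rewrite -(fs z); exact: (size_swap hk).
- apply: val_inj => /=; rewrite fc (@swap_cat k (tperm b c) [:: c]) /=.
  by rewrite tpermR.
Qed.

Lemma tree_pair_transitive x y z z' : letters y = letters z' ++ letters x ->
  size (letters z) = size (letters z') ->
  exists f, [/\ tree_automorphism f, f root = x & f z = y].
Proof.
move=> yx /tree_sphere_transitive[f [fa fs fz]].
have [g ga hg] := tree_translation x.
exists (g \o f); split; first exact: tree_automorphism_comp.
- have -> /= : (g \o f) root = g root.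
    congr g; apply: val_inj; apply: size0nil; exact: fs.
  exact: hg.
- by rewrite /= fz (hg _ y).
Qed.

Definition tree_children x : seq (tree d) :=
  pmap insub [seq a :: letters x | a <- enum 'I_d].

Fixpoint descendants n x : seq (tree d) :=
  if n is n'.+1 then flatten [seq tree_children y | y <- descendants n' x] else [:: x].

Lemma mem_tree_children x y :
  (y \in tree_children x) = (letters y != [::]) && (behead (letters y) == letters x).
Proof.
rewrite mem_pmap_sub /=; apply/mapP/andP => [[a _ ->]|[]]; first by rewrite eqxx.
by case: (letters y) => //= a l _ /eqP ->; exists a; rewrite ?mem_enum.
Qed.

Lemma uniq_tree_children x : uniq (tree_children x).
Proof. by apply: pmap_sub_uniq; rewrite map_inj_uniq ?enum_uniq // => a b []. Qed.

Lemma size_tree_children x :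
  size (tree_children x) = if letters x is [::] then d else d.-1.
Proof.
rewrite size_pmap_sub count_map; case E: (letters x) => [|b l].
  by rewrite (eq_count (a2 := predT)) // count_predT size_enum_ord.
have rx := letters_reduced x; rewrite E in rx.
rewrite (eq_count (a2 := predC (pred1 b))); last first.
  by move=> a; rewrite /= (rx : path _ _ _) andbT.
have := count_predC (pred1 b) (enum 'I_d).
by rewrite (count_uniq_mem b (enum_uniq _)) mem_enum /= size_enum_ord; lia.
Qed.

Lemma mem_descendants n x y : (y \in descendants n x) =
  (size (letters y) == n + size (letters x))%N && (drop n (letters y) == letters x).
Proof.
elim: n y => [|n IH] y /=.
  rewrite inE drop0 add0n; apply/eqP/andP => [->//|[_ /eqP]]; exact: val_inj.
apply/flatten_mapP/andP => [[z]|[/eqP sy /eqP dy]].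
  rewrite IH mem_tree_children => /andP[/eqP sz /eqP dz].
  case: (letters y) => //= a l /eqP ->; by rewrite sz dz.
have ry := letters_reduced y; case E: (letters y) => [|a l]; first by rewrite E in sy.
rewrite E in sy dy ry; exists (Word (path_sorted ry)).
  rewrite IH /=; apply/andP; split; first by move: sy => /= [->].
  by rewrite -dy.
by rewrite mem_tree_children E /= eqxx.
Qed.

Lemma uniq_descendants n x : uniq (descendants n x).
Proof.
elim: n => //= n IH; elim: (descendants n x) IH => //= y s IH /andP[ys us].
rewrite cat_uniq uniq_tree_children IH // andbT; apply/hasPn => z.
move=> /flatten_mapP[y' y's zy']; apply/negP; rewrite mem_tree_children => /andP[_ /eqP e].
move: zy'; rewrite mem_tree_children => /andP[_ /eqP e'].
by move: ys; rewrite (_ : y = y') ?y's //; apply: val_inj; rewrite /= -e e'.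
Qed.

Let size_flatten_map (m : nat) (f : tree d -> seq (tree d)) s :
  (forall y, y \in s -> size (f y) = m) -> size (flatten (map f s)) = (m * size s)%N.
Proof.
elim: s => [|y s IH] h /=; first by rewrite muln0.
rewrite size_cat h ?mem_head // IH ?mulnS // => z zs.
by apply: h; rewrite inE zs orbT.
Qed.

Lemma size_descendants n x : x != root -> size (descendants n x) = (d.-1 ^ n)%N.
Proof.
move=> x0; elim: n => //= n IH; rewrite expnS -IH; apply: size_flatten_map.
move=> y; rewrite mem_descendants size_tree_children => /andP[/eqP sy _].
case: (letters y) sy => //= /esym/eqP; rewrite addn_eq0 => /andP[_ /eqP/size0nil x0'].
by move: x0; rewrite (_ : x = root) ?eqxx //; apply: val_inj.
Qed.

Lemma size_sphere n : (2 <= d)%N -> (size (descendants n root) <= 2 * d.-1 ^ n)%N.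
Proof.
move=> d2; case: n => // n.
rewrite (_ : size _ = d * d.-1 ^ n)%N.
  by rewrite expnS mulnA leq_mul2r; apply/orP; right; lia.
elim: n => [|n IH]; first by rewrite /= cats0 size_tree_children muln1.
rewrite -[descendants _ _]/(flatten (map tree_children (descendants n.+1 root))).
rewrite (@size_flatten_map d.-1) ?IH ?expnS 1?mulnCA // => y.
rewrite mem_descendants size_tree_children => /andP[/eqP sy _].
by case: (letters y) sy.
Qed.

Lemma path_adjT_size x s : path (@adjT d) x s ->
  (size (letters (last x s)) <= size (letters x) + size s)%N.
Proof.
elim: s x => [|y s IH] x /=; first by rewrite addn0.
move=> /andP[/adjTP xy /IH h]; apply: (leq_trans h).
by case: xy => -[a ->] /=; lia.
Qed.

Lemma tree_path_exists x : exists s,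
  [/\ path (@adjT d) root s, last root s = x & size s = size (letters x)].
Proof.
case: x => l; elim: l => [|a l IH] rl; first by exists [::]; split=> //; apply: val_inj.
have [s [ps ls ss]] := IH (path_sorted rl).
exists (rcons s (Word rl)); rewrite rcons_path last_rcons size_rcons ps ls ss.
by split=> //=; apply/adjTP; right; exists a.
Qed.

Lemma at_distance_root x n : at_distance (@adjT d) root x n -> size (letters x) = n.
Proof.
move=> [[s [ps ls sn]] hmin]; apply/eqP; rewrite eqn_leq; apply/andP; split.
  by rewrite -ls -sn; apply: leq_trans (path_adjT_size ps) _.
have [t [pt lt st]] := tree_path_exists x.
by rewrite -st; exact: hmin.
Qed.
End TreeAutomorphism.

(** * Connection probabilities on the product of the tree with the line *)

(** Permuting the neighbours is a separate hypothesis, since [f] is only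
    required to be injective. *)
Lemma boundary_flow_automorphism (V : countType) (adj : rel V)
    (adjC : symmetric adj) (nb : V -> seq V) (R : realType) (p : R) (f : V -> V)
    (S : {fset V}) x :
  injective f -> (forall x y, adj (f x) (f y) = adj x y) ->
  (forall x, perm_eq (nb (f x)) (map f (nb x))) ->
  boundary_flow adj nb p (f @` S)%fset (f x) = boundary_flow adj nb p S x.
Proof.
move=> fI fadj fnb; rewrite /boundary_flow.
have pS : perm_eq (enum_fset (f @` S)%fset) (map f (enum_fset S)).
  apply: uniq_perm; rewrite ?fset_uniq ?map_inj_uniq ?fset_uniq // => y.
  by apply/imfsetP/mapP => -[z zS ->]; exists z.
have fSE : [set` (f @` S)%fset] = f @` [set` S].
  apply/seteqP; split => y /=; first by move=> /imfsetP[z zS ->]; exists z.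
  by move=> [z zS <-]; exact: in_imfset.
rewrite (perm_big _ pS) big_map; apply: eq_bigr => a _.
rewrite (perm_big _ (fnb a)) big_map; apply: eq_big => [b|b _].
  by rewrite mem_imfset.
by rewrite fSE region_prob_automorphism //; exact: finite_fset.
Qed.

Section TreeLine.
Variable d : nat.
Local Notation root := (tree_root d).
Local Notation V := (tree d * int)%type.
Local Notation adj := (@tree_line d).
Local Notation o := ((root, 0) : V).
Implicit Types (x y z : tree d) (i j : int) (u v : V).

Lemma adjZ_sym : symmetric adjZ.
Proof. by move=> i j; rewrite /adjZ orbC. Qed.

Lemma tree_line_sym : symmetric adj.
Proof.
move=> u v; rewrite /tree_line /box adjZ_sym (adjT_sym u.1).
by rewrite (eq_sym u.1) (eq_sym u.2).
Qed.

Definition act (f : tree d -> tree d) (h : int -> int) (u : V) : V := (f u.1, h u.2).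

Definition line_automorphism (h : int -> int) :=
  injective h /\ forall i j, adjZ (h i) (h j) = adjZ i j.

Lemma line_automorphism_shift k : line_automorphism (fun i => i + k).
Proof.
split; first exact: addIr.
by move=> i j; rewrite /adjZ !(addrAC _ k) !(inj_eq (addIr k)).
Qed.

Lemma line_automorphism_opp : line_automorphism (@GRing.opp int).
Proof.
split; first exact: oppr_inj.
by move=> i j; rewrite /adjZ; lia.
Qed.

Lemma line_automorphism_id : line_automorphism id.
Proof. by split. Qed.

Lemma act_inj f h : tree_automorphism f -> line_automorphism h -> injective (act f h).
Proof. by move=> [fI _] [hI _] [x i] [y j] [/fI -> /hI ->]. Qed.

Lemma act_adj f h u v : tree_automorphism f -> line_automorphism h ->
  adj (act f h u) (act f h v) = adj u v.
Proof.
move=> [fI fa] [hI ha]; rewrite /tree_line /box /= fa ha.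
by rewrite (inj_eq fI) (inj_eq hI).
Qed.

Definition tree_neighbors x : seq (tree d) :=
  pmap insub (if letters x is _ :: l then [:: l] else [::]) ++ tree_children x.

Definition neighbors u : seq V :=
  [:: (u.1, u.2 + 1); (u.1, u.2 - 1)] ++ [seq (y, u.2) | y <- tree_neighbors u.1].

Lemma mem_tree_neighbors x y : (y \in tree_neighbors x) = adjT x y.
Proof.
rewrite mem_cat mem_tree_children mem_pmap_sub /adjT /=; congr (_ || _).
by case: (letters x) => //= a l; rewrite inE eq_sym.
Qed.

Lemma mem_neighbors u v : adj u v = (v \in neighbors u).
Proof.
case: u v => [x i] [y j]; rewrite /tree_line /box /neighbors /= !inE /=.
have -> : ((y, j) \in [seq (z, i) | z <- tree_neighbors x]) = adjT x y && (i == j).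
  rewrite -mem_tree_neighbors; apply/mapP/andP => [[z zx [-> ->]]|[yx /eqP ->]].
    by rewrite zx.
  by exists y.
rewrite orbA; congr (_ || _); rewrite !xpair_eqE -andb_orr eq_sym; congr (_ && _).
rewrite /adjZ; lia.
Qed.

Lemma size_tree_neighbors x : (0 < d)%N -> size (tree_neighbors x) = d.
Proof.
move=> d0; rewrite size_cat size_tree_children size_pmap_sub.
have := letters_reduced x; case: (letters x) => //= a l al.
by rewrite (path_sorted al); lia.
Qed.

Lemma uniq_neighbors u : uniq (neighbors u).
Proof.
case: u => x i.
have xx : x \notin tree_neighbors x.
  by rewrite mem_tree_neighbors; apply/adjTP => -[] [a /(congr1 size)] /=; lia.
have ne k : (x, k) \notin [seq (y, i) | y <- tree_neighbors x].
  by apply/mapP => -[y yx [e _]]; rewrite -e in yx; rewrite yx in xx.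
rewrite /neighbors /= inE negb_or !ne !andbT /=; apply/andP; split.
  by rewrite xpair_eqE eqxx /=; lia.
rewrite map_inj_uniq => [|y z []//].
rewrite cat_uniq uniq_tree_children andbT; apply/andP; split.
  by case: (letters x) => [|a l] /=; rewrite ?pmap_sub_uniq //; case: insub.
apply/hasPn => y; rewrite mem_tree_children mem_pmap_sub => /andP[_ /eqP yx].
apply/negP => /=; case: (letters x) yx => //= a l yx; rewrite inE => /eqP e.
by have := congr1 size yx; rewrite /= size_behead e; lia.
Qed.

Lemma perm_neighbors f h u : (0 < d)%N -> tree_automorphism f -> line_automorphism h ->
  perm_eq (neighbors (act f h u)) (map (act f h) (neighbors u)).
Proof.
move=> d0 fa ha.
have ufn : uniq (map (act f h) (neighbors u)).
  by rewrite map_inj_uniq ?uniq_neighbors //; exact: act_inj.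
have sub : {subset map (act f h) (neighbors u) <= neighbors (act f h u)}.
  by move=> _ /mapP[v vu ->]; rewrite -mem_neighbors act_adj // mem_neighbors.
have [] := uniq_min_size ufn sub.
  by rewrite size_map /= !size_map !size_tree_neighbors.
by move=> _ e; rewrite perm_sym; apply: uniq_perm => //; exact: uniq_neighbors.
Qed.

Lemma split_word x n : (n <= size (letters x))%N ->
  exists z y, [/\ letters x = letters z ++ letters y, size (letters y) = n &
    size (letters z) = (size (letters x) - n)%N].
Proof.
move=> nx; have rx := letters_reduced x.
set m := (size (letters x) - n)%N.
have ry : sorted (fun a b : 'I_d => a != b) (drop m (letters x)) by exact: drop_sorted.
have rz : sorted (fun a b : 'I_d => a != b) (take m (letters x)) by exact: take_sorted.
exists (Word rz), (Word ry); rewrite /= cat_take_drop size_drop size_take.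
split=> //; first by rewrite /m; lia.
by rewrite /m; case: ltnP => //; lia.
Qed.

Variables (R : realType) (p : R).
Hypothesis p01 : 0 <= p <= 1.
Local Notation tau := (connection_prob adj p).

Lemma connection_prob_act f h u v : tree_automorphism f -> line_automorphism h ->
  tau u v <= tau (act f h u) (act f h v).
Proof.
move=> fa ha; apply: (connection_prob_automorphism tree_line_sym) => //.
  exact: act_inj.
by move=> *; exact: act_adj.
Qed.

Lemma connection_prob_transport x y z z' i j : letters y = letters z' ++ letters x ->
  size (letters z) = size (letters z') ->
  tau (root, i) (z, j) <= tau (x, i) (y, j).
Proof.
move=> yx zz'; have [f [fa fx fz]] := tree_pair_transitive yx zz'.
have := connection_prob_act (root, i) (z, j) fa line_automorphism_id.
by rewrite /act /= fx fz.
Qed.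

Lemma connection_prob_sphere x y i j : size (letters x) = size (letters y) ->
  tau (root, i) (x, j) = tau (root, i) (y, j).
Proof.
move=> xy; apply/eqP; rewrite eq_le; apply/andP; split;
  by [apply: (@connection_prob_transport _ _ _ y); rewrite ?cats0|
      apply: (@connection_prob_transport _ _ _ x); rewrite ?cats0].
Qed.

Lemma connection_prob_shift k x y i j :
  tau (x, i) (y, j) <= tau (x, i + k) (y, j + k).
Proof. exact: (connection_prob_act (x, i) (y, j) (tree_automorphism_id d) (line_automorphism_shift k)). Qed.

Lemma connection_prob_opp x y i j :
  tau (x, i) (y, j) <= tau (x, - i) (y, - j).
Proof. exact: (connection_prob_act (x, i) (y, j) (tree_automorphism_id d) line_automorphism_opp). Qed.

(** Pass through the ancestor of [z] at the depth of [x]. *)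
Lemma connection_prob_supermult x y z :
  size (letters z) = (size (letters x) + size (letters y))%N ->
  tau o (x, 0) * tau o (y, 0) <= tau o (z, 0).
Proof.
move=> sz; have [|z2 [z1 [zE s1 s2]]] := @split_word z (size (letters x)).
  by rewrite sz leq_addr.
apply: le_trans (connection_prob_trans adj p01 o (z1, 0) (z, 0)).
have ge0 := connection_prob_ge0 adj p01.
apply: ler_pM => //; first by rewrite (@connection_prob_sphere x z1).
by apply: connection_prob_transport zE _; rewrite s2 sz; lia.
Qed.

(** Go up to height [k] over the midpoint of the geodesic to [z], and come
    back to height [0] by the reflected connection. *)
Lemma connection_prob_reflect x z k :
  size (letters z) = (size (letters x) + size (letters x))%N ->
  tau o (x, k) ^+ 2 <= tau o (z, 0).
Proof.
move=> sz; have [|z2 [z1 [zE s1 s2]]] := @split_word z (size (letters x)).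
  by rewrite sz leq_addr.
apply: le_trans (connection_prob_trans adj p01 o (z1, k) (z, 0)).
have ge0 := connection_prob_ge0 adj p01.
rewrite expr2; apply: ler_pM => //; first by rewrite (@connection_prob_sphere x z1).
apply: le_trans (_ : tau (root, k) (x, 0) <= _); last first.
  by apply: connection_prob_transport zE _; rewrite s2 sz; lia.
apply: le_trans (connection_prob_opp _ _ _ _) _; rewrite oppr0.
by apply: le_trans (connection_prob_shift k _ _ _ _) _; rewrite add0r addNr.
Qed.

Lemma connection_prob_tree x k : p ^+ size (letters x) <= tau (root, k) (x, k).
Proof.
case: x => l; elim: l => [|a l IH] rl.
  rewrite (_ : Word _ = root); last exact: val_inj.
  have := region_prob_le_connection adj p01 (root, k) (root, k) (finite_set1 (root, k)).
  by rewrite region_prob_id.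
have IH' := IH (path_sorted rl).
rewrite /= exprSr.
apply: le_trans (connection_prob_trans adj p01 _ (Word (path_sorted rl), k) _).
case/andP: (p01) => p0 _; apply: ler_pM => //; first exact: exprn_ge0.
apply: connection_prob_edge => //; first exact: tree_line_sym.
rewrite /tree_line /box /= eqxx andbT; apply/orP; right.
by apply/adjTP; right; exists a.
Qed.

Lemma connection_prob_vertical x k :
  p ^+ size (letters x) * tau o (x, k) <= tau o (root, k).
Proof.
apply: le_trans (connection_prob_trans adj p01 o (x, k) (root, k)).
have ge0 := connection_prob_ge0 adj p01.
rewrite mulrC; apply: ler_pM => //; first by case/andP: p01 => p0 _; exact: exprn_ge0.
by rewrite (connection_probC adj p01); exact: connection_prob_tree.
Qed.

Let geodesic_edges x k : exists (J : seq (edge adj)) (Q : {fset V}),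
  [/\ size J = size (letters x),
      forall e, e \in J -> exists2 v, v \in endpoints e & v.2 = k &
      forall w, all w J -> conn [set` Q] w (root, k) (x, k)].
Proof.
case: x => l; elim: l => [|a l IH] rl.
  exists [::], [fset (root, k)]%fset; split=> // w _.
  rewrite (_ : Word _ = root); last exact: val_inj.
  by apply: conn_refl; rewrite /= in_fset1.
have [J [Q [sJ Jk JQ]]] := IH (path_sorted rl).
have xy : adj (Word (path_sorted rl), k) (Word rl, k).
  rewrite /tree_line /box /= eqxx andbT; apply/orP; right.
  by apply/adjTP; right; exists a.
have [e ee] := edge_exists tree_line_sym xy.
exists (e :: J), ((Word rl, k) |` Q)%fset; split=> /=; first by rewrite sJ.
  move=> f; rewrite inE => /orP[/eqP->|/Jk //].
  by exists (Word rl, k) => //; rewrite ee in_fset2 eqxx orbT.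
move=> w /andP[we /JQ c].
have c' : conn [set` ((Word rl, k) |` Q)%fset] w (root, k) (Word (path_sorted rl), k).
  by apply: conn_sub c => v /= vQ; rewrite in_fset1U vQ orbT.
apply: (conn_trans c'); apply: conn_edge => /=.
- by case: (conn_region c').
- by rewrite in_fset1U eqxx.
- by apply/edge_openP; exists e.
Qed.

(** At a height [k] that [S0] avoids, the horizontal path from [(root, k)] to
    [(x, k)] is independent of the connections in [S0]. If [o] and [(x, 0)]
    are not connected in [S0], but both are connected to the ends of this
    path, then opening the path, at the cost [p ^+ size (letters x)], connects
    them. *)
Lemma merge_lines x k (S0 : {fset V}) : (forall v, v \in S0 -> v.2 != k) ->
  (1 - p ^+ size (letters x)) * region_prob adj p [set` S0] o (x, 0) +
    p ^+ size (letters x) * (tau o (root, k) * tau (x, 0) (x, k)) <= tau o (x, 0).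
Proof.
move=> S0k; have [J [Q [sJ Jk JQ]]] := geodesic_edges x k.
set n := size (letters x).
case/andP: (p01) => p0 p1.
have cv : (1 - p ^+ n) * region_prob adj p [set` S0] o (x, 0) + p ^+ n *
    (region_prob adj p [set` pickle_ball _ m] o (root, k) *
     region_prob adj p [set` pickle_ball _ m] (x, 0) (x, k)) @[m --> \oo] -->
  (1 - p ^+ n) * region_prob adj p [set` S0] o (x, 0) +
    p ^+ n * (tau o (root, k) * tau (x, 0) (x, k)).
  apply: cvgD; first exact: cvg_cst.
  apply: cvgM; first exact: cvg_cst.
  by apply: cvgM; exact: (region_prob_cvg p01).
rewrite -(cvg_lim (@Rhausdorff R) cv).
apply: limr_le; first by apply/cvg_ex; eexists; exact: cv.
have [m0 S0Qm0] := fset_pickle_ball (S0 `|` Q)%fset.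
near=> m; set S := pickle_ball _ m.
have S0QS : [set` (S0 `|` Q)%fset] `<=` [set` S].
  by apply: (subset_trans S0Qm0); apply: pickle_ball_sub; near: m; exact: nbhs_infty_ge.
have fS := finite_fset S; have fS0 := finite_fset S0.
apply: le_trans (region_prob_le_connection adj p01 o (x, 0) fS).
pose A w : R := (conn (adj := adj) [set` S0] w o (x, 0))%:R.
pose G1 w : R := (conn (adj := adj) [set` S] w o (root, k))%:R.
pose G2 w : R := (conn (adj := adj) [set` S] w (x, 0) (x, k))%:R.
have fA : finitary A by exact: finitary_connR.
have fG1 : finitary G1 by exact: finitary_connR.
have fG2 : finitary G2 by exact: finitary_connR.
have fG := finitaryM fG1 fG2.
(* the indicator that the ends meet the path but are not connected in [S0] *)
pose F w := G1 w * G2 w - A w * (G1 w * G2 w).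
have fF : finitary F by apply: finitaryB => //; exact: finitaryM.
have iG1 : increasing G1 by exact: increasing_conn.
have iG2 : increasing G2 by exact: increasing_conn.
have AJ w e b : e \in J -> A (update w e b) = A w.
  move=> /Jk[v ve vk]; apply: (depends_update _ _ (D := inside [set` S0])).
    by apply: (depends_comp (fun b : bool => b%:R : R)); exact: depends_conn.
  by move=> /(_ v ve) /S0k; rewrite vk eqxx.
have A01 w : 0 <= A w <= 1 by rewrite /A ler0n lern1 leq_b1.
have G01 w : 0 <= G1 w * G2 w <= 1.
  by rewrite /G1 /G2 -natrM mulnb ler0n lern1 leq_b1.
have F0 w : 0 <= F w.
  rewrite /F -[X in X - _]mul1r -mulrBl; have := A01 w; have := G01 w.
  by move=> /andP[? _] /andP[_ ?]; rewrite mulr_ge0 ?subr_ge0.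
have iF w e : e \in J -> F (update w e false) <= F (update w e true).
  move=> eJ; rewrite /F !AJ //.
  rewrite -[X in X - _]mul1r -mulrBl -[X in _ <= X - _]mul1r -mulrBl.
  have /andP[_ A1] := A01 w; apply: ler_wpM2l; first by rewrite subr_ge0.
  have uu e' : update w e false e' -> update w e true e'.
    by rewrite /update; case: eqP.
  by apply: ler_pM; rewrite /G1 /G2 ?ler0n //; [exact: iG1|exact: iG2].
have h1 := expect_open p01 fF F0 iF; rewrite sJ -/n in h1.
have fAJ : finitary (fun w : edge adj -> bool => (all w J)%:R : R).
  exists J => w w' ww'; congr (nat_of_bool _)%:R.
  by apply: eq_in_all => e; exact: ww'.
have h2 : expect p (fun w => A w + (all w J)%:R * F w) <=
    region_prob adj p [set` S] o (x, 0).
  apply: expect_le => //.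
  - by apply: finitaryD => //; exact: finitaryM.
  - exact: finitary_connR.
  - move=> w; rewrite /F /A.
    case: (boolP (conn [set` S0] w o (x, 0))) => [h|_].
      rewrite (conn_sub _ h) ?mul1r ?subrr ?mulr0 ?addr0 // => v vS0.
      by apply: S0QS => /=; rewrite in_fsetU (vS0 : v \in S0).
    rewrite add0r mul0r subr0 /G1 /G2 -!natrM !mulnb ler_nat.
    case: (boolP (all w J)) => //= /JQ xk.
    case: andP => // -[c1 c2]; rewrite lt0b; apply: (conn_trans c1).
    have xk' : conn [set` S] w (root, k) (x, k).
      by apply: conn_sub xk => v vQ; apply: S0QS => /=; rewrite in_fsetU (vQ : v \in Q) orbT.
    by apply: (conn_trans xk'); exact: conn_sym.
apply: le_trans h2; rewrite expectD //; last exact: finitaryM.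
apply: le_trans (lerD (lexx _) h1).
have h3 : expect p (fun w => G1 w * G2 w) - expect p A <= expect p F.
  rewrite -expectB //; apply: expect_le => //; first exact: finitaryB.
  move=> w; rewrite lerD2l lerN2; have /andP[A0 _] := A01 w.
  by have /andP[_ G1'] := G01 w; rewrite ler_piMr.
have h4 := expect_harris p01 fG1 fG2 iG1 iG2.
have pn0 : 0 <= p ^+ n by exact: exprn_ge0.
change (region_prob adj p [set` S0] o (x, 0)) with (expect p A).
change (region_prob adj p [set` S] o (root, k)) with (expect p G1).
change (region_prob adj p [set` S] (x, 0) (x, k)) with (expect p G2).
apply: le_trans (_ : expect p A + p ^+ n * (expect p G1 * expect p G2 - expect p A) <= _).
  by rewrite le_eqVlt; apply/orP; left; apply/eqP; ring.
rewrite lerD2l ler_wpM2l //.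
by apply: le_trans h3; rewrite lerD2r.
Unshelve. all: by end_near. Qed.

(** Let [k] tend to infinity in [merge_lines], with [S0] growing so that the
    first term tends to a multiple of [f = tau o (x, 0)]. With [q] the cost of
    the horizontal path, the limit reads [f >= (1 - q) * f + q * c ^+ 2], that
    is, [f >= c ^+ 2]. *)
Lemma long_range_order c : 0 < p -> 0 <= c -> (forall k : nat, c <= tau o (root, k%:Z)) ->
  forall x, c ^+ 2 <= tau o (x, 0).
Proof.
move=> p0 c0 hc x; rewrite leNgt; apply/negP => lt.
case/andP: (p01) => _ p1.
set f := tau o (x, 0) in lt *; set q := p ^+ size (letters x).
have q0 : 0 < q by exact: exprn_gt0.
have q1 : q <= 1 by exact: exprn_ile1 (ltW p0) p1.
have f0 : 0 <= f by exact: (connection_prob_ge0 adj p01).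
(* close enough to [f] for the strict inequality to survive the loss [f - t] *)
pose t := f - q * (c ^+ 2 - f) / 2.
have qc : 0 < q * (c ^+ 2 - f) by rewrite mulr_gt0 // subr_gt0.
have [|S0 tS0] := @connection_lt_region _ adj R p p01 t o (x, 0).
  by rewrite -/f /t; lra.
pose k := (\max_(v <- enum_fset S0) `|v.2|%N).+1.
have kS0 v : v \in S0 -> v.2 != k%:Z.
  move=> vS0; apply/eqP => vk.
  have : (`|v.2| < k)%N by rewrite ltnS; apply: (@leq_bigmax_seq _ _ predT (fun v : V => `|v.2|%N)).
  by rewrite vk absz_nat ltnn.
have := @merge_lines x _ _ kS0; rewrite -/f -/q.
have g1 := hc k.
have g2 : c <= tau (x, 0) (x, k%:Z).
  apply: le_trans g1 _.
  by apply: (@connection_prob_transport x x root root) => //; rewrite cat0s.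
have cc : c ^+ 2 <= tau o (root, k%:Z) * tau (x, 0) (x, k%:Z).
  by rewrite expr2; apply: ler_pM.
have := ler_wpM2l (ltW q0) cc.
have : (1 - q) * t <= (1 - q) * region_prob adj p [set` S0] o (x, 0).
  by rewrite ler_wpM2l ?subr_ge0 // ltW.
move=> h1 h2 h3.
have : (1 - q) * t + q * c ^+ 2 <= f by lra.
have -> : (1 - q) * t + q * c ^+ 2 = f + q * (c ^+ 2 - f) - (1 - q) * (q * (c ^+ 2 - f)) / 2.
  by rewrite /t; field.
have : (1 - q) * (q * (c ^+ 2 - f)) <= q * (c ^+ 2 - f).
  by rewrite ler_piMl // ?ltW //; lra.
lra.
Qed.
End TreeLine.

(** * A box with small boundary flow *)

Lemma exprn_small (R : realType) (r e : R) : 0 <= r < 1 -> 0 < e ->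
  exists n0, forall n, (n0 <= n)%N -> r ^+ n < e.
Proof.
move=> /andP[r0 r1] e0.
have : (fun n => r ^+ n) @ \oo --> (0 : R) by apply: cvg_expr; rewrite ger0_norm.
move=> /cvgr_lt/(_ e e0)[n0 _ h]; by exists n0 => n; exact: h.
Qed.

Lemma sum_indicator (R : realType) (I : eqType) (s : seq I) (P : pred I) :
  \sum_(i <- s) (P i)%:R = (count P s)%:R :> R.
Proof.
by rewrite -natr_sum -sum1_count [in RHS]big_mkcond.
Qed.

Section Box.
Variable d : nat.
Local Notation root := (tree_root d).
Local Notation V := (tree d * int)%type.
Local Notation adj := (@tree_line d).
Local Notation o := ((root, 0) : V).

Let heights (k : nat) : seq int := [seq i%:Z - k%:Z | i <- iota 0 (2 * k + 1)].

Let mem_heights k j : (j \in heights k) = (`|j| <= k)%N.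
Proof.
apply/mapP/idP => [[i]|jk]; first by rewrite mem_iota => ? ->; lia.
exists (absz (j + k%:Z)%R); last by lia.
by rewrite mem_iota; lia.
Qed.

Let uniq_heights k : uniq (heights k).
Proof. by rewrite map_inj_uniq ?iota_uniq // => i j /addIr []. Qed.

Let tree_ball n : seq (tree d) := flatten [seq descendants i root | i <- iota 0 n.+1].

Let mem_tree_ball n x : (x \in tree_ball n) = (size (letters x) <= n)%N.
Proof.
apply/flatten_mapP/idP => [[i]|xn].
  by rewrite mem_iota mem_descendants /= addn0 => ilt /andP[/eqP -> _].
exists (size (letters x)); first by rewrite mem_iota.
by rewrite mem_descendants /= addn0 eqxx drop_size.
Qed.

Let uniq_tree_ball n : uniq (tree_ball n).
Proof.
rewrite /tree_ball; elim: (iota _ _) (iota_uniq 0 n.+1) => //= i s IH /andP[is_ us].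
rewrite cat_uniq uniq_descendants IH // andbT; apply/hasPn => x /flatten_mapP[j js].
rewrite !mem_descendants /= !addn0 => /andP[/eqP -> _]; apply/negP => /andP[/eqP ji _].
by rewrite -ji js in is_.
Qed.

Definition tree_box n k : {fset V} := [fset u in [seq (x, j) | x <- tree_ball n, j <- heights k]]%fset.

Lemma mem_tree_box n k x j :
  ((x, j) \in tree_box n k) = (size (letters x) <= n)%N && (`|j| <= k)%N.
Proof.
rewrite in_fset -mem_tree_ball -mem_heights.
apply/allpairsPdep/andP => [[y [i [? ? [-> ->]]]]//|[xb jh]].
by exists x, j.
Qed.

Let big_tree_box (R : realType) n k (F : V -> R) :
  \sum_(u <- enum_fset (tree_box n k)) F u =
  \sum_(0 <= i < n.+1) \sum_(x <- descendants i root) \sum_(j <- heights k) F (x, j).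
Proof.
rewrite (perm_big [seq (x, j) | x <- tree_ball n, j <- heights k]); last first.
  apply: uniq_perm; rewrite ?fset_uniq //; last by move=> u; rewrite -[LHS]/(u \in tree_box n k) in_fset.
  apply: allpairs_uniq; [exact: uniq_tree_ball|exact: uniq_heights|].
  by move=> -[x i] [y j] _ _ /= [-> ->].
by rewrite big_allpairs_dep /tree_ball big_flatten big_map /index_iota subn0.
Qed.

Hypothesis d_gt2 : (2 < d)%N.

Lemma word_exists n : exists x : tree d, size (letters x) = n.
Proof.
elim: n => [|n [x xn]]; first by exists root.
have : (0 < size (tree_children x))%N by rewrite size_tree_children; case: (letters x); lia.
case E: (tree_children x) => [//|y s] _; exists y.
have : y \in tree_children x by rewrite E mem_head.
by rewrite mem_tree_children; case: (letters y) => //= a l /eqP ->; rewrite xn.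
Qed.

Variables (R : realType) (p : R).
Hypotheses (p01 : 0 <= p <= 1) (p_gt0 : 0 < p).
Local Notation tau := (connection_prob adj p).
Variable A : R.
Hypotheses (A_ge0 : 0 <= A) (DA_lt1 : (d.-1)%:R * A < 1)
  (tauA : forall x, tau o (x, 0) <= A ^+ size (letters x)).

Let D : R := (d.-1)%:R.
Let d_gt0 : 0 < d%:R :> R. Proof. by rewrite ltr0n; lia. Qed.
Let D_ge2 : 2 <= D. Proof. by rewrite /D ler_nat; lia. Qed.
Let A_lt1 : A < 1.
Proof.
apply: le_lt_trans DA_lt1; rewrite -[leLHS]mul1r ler_wpM2r // -/D; have := D_ge2; lra.
Qed.
Let tau_ge0 u v : 0 <= tau u v. Proof. exact: (connection_prob_ge0 adj p01). Qed.

(** The reflection bound: the decay in the tree direction holds at every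
    height. *)
Let tauA_height x j : tau o (x, j) <= A ^+ size (letters x).
Proof.
have [z sz] := word_exists (size (letters x) + size (letters x)).
have := le_trans (connection_prob_reflect p01 j sz) (tauA z).
rewrite sz addnn -mul2n mulnC exprM => h.
by rewrite -(ler_pXn2r (n := 2)) // nnegrE ?exprn_ge0.
Qed.

(** Otherwise long-range order contradicts the decay of [tau o (x, 0)] along
    the tree, as [A < 1]. *)
Let low_height e : 0 < e -> exists k : nat, tau o (root, k%:Z) < e.
Proof.
move=> e0; apply: contrapT => /forallNP h.
have lo := long_range_order p01 p_gt0 (ltW e0).
have [|n0 hn] := @exprn_small R A (e ^+ 2) _ (exprn_gt0 2 e0); first by rewrite A_ge0.
have [x xn] := word_exists n0.
have := hn n0 (leqnn _); rewrite -xn ltNge => /negP; apply.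
apply: le_trans (tauA x); apply: lo => k.
by rewrite leNgt; apply/negP; exact: h.
Qed.

(** Vertical neighbours leave the box only from the top and the bottom (both
    may occur at once when [k] is [0]), horizontal ones only from the side. *)
Let exits n k x j : (size (letters x) <= n)%N -> (`|j| <= k)%N ->
  (count (fun b => b \notin tree_box n k) (neighbors (x, j)) <=
   2 * (`|j| == k) + d * (size (letters x) == n))%N.
Proof.
move=> xn jk; rewrite /neighbors count_cat; apply: leq_add.
  case: (eqVneq `|j|%N k) => [_|jk']; last by rewrite /= !mem_tree_box xn /=; lia.
  by rewrite muln1; apply: leq_trans (count_size _ _) _.
rewrite count_map; case: (eqVneq (size (letters x)) n) => [_|xn'].
  by rewrite muln1; apply: leq_trans (count_size _ _) _; rewrite size_tree_neighbors //; lia.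
rewrite muln0 leqn0 -leqn0 leqNgt -has_count; apply/hasPn => y.
rewrite mem_tree_neighbors negbK mem_tree_box jk andbT => /adjTP[] [a].
  by move=> /(congr1 size) /=; lia.
by move=> -> /=; lia.
Qed.

Let geometric_tail (r : R) i0 n : 0 <= r < 1 ->
  \sum_(i0 <= i < n) r ^+ i <= r ^+ i0 / (1 - r).
Proof.
move=> /andP[r0 r1]; rewrite ler_pdivlMr ?subr_gt0 //.
have [i0n|ni0] := leqP i0 n; last first.
  by rewrite big_geq ?mul0r ?exprn_ge0 // ltnW.
have -> : (\sum_(i0 <= i < n) r ^+ i) * (1 - r) = r ^+ i0 - r ^+ n.
  elim: n i0n => [|n IH]; first by rewrite leqn0 => /eqP ->; rewrite big_geq // mul0r subrr.
  rewrite leq_eqVlt => /orP[/eqP ->|i0n]; first by rewrite big_geq // mul0r subrr.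
  by rewrite big_nat_recr //= mulrDl IH // exprS; ring.
by rewrite lerBlDr lerDl exprn_ge0.
Qed.

Let count_extremal k : (count (fun j : int => `|j|%N == k) (heights k) <= 2)%N.
Proof.
rewrite -size_filter; apply: (@uniq_leq_size _ _ [:: k%:Z; - k%:Z]).
  by rewrite filter_uniq ?uniq_heights.
by move=> j; rewrite mem_filter !inE => /andP[/eqP jk _]; lia.
Qed.

(** The sphere of radius [i] has at most [2 * D ^+ i] vertices, each of them
    contributing at most two heights [k] and [- k] with at most two exits
    each, which accounts for the factor [8]. *)
Let flow_le n k (m : nat -> R) :
  (forall x j, (size (letters x) <= n)%N -> `|j|%N = k -> tau o (x, j) <= m (size (letters x))) ->
  (forall i, 0 <= m i) ->
  boundary_flow adj (@neighbors d) p (tree_box n k) o <=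
  \sum_(0 <= i < n.+1) 8 * D ^+ i * m i + 2 * d%:R * (2 * k + 1)%:R * (D * A) ^+ n.
Proof.
move=> hm m0; case/andP: (p01) => p0 p1.
have fS := finite_fset (tree_box n k).
apply: le_trans (_ : \sum_(u <- enum_fset (tree_box n k))
   tau o u * (2 * (`|u.2|%N == k) + d * (size (letters u.1) == n))%:R <= _).
  rewrite /boundary_flow !big_seq; apply: ler_sum => -[x j].
  rewrite mem_tree_box => /andP[xn jk].
  rewrite big_const_seq iter_addr addr0 -[leLHS]mulr_natr.
  apply: ler_pM; rewrite ?mulr_ge0 ?region_prob_ge0 //.
    apply: le_trans (region_prob_le_connection adj p01 o (x, j) fS).
    by rewrite ler_piMl // region_prob_ge0.
  by rewrite ler_nat; exact: exits.
rewrite big_tree_box.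
have stepx i x : (i <= n)%N -> x \in descendants i root ->
    \sum_(j <- heights k) tau o (x, j) * (2 * (`|j|%N == k) + d * (size (letters x) == n))%:R
    <= 4 * m i + (i == n)%:R * (d%:R * (2 * k + 1)%:R * A ^+ n).
  move=> i_n; rewrite mem_descendants /= addn0 => /andP[/eqP xi _]; rewrite xi.
  under eq_bigr do rewrite natrD mulrDr; rewrite big_split /=; apply: lerD.
    apply: le_trans (_ : \sum_(j <- heights k) (`|j|%N == k)%:R * (2 * m i) <= _).
      apply: ler_sum => j _; case: (eqVneq `|j|%N k) => [jk|_]; last by rewrite muln0 mulr0 mul0r.
      by rewrite muln1 mul1r mulrC ler_wpM2l // -xi hm // xi.
    rewrite -mulr_suml sum_indicator.
    have := count_extremal k; rewrite -(ler_nat R) => c2.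
    by apply: le_trans (ler_wpM2r (mulr_ge0 _ (m0 i)) c2) _ => //; rewrite mulrA -natrM.
  case: (eqVneq i n) => [i_eq|_]; last by rewrite big1 ?mul0r // => j _; rewrite muln0 mulr0.
  rewrite muln1 mul1r -mulr_suml mulrC -mulrA ler_wpM2l //.
  apply: le_trans (_ : \sum_(j <- heights k) A ^+ n <= _).
    by apply: ler_sum => j _; rewrite -i_eq -xi.
  by rewrite big_const_seq count_predT size_map size_iota iter_addr addr0 mulr_natl.
apply: le_trans (_ : \sum_(0 <= i < n.+1) \sum_(x <- descendants i root)
   (4 * m i + (i == n)%:R * (d%:R * (2 * k + 1)%:R * A ^+ n)) <= _).
  rewrite !big_nat; apply: ler_sum => i /andP[_ i_n].
  rewrite big_seq [leRHS]big_seq; apply: ler_sum => x xi; exact: stepx.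
have sphere i : (size (descendants i root))%:R <= 2 * D ^+ i.
  by rewrite /D -natrX -natrM ler_nat size_sphere //; lia.
apply: le_trans (_ : \sum_(0 <= i < n.+1)
   (8 * D ^+ i * m i + (i == n)%:R * (2 * d%:R * (2 * k + 1)%:R * (D * A) ^+ n)) <= _).
  apply: ler_sum_nat => i _.
  rewrite big_const_seq count_predT iter_addr addr0 -[leLHS]mulr_natl.
  apply: le_trans (_ : 2 * D ^+ i * (4 * m i + (i == n)%:R * (d%:R * (2 * k + 1)%:R * A ^+ n)) <= _).
    by apply: ler_wpM2r => //; rewrite addr_ge0 ?mulr_ge0 ?exprn_ge0.
  rewrite mulrDr; apply: lerD; first by rewrite le_eqVlt; apply/orP; left; apply/eqP; ring.
  case: (eqVneq i n) => [->|_]; last by rewrite !mul0r mulr0.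
  by rewrite exprMn le_eqVlt; apply/orP; left; apply/eqP; ring.
rewrite big_split /= lerD2l big_nat_recr //= eqxx mul1r big_nat_cond big1 ?add0r //.
by move=> i /andP[/andP[_ i_n] _]; rewrite (ltn_eqF i_n) mul0r.
Qed.

(** The order of the choices is what matters: [i0] cuts off the tail of a
    geometric series that does not depend on [k], then [k] makes the remaining
    finitely many terms small, and finally [n] is large enough to compensate
    for the [2 * k + 1] heights of the side. *)
Lemma small_flow : exists S : {fset V},
  o \in S /\ boundary_flow adj (@neighbors d) p S o < 1.
Proof.
pose r := D * A.
have D0 : 0 <= D by have := D_ge2; lra.
have r01 : 0 <= r < 1 by rewrite DA_lt1 andbT mulr_ge0.
have r1 : 0 < 1 - r by case/andP: r01 => _; rewrite subr_gt0.
have e32 : 0 < (1 - r) / 32 by rewrite divr_gt0.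
have [i0 hi0] := exprn_small r01 e32.
pose C0 := \sum_(0 <= i < i0) 8 * D ^+ i * (p ^+ i)^-1.
have C00 : 0 <= C0.
  by apply: sumr_ge0 => i _; rewrite !mulr_ge0 ?exprn_ge0 // invr_ge0 exprn_ge0 // ltW.
have [k hk] : exists k : nat, tau o (root, k%:Z) < (4 * (C0 + 1))^-1.
  by apply: low_height; rewrite invr_gt0; lra.
have c0 : 0 < 8 * d%:R * (2 * k + 1)%:R :> R.
  apply: mulr_gt0; last by rewrite ltr0n addn1.
  by apply: mulr_gt0 => //; exact: d_gt0.
have [n1 hn1] : exists n1, forall n, (n1 <= n)%N -> r ^+ n < (8 * d%:R * (2 * k + 1)%:R)^-1.
  by apply: exprn_small r01 _; rewrite invr_gt0.
pose n := maxn i0 n1.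
pose g := tau o (root, k%:Z).
(* below [i0] the bound by the axis, from [i0] on the bound uniform in [k] *)
pose m i := if (i < i0)%N then (p ^+ i)^-1 * g else A ^+ i.
have pi i : 0 < p ^+ i by exact: exprn_gt0.
exists (tree_box n k); split; first by rewrite mem_tree_box.
apply: le_lt_trans (flow_le (m := m) _ _) _.
- move=> x j xn jk; rewrite /m; case: ifP => _; last exact: tauA_height.
  rewrite mulrC ler_pdivlMr // mulrC; apply: le_trans (connection_prob_vertical p01 x j) _.
  have [->//|->] : j = k%:Z \/ j = - k%:Z.
    by move: jk; clear; lia.
  apply: le_trans (connection_prob_opp p01 _ _ _ _) _.
  by rewrite oppr0 opprK.
- move=> i; rewrite /m; case: ifP => _; last exact: exprn_ge0.
  by apply: mulr_ge0; [rewrite invr_ge0 ltW|exact: tau_ge0].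
- rewrite -/r (big_cat_nat (n := i0)) //=; last by rewrite leqW // leq_maxl.
  have -> : \sum_(0 <= i < i0) 8 * D ^+ i * m i = C0 * g.
    rewrite /C0 mulr_suml; apply: eq_big_nat => i /andP[_ ii0].
    by rewrite /m ii0 mulrA.
  have -> : \sum_(i0 <= i < n.+1) 8 * D ^+ i * m i = 8 * \sum_(i0 <= i < n.+1) r ^+ i.
    rewrite mulr_sumr; apply: eq_big_nat => i /andP[ii0 _].
    by rewrite /m ltnNge ii0 /= /r exprMn mulrA.
  have h1 : C0 * g <= 1 / 4.
    apply: le_trans (_ : C0 * (4 * (C0 + 1))^-1 <= _); first by rewrite ler_wpM2l // ltW.
    by rewrite ler_pdivrMr; lra.
  have h2 : 8 * \sum_(i0 <= i < n.+1) r ^+ i <= 1 / 4.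
    apply: le_trans (_ : 8 * (r ^+ i0 / (1 - r)) <= _).
      by rewrite ler_wpM2l // geometric_tail.
    have := hi0 _ (leqnn i0) => h.
    have : r ^+ i0 / (1 - r) <= 32^-1 by rewrite ler_pdivrMr // mulrC ltW.
    lra.
  have h3 : 2 * d%:R * (2 * k + 1)%:R * r ^+ n <= 1 / 4.
    have := ltW (hn1 n (leq_maxr _ _)).
    rewrite -div1r ler_pdivlMr //; set q := r ^+ n => h.
    have -> : 2 * d%:R * (2 * k + 1)%:R * q = q * (8 * d%:R * (2 * k + 1)%:R) / 4.
      by field.
    by rewrite ler_wpM2r.
  lra.
Qed.
End Box.

Section CriticalPoint.
Variable d : nat.
Hypothesis d_gt2 : (2 < d)%N.
Local Notation root := (tree_root d).
Local Notation V := (tree d * int)%type.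
Local Notation adj := (@tree_line d).
Local Notation o := ((root, 0) : V).
Variable R : realType.

Let percolates : set R := [set p : R | 0 <= p <= 1 /\
  {ae bernoulli_measure (edge adj) p, forall w, infinite_cluster_exists w}].

Lemma small_flow_no_percolation (p : R) (S : {fset V}) : 0 <= p <= 1 ->
  o \in S -> boundary_flow adj (@neighbors d) p S o < 1 -> ~ percolates p.
Proof.
move=> p01 oS flow1 [_].
apply: (@finite_size_criterion _ adj (@tree_line_sym d) (@neighbors d) (@mem_neighbors d)
  R p (boundary_flow adj (@neighbors d) p S o) #|` S|) => //.
- rewrite flow1 andbT /boundary_flow; apply: sumr_ge0 => a _; apply: sumr_ge0 => b _.
  by case/andP: (p01) => p0 _; rewrite mulr_ge0 // region_prob_ge0 //; exact: finite_fset.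
move=> [x i]; have [f fa hf] := tree_translation x.
have fx : f root = x by exact: hf.
pose h (j : int) := j + i.
have ha : line_automorphism h := line_automorphism_shift i.
have ox : act f h o = (x, i) by rewrite /act /= fx /h add0r.
exists (act f h @` S)%fset; split.
- by rewrite -ox; exact: in_imfset.
- by rewrite card_imfset //; exact: act_inj.
- rewrite -ox boundary_flow_automorphism //.
  + exact: tree_line_sym.
  + exact: act_inj.
  + by move=> *; exact: act_adj.
  + by move=> *; apply: perm_neighbors => //; lia.
Qed.

Hypothesis percolates1 : percolates 1.
Local Notation pc := (critical_prob adj R).

Lemma critical_prob01 : 0 <= pc <= 1.
Proof.
apply/andP; split.
  by apply: lb_le_inf; [exists 1|move=> p [/andP[]]].
by apply: ge_inf => //; exists 0 => p [/andP[]].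
Qed.

(** Otherwise the flow would be less than one at some percolating parameter
    just above the infimum, by continuity. *)
Lemma critical_flow (S : {fset V}) : o \in S ->
  1 <= boundary_flow adj (@neighbors d) pc S o.
Proof.
move=> oS; rewrite leNgt; apply/negP => flow1.
have cont := @boundary_flow_continuous _ adj (@neighbors d) R S o pc.
have near1 : \forall q \near pc, boundary_flow adj (@neighbors d) q S o < 1.
  exact: (cvgr_lt _ cont _ flow1).
have [e /= e0 he] := (nbhs_normP _ _).1 near1.
have hi : has_inf percolates by split; [exists 1|exists 0 => p [/andP[]]].
have [p pP ppc] := inf_adherent e0 hi.
have pcp : pc <= p by apply: ge_inf => //; exists 0 => q [/andP[]].
have p01 := pP.1; apply: (small_flow_no_percolation p01 oS) pP.
apply: he; rewrite /= distrC ger0_norm ?subr_ge0 //.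
by rewrite ltrBlDl.
Qed.

Lemma critical_prob_gt0 : 0 < pc.
Proof.
case/andP: critical_prob01 => pc0 _; rewrite lt_neqAle pc0 andbT eq_sym.
apply/eqP => pcE; have := @critical_flow [fset o]%fset.
rewrite in_fset1 eqxx => /(_ isT).
rewrite /boundary_flow pcE big1 ?ler10 // => a _; rewrite big1 // => b _.
by rewrite mul0r.
Qed.

Lemma percolates_ge_critical p : percolates p -> pc <= p.
Proof. by move=> pp; apply: ge_inf => //; exists 0 => q [/andP[]]. Qed.
End CriticalPoint.

(** * Thinning independent events *)

Section Thinning.
Variables (E I : eqType) (R : realType) (p : R).
Hypothesis p01 : 0 <= p <= 1.
Implicit Types (r s : I -> (E -> bool) -> R).

(** The factors [s i] are independent of each other and of everything else, so
    each of them can be replaced in turn by a lower bound of its mean. In a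
    branching process, [r i] tells whether [i] is reached and [s i] whether
    its descent survives. *)
Lemma expect_thinning (eps : R) (D0 : set E) (D : I -> set E) r s (l : seq I)
    (G : (E -> bool) -> R) :
  0 <= eps <= 1 -> uniq l ->
  finitary G -> depends D0 G -> (forall w, 0 <= G w) ->
  (forall i, i \in l -> finitary (r i) /\ depends D0 (r i)) ->
  (forall i w, i \in l -> 0 <= r i w <= 1) ->
  (forall i, i \in l -> finitary (s i) /\ depends (D i) (s i)) ->
  (forall i w, i \in l -> 0 <= s i w <= 1) ->
  (forall i, i \in l -> eps <= expect p (s i)) ->
  (forall i, i \in l -> D0 `&` D i = set0) ->
  (forall i j, i \in l -> j \in l -> i != j -> D i `&` D j = set0) ->
  expect p (fun w => G w * \prod_(i <- l) (1 - r i w * s i w)) <=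
  expect p (fun w => G w * \prod_(i <- l) (1 - eps * r i w)).
Proof.
move=> /andP[e0 e1]; elim: l G => [|i l IH] G /=.
  move=> _ *; rewrite (_ : (fun w => _) = (fun w => G w * \prod_(i <- [::]) (1 - eps * r i w))) //.
  by apply/funext => w; rewrite !big_nil.
move=> /andP[il ul] fG dG G0 hr r01 hs s01 es D0D DD.
have sub j : j \in l -> j \in i :: l by move=> jl; rewrite inE jl orbT.
have im : i \in i :: l by rewrite mem_head.
have [fr dr] := hr i im; have [fs ds] := hs i im.
pose P w := \prod_(j <- l) (1 - r j w * s j w).
have fP : finitary P.
  apply: finitary_bigop => j /sub jl _.
  apply: finitaryB; first exact: finitary_cst.
  by apply: finitaryM; [case: (hr j jl)|case: (hs j jl)].
pose D1 : set E := [set e | D0 e \/ exists2 j, j \in l & D j e].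
have dP : depends D1 P.
  move=> w w' ww'; apply: eq_big_seq => j jl; have jl' := sub j jl.
  rewrite (((hr j jl').2) w w'); last by move=> e De; apply: ww'; left.
  by rewrite (((hs j jl').2) w w') // => e De; apply: ww'; right; exists j.
have P0 w : 0 <= P w.
  rewrite /P big_seq; apply: prodr_ge0 => j /sub jl.
  case/andP: (r01 j w jl) => rj0 rj1; case/andP: (s01 j w jl) => sj0 sj1.
  by rewrite subr_ge0; apply: mulr_ile1.
have D01 : D0 `<=` D1 by move=> e; left.
have fH : finitary (fun w => G w * P w) by exact: finitaryM.
have dH : depends D1 (fun w => G w * P w).
  by apply: depends_comp2 dP; exact: depends_sub dG.
have fHr : finitary (fun w => G w * P w * r i w) by exact: finitaryM.
have dHr : depends D1 (fun w => G w * P w * r i w).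
  by apply: depends_comp2 dH _; exact: depends_sub dr.
have DD1 : D1 `&` D i = set0.
  apply/seteqP; split => // e [[De|[j jl De]] Di].
    by have : (D0 `&` D i) e by []; rewrite D0D.
  have ji : j != i by apply: contraNneq il => <-.
  by have : (D j `&` D i) e by []; rewrite DD // sub.
have -> : (fun w => G w * \prod_(j <- i :: l) (1 - r j w * s j w)) =
    (fun w => G w * P w - G w * P w * r i w * s i w).
  by apply/funext => w; rewrite big_cons -/(P w); ring.
rewrite expectB //; last exact: finitaryM.
rewrite (expectM p fHr fs dHr ds DD1).
apply: le_trans (_ : expect p (fun w => G w * P w) -
    expect p (fun w => G w * P w * r i w) * eps <= _).
  rewrite lerD2l lerN2 ler_wpM2l ?es //.
  apply: expect_ge0 => // w; case/andP: (r01 i w im) => ri0 _.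
  by rewrite !mulr_ge0.
rewrite mulrC -expectZ // -expectB //; last exact: finitary_comp.
have -> : (fun w => G w * P w - eps * (G w * P w * r i w)) =
    (fun w => (G w * (1 - eps * r i w)) * P w).
  by apply/funext => w; ring.
have -> : (fun w => G w * \prod_(j <- i :: l) (1 - eps * r j w)) =
    (fun w => (G w * (1 - eps * r i w)) * \prod_(j <- l) (1 - eps * r j w)).
  by apply/funext => w; rewrite big_cons mulrA.
have f1 : finitary (fun w => 1 - eps * r i w) by exact: (finitary_comp (fun t => 1 - eps * t)).
apply: IH => //.
- exact: finitaryM.
- apply: depends_comp2 dG _; exact: (depends_comp (fun t => 1 - eps * t)).
- move=> w; rewrite mulr_ge0 // subr_ge0.
  by case/andP: (r01 i w im) => ri0 ri1; apply: mulr_ile1.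
- by move=> j /sub; exact: hr.
- by move=> j w /sub; exact: r01.
- by move=> j /sub; exact: hs.
- by move=> j w /sub; exact: s01.
- by move=> j /sub; exact: es.
- by move=> j /sub; exact: D0D.
- by move=> j j' /sub jl /sub jl'; exact: DD.
Qed.
End Thinning.

(** A Bonferroni inequality, weakened so that only the total [\sum_i r i]
    appears. *)
Lemma prod_one_sub_le (R : realType) (I : eqType) (l : seq I) (eps : R) (r : I -> R) :
  0 <= eps <= 1 -> (forall i, i \in l -> 0 <= r i <= 1) ->
  \prod_(i <- l) (1 - eps * r i) <=
  1 - eps * (\sum_(i <- l) r i) + eps ^+ 2 * (\sum_(i <- l) r i) ^+ 2.
Proof.
move=> /andP[e0 e1]; elim: l => [|i l IH] r01; first by rewrite !big_nil; lra.
have /andP[ri0 ri1] := r01 i (mem_head _ _).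
have r01' j : j \in l -> 0 <= r j <= 1 by move=> jl; apply: r01; rewrite inE jl orbT.
rewrite !big_cons; set S := \sum_(j <- l) r j.
have S0 : 0 <= S by rewrite /S big_seq; apply: sumr_ge0 => j /r01' /andP[].
have er : eps * r i <= 1 by apply: mulr_ile1.
apply: le_trans (ler_wpM2l _ (IH r01')) _; first by rewrite subr_ge0.
rewrite -/S -subr_ge0.
have -> : 1 - eps * (r i + S) + eps ^+ 2 * (r i + S) ^+ 2 -
  (1 - eps * r i) * (1 - eps * S + eps ^+ 2 * S ^+ 2) =
  eps ^+ 2 * r i ^+ 2 + eps ^+ 2 * (r i * S) + eps ^+ 2 * eps * (r i * S ^+ 2).
  by ring.
by rewrite !addr_ge0 ?mulr_ge0 ?exprn_ge0.
Qed.

Lemma one_sub_has (R : realType) (I : Type) (l : seq I) (P : pred I) :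
  1 - (has P l)%:R = \prod_(i <- l) (1 - (P i)%:R) :> R.
Proof.
elim: l => [|i l IH]; first by rewrite big_nil subr0.
by rewrite big_cons -IH /=; case: (P i); rewrite ?subrr ?mul0r // subr0 mul1r.
Qed.

(** * A branching process of layers *)

Section Branching.
Variable d : nat.
Local Notation root := (tree_root d).
Local Notation V := (tree d * int)%type.
Local Notation adj := (@tree_line d).
Local Notation E := (edge adj).
Local Notation o := ((root, 0) : V).
Implicit Types (x y u v : tree d).

Definition in_cone u x := suffix (letters u) (letters x).

Let in_cone_size u x : in_cone u x -> (size (letters u) <= size (letters x))%N.
Proof. exact: size_suffix. Qed.

Let in_cone_step u x y : adjT x y -> in_cone u x ->
  (size (letters u) < size (letters x))%N -> in_cone u y.
Proof.
rewrite /in_cone => /adjTP[[a xE]|[a yE]] ux su; last first.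
  by rewrite yE; apply: suffix_trans ux _; rewrite -cat1s suffix_suffix.
move: ux su; rewrite xE => /suffixP[[|b k] /= e]; first by rewrite -e ltnn.
by move=> _; case: e => _ ->; exact: suffix_suffix.
Qed.

Lemma in_cone_path u x s i : path (@adjT d) x s -> in_cone u x ->
  size (letters x) = (size (letters u) + i)%N -> (size s <= i)%N ->
  in_cone u (last x s).
Proof.
elim: s x i => //= y s IH x [|i] // /andP[xy ys] ux sx si.
have uy : in_cone u y by apply: (in_cone_step xy ux); rewrite sx; lia.
have : size (letters y) = (size (letters x)).+1 \/ size (letters x) = (size (letters y)).+1.
  by case/adjTP: xy => -[a ->]; [right|left].
case=> sy; first by apply: (IH y i.+2) => //; lia.
by apply: (IH y i) => //; lia.
Qed.

Let in_cone_descendants m u v : v \in descendants m u -> in_cone u v.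
Proof.
rewrite mem_descendants /in_cone => /andP[_ /eqP <-].
by rewrite -{2}(cat_take_drop m (letters v)) suffix_suffix.
Qed.

Let in_cone_eq u v x : in_cone u x -> in_cone v x ->
  size (letters u) = size (letters v) -> u = v.
Proof.
move=> /suffixP[k xk] /suffixP[l xl] uv; apply: val_inj => /=.
have := congr1 (drop (size k)) xk; rewrite drop_size_cat // => <-.
rewrite xl drop_size_cat //.
by have := congr1 size xk; rewrite xl !size_cat uv => /addIn.
Qed.

Let edge_ends (e : E) : exists a b, adj a b /\ endpoints e = [fset a; b]%fset.
Proof.
have /existsP[a /existsP[b /andP[ab /eqP ee]]] := endpointsP e.
by exists (val a), (val b).
Qed.

Variables (m H : nat).

(** The region explored by one generation from [u]. At relative depth [m] it
    contains only the vertices at height [0] from which the next generation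
    starts, and no edge between them. *)
Definition layer u : set V := [set a | in_cone u a.1 /\
  ((size (letters a.1) < size (letters u) + m)%N /\ (`|a.2| <= H)%N \/
   size (letters a.1) = (size (letters u) + m)%N /\ a.2 = 0)].

Lemma layer_finite u : finite_set (layer u).
Proof.
apply: sub_finite_set (finite_fset (tree_box d (size (letters u) + m) H)) => -[x j].
rewrite /layer /= => -[_ h]; rewrite mem_tree_box //.
by case: h => [[? ->]|[-> ->]]; rewrite ?leqnn ?andbT //; lia.
Qed.

Definition reach u v : (E -> bool) -> bool := fun w => conn (layer u) w (u, 0) (v, 0).

Fixpoint survives N u (w : E -> bool) : bool :=
  if N is N'.+1 then has (fun v => reach u v w && survives N' v w) (descendants m u)
  else true.

Let cone_edges u : set E := inside [set a : V | in_cone u a.1].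

Let depends_reach u v : depends (inside (layer u)) (reach u v).
Proof. exact: depends_conn. Qed.

Let layer_cone u : inside (layer u) `<=` cone_edges u.
Proof. by move=> e De a /De []. Qed.

Let depends_survives N u : depends (cone_edges u) (survives N u).
Proof.
elim: N u => // N IH u w w' ww' /=; apply: eq_in_has => v vu.
have -> : reach u v w = reach u v w'.
  by apply: depends_reach => e /layer_cone; exact: ww'.
rewrite (IH v w w') // => e De; apply: ww' => a /De /=.
by apply: suffix_trans; exact: in_cone_descendants vu.
Qed.

Let finitary_survives N u : finitary (survives N u).
Proof.
elim: N u => [|N IH] u; first exact: finitary_cst.
have h (l : seq (tree d)) : finitary (fun w => has (fun v => reach u v w && survives N v w) l).
  elim: l => [|v l IHl] /=; first exact: finitary_cst.
  apply: (finitary_comp2 orb) IHl; apply: (finitary_comp2 andb) (IH v).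
  by apply: finitary_conn; exact: layer_finite.
exact: h.
Qed.

Lemma survives_anti N u w : survives N.+1 u w -> survives N u w.
Proof.
elim: N u => [|N IH] u //= /hasP[v vu /andP[uv sv]]; apply/hasP; exists v => //.
by rewrite uv IH.
Qed.

Lemma survives_anti_le M N u w : (M <= N)%N -> survives N u w -> survives M u w.
Proof.
move=> /subnK <-; elim: (N - M)%N => // n IH h; apply: IH; exact: survives_anti.
Qed.

Let survives_far N u w : survives N u w -> exists2 v,
  size (letters v) = (size (letters u) + N * m)%N & conn setT w (u, 0) (v, 0).
Proof.
elim: N u => [|N IH] u /=.
  by exists u; rewrite ?addn0 //; exact: conn_refl.
move=> /hasP[v vu /andP[uv /IH[x sx vx]]]; exists x.
  by move: vu; rewrite sx mem_descendants => /andP[/eqP -> _]; lia.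
by apply: (conn_trans (conn_sub _ uv) vx).
Qed.

Lemma survives_infinite u w : (0 < m)%N -> (forall N, survives N u w) -> infinite_cluster_exists w.
Proof.
move=> m_gt0 su; exists (u, 0) => /finite_fsetP[B BE].
pose N := (\max_(a <- enum_fset B) size (letters a.1)).+1.
have [v sv /asboolP[s [ps _ ls]]] := survives_far (su N).
have vB : (v, 0) \in B.
  have : open_cluster w (u, 0) (v, 0) by exists s.
  by rewrite BE.
have : (size (letters v) < N)%N.
  by rewrite ltnS; apply: (@leq_bigmax_seq _ _ predT (fun a : V => size (letters a.1)) _ vB).
rewrite sv; apply/negP; rewrite -leqNgt; apply: leq_trans (leq_addl _ _).
by rewrite leq_pmulr.
Qed.

Variables (R : realType) (p : R).

Let finitary_survivesR N u : finitary (fun w => (survives N u w)%:R : R).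
Proof. exact: (finitary_comp (fun b : bool => b%:R) (finitary_survives N u)). Qed.

Let cone_disjoint u v : size (letters u) = size (letters v) -> u != v ->
  cone_edges u `&` cone_edges v = set0.
Proof.
move=> suv uv; apply/seteqP; split => // e [Du Dv].
have [a [b [_ ee]]] := edge_ends e.
have ae : a \in endpoints e by rewrite ee in_fset2 eqxx.
by move/eqP: uv; apply; exact: (in_cone_eq (Du a ae) (Dv a ae)).
Qed.

(** An edge in both sets would have its two ends in the layer at depth [m] and
    in the cone of [v], hence both equal to [(v, 0)]. *)
Let layer_disjoint u v : v \in descendants m u ->
  inside (layer u) `&` cone_edges v = set0.
Proof.
move=> vu; apply/seteqP; split => // e [Du Dv].
have [a [b [ab ee]]] := edge_ends e.
have ae : a \in endpoints e by rewrite ee in_fset2 eqxx.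
have be : b \in endpoints e by rewrite ee in_fset2 eqxx orbT.
have sv : size (letters v) = (m + size (letters u))%N.
  by move: vu; rewrite mem_descendants => /andP[/eqP].
have bottom c : c \in endpoints e -> c = (v, 0).
  move=> ce; have vc := Dv c ce; have := in_cone_size vc; rewrite sv => sc.
  have [_ [[]|[sc' c0]]] := Du c ce; first by lia.
  case: c {ce} vc sc' c0 {sc} => x j /= vx sx ->; congr (_, _).
  apply: (in_cone_eq _ vx); first exact: suffix_refl.
  by rewrite sx sv addnC.
move: ab; rewrite (bottom a ae) (bottom b be) /tree_line /box.
by case/orP => /andP[] // /adjTP[] [c /(congr1 size)] /=; lia.
Qed.

Hypotheses (d_gt2 : (2 < d)%N) (p01 : 0 <= p <= 1) (m_gt0 : (0 < m)%N).
Variable c0 : R.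
Hypothesis reach_ge : forall u v, u != root -> v \in descendants m u ->
  c0 <= region_prob adj p (layer u) (u, 0) (v, 0).
Let K : R := ((d.-1) ^ m)%:R.
Hypothesis supercritical : 1 < K * c0.

(** A value of [eps] such that [1 - eps * (K * c0) + eps ^+ 2 * K ^+ 2 = 1 -
    eps]. *)
Definition survival_bound : R := (K * c0 - 1) / K ^+ 2.
Local Notation eps := survival_bound.

Let K_ge1 : 1 <= K.
Proof. by rewrite /K ler1n expn_gt0; lia. Qed.

Let c0_le1 : c0 <= 1.
Proof.
have [u1 [v vu]] : exists u v, u != root /\ v \in descendants m u.
  have [u u1] := word_exists d_gt2 1; exists u.
  have u0 : u != root by apply/eqP => e; move: u1; rewrite e.
  have : (0 < size (descendants m u))%N by rewrite size_descendants // expn_gt0; lia.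
  by case Ev: (descendants m u) => [//|v s] _; exists v; rewrite mem_head.
case: vu => u0 vu.
by apply: le_trans (reach_ge u0 vu) _; apply: region_prob_le1 => //; exact: layer_finite.
Qed.

Lemma survival_bound01 : 0 < eps <= 1.
Proof.
have K0 : 0 < K by apply: lt_le_trans K_ge1.
have K20 : 0 < K ^+ 2 by exact: exprn_gt0.
rewrite /eps divr_gt0 ?subr_gt0 //= ler_pdivrMr // mul1r.
have h1 : K * c0 <= K by rewrite ler_piMr // ltW.
have h2 : K * 1 <= K * K by rewrite ler_wpM2l // ltW.
by rewrite expr2; lra.
Qed.

(** The cones of the [K] vertices of the next generation are disjoint, so
    [expect_thinning] and [prod_one_sub_le] bound the extinction probability
    by [1 - eps * (K * c0) + eps ^+ 2 * K ^+ 2]. The lower bound [eps]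
    reproduces itself from one generation to the next. *)
Lemma survival_prob_ge N u : u != root -> eps <= expect p (fun w => (survives N u w)%:R).
Proof.
have /andP[e0 e1] := survival_bound01.
elim: N u => [|N IH] u u0 /=; first by rewrite expect_cst.
have nonroot v : v \in descendants m u -> v != root.
  rewrite mem_descendants => /andP[/eqP sv _]; apply/eqP => ve.
  by move: sv; rewrite ve /=; lia.
pose P w : R := \prod_(v <- descendants m u) (1 - (reach u v w)%:R * (survives N v w)%:R).
have fr v : finitary (fun w => (reach u v w)%:R : R).
  by apply: finitary_connR; exact: layer_finite.
have fP : finitary P.
  apply: finitary_bigop => v _ _; apply: finitaryB; first exact: finitary_cst.
  exact: finitaryM.
have PE w : (has (fun v => reach u v w && survives N v w) (descendants m u))%:R = 1 - P w :> R.
  rewrite /P; under eq_bigr do rewrite -natrM mulnb.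
  by rewrite -one_sub_has opprB addrC subrK.
under eq_fun do rewrite PE.
rewrite expectB //; last exact: finitary_cst.
rewrite expect_cst lerBrDr -lerBrDl.
pose Q w : R := \prod_(v <- descendants m u) (1 - eps * (reach u v w)%:R).
have fQ : finitary Q.
  apply: finitary_bigop => v _ _; exact: (finitary_comp (fun t => 1 - eps * t)).
apply: le_trans (_ : expect p Q <= _).
  have thin := @expect_thinning E (tree d) R p p01 eps (inside (layer u)) cone_edges
    (fun v w => (reach u v w)%:R) (fun v w => (survives N v w)%:R) (descendants m u) (fun=> 1).
  have -> : P = (fun w => 1 * P w) by apply/funext => w; rewrite mul1r.
  have -> : Q = (fun w => 1 * Q w) by apply/funext => w; rewrite mul1r.
  apply: thin => //.
  - by rewrite (ltW e0).
  - exact: uniq_descendants.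
  - exact: finitary_cst.
  - move=> v _; split; first exact: fr.
    exact: (depends_comp (fun b : bool => b%:R : R) (@depends_reach u v)).
  - by move=> v w _; rewrite ler0n lern1 leq_b1.
  - move=> v _; split; first exact: finitary_survivesR.
    exact: (depends_comp (fun b : bool => b%:R : R) (@depends_survives N v)).
  - by move=> v w _; rewrite ler0n lern1 leq_b1.
  - by move=> v vu; apply: IH; exact: nonroot.
  - by move=> v vu; exact: layer_disjoint.
  - move=> v v'; rewrite !mem_descendants => /andP[/eqP sv _] /andP[/eqP sv' _].
    by apply: cone_disjoint; rewrite sv sv'.
pose S w : R := \sum_(v <- descendants m u) (reach u v w)%:R.
have fS : finitary S by apply: finitary_bigop.
have sizeK : (size (descendants m u))%:R = K by rewrite size_descendants.
have S0 w : 0 <= S w by apply: sumr_ge0.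
have SK w : S w <= K.
  rewrite -sizeK /S sum_indicator ler_nat; exact: count_size.
apply: le_trans (_ : expect p (fun w => 1 - eps * S w + eps ^+ 2 * K ^+ 2) <= _).
  apply: expect_le => //; first exact: (finitary_comp (fun t => 1 - eps * t + eps ^+ 2 * K ^+ 2)).
  move=> w; apply: le_trans (prod_one_sub_le _ _) _.
  - by rewrite ltW.
  - by move=> v _; rewrite ler0n lern1 leq_b1.
  - rewrite lerD2l ler_wpM2l ?exprn_ge0 ?(ltW e0) //.
    by rewrite !expr2; apply: ler_pM; rewrite ?S0 ?SK.
have ES : K * c0 <= expect p S.
  rewrite /S expect_sum // -sizeK mulr_natl.
  rewrite -[leLHS]addr0 -iter_addr -(count_predT (descendants m u)) -big_const_seq.
  by rewrite !big_seq; apply: ler_sum => v vu; exact: reach_ge.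
have f2 : finitary (fun w => 1 - eps * S w) by exact: (finitary_comp (fun t => 1 - eps * t)).
rewrite expectD ?expect_cst //; last exact: finitary_cst.
rewrite expectB ?expect_cst ?expectZ //; [|exact: finitary_cst|exact: finitary_comp].
have epsE : eps * K ^+ 2 = K * c0 - 1.
  by rewrite /eps divfK // expf_neq0 // gt_eqF // (lt_le_trans ltr01 K_ge1).
have -> : eps ^+ 2 * K ^+ 2 = eps * (K * c0 - 1) by rewrite -epsE; ring.
have := ler_wpM2l (ltW e0) ES; lra.
Qed.

Let extinct (us : seq (tree d)) N w := ~~ has (fun u => survives N u w) us.

Let finitary_extinct us N : finitary (extinct us N).
Proof.
apply: finitary_comp; elim: us => [|u us IH] /=; first exact: finitary_cst.
exact: (finitary_comp2 orb (finitary_survives N u) IH).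
Qed.

Let mu := bernoulli_measure E p.

Let extinct_prob k us N : uniq us -> root \notin us ->
  (forall u, u \in us -> size (letters u) = k) ->
  (mu [set w : config E | extinct us N w] <= ((1 - eps) ^+ size us)%:E)%E.
Proof.
move=> uu r_us szu; have /andP[e0 e1] := survival_bound01.
rewrite /mu bernoulli_measure_finitary // lee_fin.
have thin := @expect_thinning E (tree d) R p p01 eps set0 cone_edges
  (fun _ _ => 1) (fun v w => (survives N v w)%:R) us (fun=> 1).
have -> : (fun w => (extinct us N w)%:R : R) =
    (fun w => 1 * \prod_(u <- us) (1 - 1 * (survives N u w)%:R)).
  apply/funext => w; rewrite mul1r; under eq_bigr do rewrite mul1r.
  by rewrite -one_sub_has /extinct; case: (has _ _); rewrite ?subrr ?subr0.
apply: le_trans (thin _ _ _ _ _ _ _ _ _ _ _ _) _ => //.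
- by rewrite (ltW e0).
- exact: finitary_cst.
- by move=> v _; split; [exact: finitary_cst|].
- by move=> *; rewrite ler01 lexx.
- move=> v _; split; first exact: finitary_survivesR.
  exact: (depends_comp (fun b : bool => b%:R : R) (@depends_survives N v)).
- by move=> v w _; rewrite ler0n lern1 leq_b1.
- move=> v vu; apply: survival_prob_ge; by apply: contraNneq r_us => <-.
- by move=> v _; rewrite set0I.
- by move=> v v' vu vu'; apply: cone_disjoint; rewrite !szu.
- rewrite expect_cst mul1r mulr1 big_const_seq count_predT.
  by rewrite -Monoid.iteropE /=; elim: (size us) => //= n IH; rewrite exprS ler_wpM2l // subr_ge0.
Qed.

(** The cones of the vertices [us n] of a same generation are disjoint, and
    all of them become extinct with probability at most [(1 - eps) ^+ size (us
    n)], which tends to [0]. *)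
Lemma supercritical_percolates :
  {ae bernoulli_measure E p, forall w, infinite_cluster_exists w}.
Proof.
have /andP[e0 e1] := survival_bound01.
(* away from the root, all vertices have the same number of children *)
have [u1 su1] := word_exists d_gt2 1.
have u1r : u1 != root by apply/eqP => e; move: su1; rewrite e.
pose us n := descendants n u1.
have us_size n u : u \in us n -> size (letters u) = (n + 1)%N.
  by rewrite mem_descendants su1 => /andP[/eqP].
have us_root n : root \notin us n.
  by apply/negP => /us_size /=; lia.
pose B n N : set (config E) := [set w : config E | extinct (us n) N w].
have mB n N : measurable (B n N) by exact: (measurable_finitary p01 (finitary_extinct _ _)).
have mUB n : measurable (\bigcup_N B n N) by exact: bigcupT_measurable.
have muUB n : (mu (\bigcup_N B n N) <= ((1 - eps) ^+ size (us n))%:E)%E.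
  have cv : mu \o B n @ \oo --> mu (\bigcup_N B n N).
    apply: nondecreasing_cvg_mu => // M N MN; apply/subsetPset => w.
    apply: contra => /hasP[u uu su]; apply/hasP; exists u => //.
    exact: survives_anti_le su.
  rewrite (_ : mu (\bigcup_N B n N) = limn (mu \o B n)).
    apply: lime_le; first by apply/cvg_ex; eexists; exact: cv.
    apply: nearW => N; apply: (@extinct_prob (n + 1)) => //.
      exact: uniq_descendants.
    exact: us_size.
  by apply/esym; apply: cvg_lim.
exists (\bigcap_n \bigcup_N B n N); split.
- exact: bigcapT_measurable.
- apply/eqP; rewrite eq_le measure_ge0 andbT; apply/lee_addgt0Pr => e ep.
  rewrite add0e.
  have [|n0 hn0] := @exprn_small R (1 - eps) e _ ep.
    by rewrite subr_ge0 e1 /= ltrBlDr ltrDl.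
  apply: le_trans (_ : mu (\bigcup_N B n0 N) <= _)%E.
    apply: le_measure; rewrite ?inE //; first exact: bigcapT_measurable.
    by move=> w; apply.
  apply: le_trans (muUB n0) _; rewrite lee_fin ltW // hn0 //.
  rewrite size_descendants //; apply: ltnW; apply: ltn_expl; lia.
- move=> w /= ninf n _.
  have ex u : exists N, ~~ survives N u w.
    apply: contrapT => /forallNP h; apply: ninf; apply: (@survives_infinite u) => // N.
    by have /negP := h N; rewrite negbK.
  have [f hf] := choice ex.
  exists (\max_(u <- us n) f u) => //; apply/hasPn => u uu.
  apply: contra (hf u); apply: survives_anti_le.
  exact: leq_bigmax_seq.
Qed.
End Branching.

(** * Renormalization to a supercritical branching process *)

Section Renormalization.
Variable d : nat.
Hypothesis d_gt2 : (2 < d)%N.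
Local Notation root := (tree_root d).
Local Notation V := (tree d * int)%type.
Local Notation adj := (@tree_line d).
Local Notation o := ((root, 0) : V).
Variables (R : realType) (p : R).
Hypotheses (p01 : 0 <= p <= 1) (p_gt0 : 0 < p).
Variables (n : nat) (v : tree d) (S0 : {fset V}).
Hypotheses (n_gt0 : (0 < n)%N) (vn : size (letters v) = n).
Let t := region_prob adj p [set` S0] o (v, 0).
Let D : R := (d.-1)%:R.
Hypothesis tD : 1 < D ^+ n * t.

Let L := \max_(a <- enum_fset S0) size (letters a.1).
Let H := \max_(a <- enum_fset S0) `|a.2|%N.

Let S0L a : a \in S0 -> (size (letters a.1) <= L)%N.
Proof. by move=> aS; apply: (@leq_bigmax_seq _ _ predT (fun a : V => size (letters a.1)) _ aS). Qed.

Let S0H a : a \in S0 -> (`|a.2| <= H)%N.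
Proof. by move=> aS; apply: (@leq_bigmax_seq _ _ predT (fun a : V => `|a.2|%N) _ aS). Qed.

Let t_ge0 : 0 <= t. Proof. by apply: region_prob_ge0 => //; exact: finite_fset. Qed.

Section Reach.
Variables (k : nat) (u x : tree d).
Let m := (n * k + (2 * L + 1))%N.
Hypothesis xu : x \in descendants m u.

Let xsize : size (letters x) = (m + size (letters u))%N.
Proof. by move: xu; rewrite mem_descendants => /andP[/eqP]. Qed.

(** The ancestor of [x] at depth [i] below [u]. *)
Let anc i : tree d := Word (drop_sorted (m - i) (letters_reduced x)).

Let anc_size i : (i <= m)%N -> size (letters (anc i)) = (size (letters u) + i)%N.
Proof. by move=> im; rewrite /= size_drop xsize; lia. Qed.

Let anc0 : anc 0 = u.
Proof.
apply: val_inj => /=; rewrite subn0.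
by move: xu; rewrite mem_descendants => /andP[_ /eqP].
Qed.

Let ancm : anc m = x.
Proof. by apply: val_inj => /=; rewrite subnn drop0. Qed.

Let anc_drop i j : (i + j <= m)%N -> letters (anc i) = drop j (letters (anc (i + j))).
Proof. by move=> ijm; rewrite /= drop_drop; congr drop; lia. Qed.

Let anc_cone i : (i <= m)%N -> in_cone u (anc i).
Proof.
move=> im; rewrite /in_cone -anc0 (@anc_drop 0 i) // add0n.
by rewrite -{2}(cat_take_drop i (letters (anc i))) suffix_suffix.
Qed.

Let anc_layer i : (i <= m)%N -> layer m H u (anc i, 0).
Proof.
move=> im; split; first exact: anc_cone.
rewrite /fst anc_size //; case: (ltngtP i m) im => // [im _|-> _]; last by right.
by left; rewrite ltn_add2l.
Qed.

Let q i j := region_prob adj p (layer m H u) (anc i, 0) (anc j, 0).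

Let fl : finite_set (layer m H u). Proof. exact: layer_finite. Qed.

Let q_ge0 i j : 0 <= q i j. Proof. exact: region_prob_ge0. Qed.

Let q_trans i j l : q i j * q j l <= q i l. Proof. exact: region_prob_trans. Qed.

Let q_edge i : (i < m)%N -> p <= q i i.+1.
Proof.
move=> im; apply: region_prob_edge => //; first exact: tree_line_sym.
- by apply: anc_layer; exact: ltnW.
- exact: anc_layer.
- rewrite /tree_line /box /= eqxx andbT; apply/orP; right; apply/adjTP; right.
  have := @anc_drop i 1; rewrite addn1 => /(_ im).
  have := anc_size im; case: (letters (anc i.+1)) => [|a l]; first by rewrite addnS.
  by move=> _ ->; exists a; rewrite /= drop0.
Qed.

Let q_straight i j : (i + j <= m)%N -> p ^+ j <= q i (i + j).
Proof.
elim: j => [|j IH] ijm.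
  rewrite addn0 in ijm *; rewrite expr0 /q region_prob_id //; exact: anc_layer.
rewrite addnS exprSr; apply: le_trans (q_trans i (i + j) _).
case/andP: (p01) => p0 _.
apply: ler_pM; rewrite ?exprn_ge0 //; first by apply: IH; lia.
by apply: q_edge; rewrite -addnS.
Qed.

(** The translate of [S0] around the ancestor at depth [i] stays within
    distance [L] of it, hence inside the layer when [i] is at least [L] below
    its top and more than [L] above its bottom. *)
Let q_block i : (L <= i)%N -> (i + L < m)%N -> (i + n <= m)%N -> t <= q i (i + n).
Proof.
move=> Li iLm inm.
have si : size (letters (anc i)) = (size (letters u) + i)%N by apply: anc_size; lia.
have sin : size (letters (anc (i + n))) = (size (letters u) + (i + n))%N by exact: anc_size.
have [|z [y [E sy sz]]] := @split_word d (anc (i + n)) (size (letters (anc i))).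
  by rewrite si sin; lia.
have zn : size (letters z) = n by rewrite sz si sin; lia.
have ya : y = anc i.
  apply: val_inj; rewrite -[RHS]/(letters (anc i)) (@anc_drop i n) // E.
  by rewrite drop_size_cat.
rewrite ya in E.
have vz : size (letters v) = size (letters z) by rewrite vn zn.
have [f [fa fr fv]] := tree_pair_transitive E vz.
have ai : injective (act f id) by apply: act_inj => //; exact: line_automorphism_id.
rewrite /t -(@region_prob_automorphism _ adj (@tree_line_sym d) _ ai _ R p [set` S0] o (v, 0)); last first.
- exact: finite_fset.
- by move=> a b; apply: act_adj => //; exact: line_automorphism_id.
rewrite /act /= fr fv; apply: region_prob_sub => // _ [[w j] wS <-].
have wL : (size (letters w) <= L)%N := S0L wS.
have [s [ps ls ss]] := tree_path_exists w.
have pfs : path (@adjT d) (f root) (map f s).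
  elim: s (root) ps {ls ss} => //= b s IH a /andP[ab bs].
  by rewrite fa.2 ab IH.
have lfs : last (f root) (map f s) = f w by rewrite last_map ls.
split=> /=.
  rewrite -lfs; apply: (in_cone_path (i := i) pfs); rewrite ?fr //.
  - by apply: anc_cone; lia.
  - by rewrite size_map ss; lia.
left; split; last exact: (S0H wS).
have := path_adjT_size pfs; rewrite lfs fr si size_map ss; lia.
Qed.

Let q_blocks j : (j <= k)%N -> t ^+ j <= q L (L + n * j).
Proof.
elim: j => [|j IH] jk.
  rewrite muln0 addn0 expr0 /q region_prob_id //; apply: anc_layer.
  by rewrite /m; lia.
have njk : (n * j + n <= n * k)%N by rewrite -mulnSr leq_mul2l jk orbT.
rewrite mulnSr addnA exprSr; apply: le_trans (q_trans L (L + n * j) _).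
apply: ler_pM; rewrite ?exprn_ge0 //; first by apply: IH; exact: ltnW.
by apply: q_block; rewrite /m; lia.
Qed.

(** A straight path of length [L], [k] translates of the connection in [S0],
    and a straight path of length [L + 1]; the extra step keeps the translates
    strictly above the bottom of the layer. *)
Lemma reach_lower_bound :
  p ^+ (2 * L + 1) * t ^+ k <= region_prob adj p (layer m H u) (u, 0) (x, 0).
Proof.
have -> : region_prob adj p (layer m H u) (u, 0) (x, 0) = q 0 m.
  by rewrite /q anc0 ancm.
case/andP: (p01) => p0 _.
have h1 : p ^+ L <= q 0 L by apply: (@q_straight 0 L); rewrite /m; lia.
have h2 : t ^+ k <= q L (L + n * k) by exact: q_blocks.
have h3 : p ^+ (L + 1) <= q (L + n * k) m.
  have -> : m = (L + n * k + (L + 1))%N by rewrite /m; lia.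
  by apply: q_straight; rewrite /m; lia.
apply: le_trans (q_trans 0 (L + n * k) m).
apply: le_trans (ler_wpM2r (q_ge0 _ _) (q_trans 0 L (L + n * k))).
have -> : p ^+ (2 * L + 1) * t ^+ k = p ^+ L * t ^+ k * p ^+ (L + 1).
  by rewrite mulrAC -exprD; congr (_ ^+ _ * _); lia.
by apply: ler_pM; rewrite ?mulr_ge0 ?exprn_ge0 //; apply: ler_pM; rewrite ?exprn_ge0.
Qed.
End Reach.

(** The expected number of descendants reached is at least [(D * p) ^+ (2 * L
    + 1) * (D ^+ n * t) ^+ k], which exceeds one for [k] large. *)
Lemma region_percolates :
  {ae bernoulli_measure (edge adj) p, forall w, infinite_cluster_exists w}.
Proof.
have D0 : 0 < D by rewrite /D ltr0n; lia.
have t0 : 0 < t by rewrite -(pmulr_rgt0 _ (exprn_gt0 n D0)); apply: lt_trans tD.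
have s0 : 0 < D ^+ n * t by apply: lt_trans tD.
have [||k hk] := @exprn_small R (D ^+ n * t)^-1 ((D * p) ^+ (2 * L + 1)).
- by rewrite invr_ge0 ltW //= invf_lt1.
- by rewrite exprn_gt0 // mulr_gt0.
pose m := (n * k + (2 * L + 1))%N.
apply: (@supercritical_percolates d m H R p d_gt2 p01 _ (p ^+ (2 * L + 1) * t ^+ k)).
- by rewrite /m; lia.
- by move=> u x _ xu; exact: reach_lower_bound.
- have := hk k (leqnn _); rewrite exprVn -div1r ltr_pdivrMr ?exprn_gt0 //.
  rewrite natrX -/D /m !exprMn -exprM; set a := (2 * L + 1)%N.
  by rewrite (_ : D ^+ a * p ^+ a * _ = D ^+ (n * k + a) * (p ^+ a * t ^+ k)) // exprD; ring.
Qed.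
End Renormalization.

(** * Fekete's lemma and the critical exponent *)

Section Fekete.
Variables (R : realType) (a : nat -> R).
Hypotheses (a0 : a 0 = 1) (a_gt0 : forall n, 0 < a n) (a_le1 : forall n, a n <= 1)
  (a_supermult : forall m n, a m * a n <= a (m + n)%N).

Let rate n := a n `^ n%:R^-1.

Let rate_ge0 n : 0 <= rate n. Proof. exact: powR_ge0. Qed.

Let rateX n : (0 < n)%N -> rate n ^+ n = a n.
Proof.
move=> n0; rewrite -powR_mulrn // -powRrM mulVf ?powRr1 ?ltW //.
by rewrite pnatr_eq0 -lt0n.
Qed.

Let lt_rate t n : 0 <= t -> (0 < n)%N -> (t < rate n) = (t ^+ n < a n).
Proof. by move=> t0 n0; rewrite -(rateX n0) ltr_pXn2r ?nnegrE. Qed.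

Let rates : set R := [set rate n | n in [set n | (0 < n)%N]].

Let rates_sup : has_sup rates.
Proof.
split; first by exists (rate 1), 1%N.
exists 1 => _ [n n0 <-]; rewrite leNgt; apply/negP.
by rewrite lt_rate // expr1n ltNge a_le1.
Qed.

Let A := sup rates.

Let rate_le n : (0 < n)%N -> rate n <= A.
Proof. by move=> n0; apply: ub_le_sup; [exact: rates_sup.2|exists n]. Qed.

Let a_ge_pow m n : a m ^+ n <= a (m * n).
Proof.
elim: n => [|n IH]; first by rewrite muln0 a0.
rewrite exprSr mulnSr; apply: le_trans (a_supermult _ _).
by rewrite ler_wpM2r // ltW.
Qed.

Let lt_sup t : 0 <= t -> t < A -> exists2 n, (0 < n)%N & t ^+ n < a n.
Proof.
move=> t0 tA; have At : 0 < A - t by rewrite subr_gt0.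
have [_ [n n0 <-]] := sup_adherent At rates_sup.
by rewrite subKr lt_rate //; exists n.
Qed.

Let A_gt0 : 0 < A.
Proof.
apply: lt_le_trans (rate_le (ltn0Sn 0)).
by rewrite lt_rate // expr1.
Qed.

Let A_le1 : A <= 1.
Proof.
apply: ge_sup; first exact: rates_sup.1.
move=> _ [n n0 <-]; rewrite leNgt; apply/negP.
by rewrite lt_rate // expr1n ltNge a_le1.
Qed.

Let rate_cvg : rate @ \oo --> A.
Proof.
apply/cvgrPdist_lt => e e0.
(* [A - e < t' < t < A]: the gap between [t'] and [t] absorbs the constant *)
pose s := Num.max 0 (A - e).
have s0 : 0 <= s by rewrite le_max lexx.
have sAe : A - e <= s by rewrite le_max lexx orbT.
have sA : s < A by rewrite gt_max A_gt0 ltrBlDr ltrDl.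
pose t' := (s + A) / 2; pose t := (t' + A) / 2.
have t'0 : 0 < t' by rewrite /t'; have := A_gt0; lra.
have t't : t' < t by rewrite /t /t'; lra.
have t0 : 0 < t by apply: lt_trans t't.
have tA : t < A by rewrite /t /t'; lra.
have [n0 n0_gt0 tn0] := lt_sup (ltW t0) tA.
have c0 : 0 < a 1 ^+ n0 by exact: exprn_gt0.
have [|n1 hn1] := @exprn_small R (t' / t) (a 1 ^+ n0) _ c0.
  by rewrite divr_ge0 ?(ltW t'0) ?(ltW t0) //= ltr_pdivrMr ?mul1r.
exists (maxn 1 n1) => // n /=; rewrite geq_max => /andP[n_gt0 n1n].
rewrite ger0_norm ?subr_ge0 ?rate_le // ltrBlDr -ltrBlDl.
apply: le_lt_trans (_ : t' < _); first by rewrite /t'; lra.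
rewrite lt_rate ?(ltW t'0) //.
have := hn1 n n1n.
rewrite exprMn exprVn ltr_pdivrMr ?exprn_gt0 // => h; apply: (lt_le_trans h).
rewrite {2}(divn_eq n n0) [(_ * n0)%N]mulnC.
apply: le_trans (a_supermult _ _); rewrite mulrC.
have tle1 : t <= 1 by apply: le_trans (ltW tA) A_le1.
apply: ler_pM; [exact: exprn_ge0 (ltW t0)|exact: ltW| |].
- apply: le_trans (_ : t ^+ (n0 * (n %/ n0)) <= _).
    by apply: ler_wiXn2l; rewrite ?(ltW t0) //; rewrite mulnC leq_trunc_div.
  apply: le_trans (a_ge_pow _ _); rewrite exprM.
  by apply: lerXn2r; rewrite ?nnegrE ?exprn_ge0 ?ltW.
- apply: le_trans (_ : a 1 ^+ (n %% n0) <= _).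
    by apply: ler_wiXn2l; [exact: ltW|exact: a_le1|exact/ltnW/ltn_pmod].
  by have := a_ge_pow 1 (n %% n0); rewrite mul1n.
Qed.

(** If [t ^+ n0 < a n0] with [n0] positive, Euclidean division by [n0] and
    supermultiplicativity bound [a n] below by a constant times [t ^+ n], and
    the constant disappears in the [n]-th root. *)
Lemma fekete : exists A : R, [/\ 0 < A, rate @ \oo --> A,
  forall n, a n <= A ^+ n &
  forall t, 0 <= t -> t < A -> exists2 n, (0 < n)%N & t ^+ n < a n].
Proof.
exists A; split; [exact: A_gt0|exact: rate_cvg| |exact: lt_sup].
case=> [|n]; first by rewrite a0.
by rewrite -(@rateX n.+1) // lerXn2r ?nnegrE ?rate_le // ltW ?A_gt0.
Qed.
End Fekete.

Section Main.
Variable d : nat.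
Hypothesis d_gt2 : (2 < d)%N.
Variable R : realType.
Local Notation root := (tree_root d).
Local Notation adj := (@tree_line d).
Local Notation o := ((root, 0) : tree d * int).
Local Notation pc := (critical_prob adj R).

Lemma percolates_at_one : 0 <= (1 : R) <= 1 /\
  {ae bernoulli_measure (edge adj) (1 : R), forall w, infinite_cluster_exists w}.
Proof.
have p01 : 0 <= (1 : R) <= 1 by rewrite ler01 lexx.
split=> //; have [x x1] := word_exists d_gt2 1.
pose S0 := [fset o; (x, 0)]%fset.
apply: (region_percolates d_gt2 p01 ltr01 (n := 1) (v := x) (S0 := S0)) => //.
have ox : adj o (x, 0).
  rewrite /tree_line /box /= andbT; apply/orP; right; apply/adjTP; right.
  by case: (letters x) x1 => [|a []] // _; exists a.
have h : 1 <= region_prob adj 1 [set` S0] o (x, 0) :> R.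
  apply: region_prob_edge => //=; rewrite ?in_fset2 ?eqxx ?orbT //.
  exact: tree_line_sym.
apply: lt_le_trans (_ : (d.-1)%:R <= _); first by rewrite ltr1n; lia.
by rewrite expr1 ler_peMr.
Qed.
End Main.

Theorem corollary1p7 (R : realType) (d : nat) (hd : (3 <= d)%N)
    (v : nat -> tree d)
    (hv : forall n : nat, at_distance (@adjT d) (tree_root d) (v n) n) :
  alpha v (critical_prob (@tree_line d) R) = 1 / (d%:R - 1).
Proof.
have perc1 := percolates_at_one hd R.
set p := critical_prob _ _.
have p01 : 0 <= p <= 1 := critical_prob01 perc1.
have p_gt0 : 0 < p := critical_prob_gt0 hd perc1.
have sv n : size (letters (v n)) = n by exact: at_distance_root.
pose o := (tree_root d, 0 : int).
pose a n := connection_prob (@tree_line d) p o (v n, 0).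
have a_le1 n : a n <= 1 by exact: connection_prob_le1.
have a_gt0 n : 0 < a n.
  by apply: lt_le_trans (connection_prob_tree p01 (v n) 0); exact: exprn_gt0.
have a0 : a 0 = 1.
  apply/eqP; rewrite eq_le a_le1 /=.
  by have := connection_prob_tree p01 (v 0) 0; rewrite sv expr0.
have a_super m n : a m * a n <= a (m + n)%N.
  by apply: connection_prob_supermult; rewrite // !sv.
have [A [A0 cvgA aA ltA]] := fekete a0 a_gt0 a_le1 a_super.
have -> : alpha v p = A by apply: cvg_lim.
have -> : d%:R - 1 = (d.-1)%:R :> R by rewrite -[in LHS](prednK (ltnW (ltnW hd))) -addn1 natrD addrK.
have D0 : 0 < (d.-1)%:R :> R by rewrite ltr0n; lia.
rewrite div1r; apply/eqP; rewrite eq_le; apply/andP; split; rewrite leNgt; apply/negP.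
- move=> DA.
  have Dinv0 : 0 <= (d.-1)%:R^-1 :> R by rewrite invr_ge0 ltW.
  have [n n0 Dn] := ltA _ Dinv0 DA.
  have [S hS] := connection_lt_region p01 Dn.
  have cont : {for p, continuous (fun q => region_prob (@tree_line d) q [set` S] o (v n, 0))}.
    apply: expect_continuous; apply: finitary_connR; exact: finite_fset.
  have near1 : \forall q \near p, (d.-1)%:R^-1 ^+ n <
      region_prob (@tree_line d) q [set` S] o (v n, 0).
    exact: (cvgr_gt _ cont _ hS).
  have [e /= e0 he] := (nbhs_normP _ _).1 near1.
  (* a positive parameter below [p], within the neighbourhood of radius [e] *)
  pose q := p - Num.min e p / 2.
  have m0 : 0 < Num.min e p by rewrite lt_min e0.
  have me : Num.min e p <= e by rewrite ge_min lexx.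
  have mp : Num.min e p <= p by rewrite ge_min lexx orbT.
  have q_gt0 : 0 < q by rewrite /q; lra.
  have q01 : 0 <= q <= 1 by case/andP: p01 => _ p1; rewrite /q; lra.
  have hq : (d.-1)%:R^-1 ^+ n < region_prob (@tree_line d) q [set` S] o (v n, 0).
    by apply: he; rewrite /= /q opprB addrC subrK ger0_norm; lra.
  have : p <= q.
    apply: percolates_ge_critical; split=> //.
    apply: (region_percolates hd q01 q_gt0 n0 (sv n) (S0 := S)).
    by move: hq; rewrite exprVn -div1r ltr_pdivrMr ?exprn_gt0 // mulrC.
  by rewrite /q; lra.
- rewrite -div1r ltr_pdivlMr // mulrC => DA.
  have tauA x : connection_prob (@tree_line d) p o (x, 0) <= A ^+ size (letters x).
    by apply: le_trans (aA _); rewrite (connection_prob_sphere p01 (y := v (size (letters x)))) ?sv.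
  have [S [oS flow]] := small_flow hd p01 p_gt0 (ltW A0) DA tauA.
  by have := critical_flow hd perc1 oS; rewrite leNgt flow.
Qed.
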